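(* Let $\mathcal{T}$ be an irreducible tredoku tiling with $\tau$ tiles and $\rho$ runs. Irreducible tredoku tilings exist with $(\tau,\rho)=(5,2)$ and with $(\tau,\rho)=(7,3)$. For any other irreducible tredoku tiling, \[ 2\rho-3 \le \tau \le 2\rho. \] Conversely, for each $k\in\{0,1,2,3\}$ and every integer $\rho\ge 3+k$, there exists an irreducible tredoku tiling with $\rho$ runs and $\tau=2\rho-k$ tiles.
   Context: A tile is a closed rhombus of unit side with interior angles $60^\circ$ and $120^\circ$, placed so that its edges lie on a fixed triangular lattice of the plane (three possible orientations). Two tiles are adjacent if they share a full common edge. A run is a maximal sequence $T_1,\dots,T_k$ ($k\ge 2$) of distinct tiles such that $T_i$ and $T_{i+1}$ share an edge $e_i$, all the $e_i$ are parallel, and for $1<i<k$ the edges $e_{i-1},e_i$ are opposite edges of $T_i$; $T_1,T_k$ are its end tiles. A tredoku tiling is a finite set of $\tau\ge5$ tiles such that: (P1) the graph on the tiles with edges given by adjacency is connected; (P2) any two tiles are disjoint, meet in exactly one common vertex, or share a full common edge; (P3) after removing any single tile, the remaining tiles are still connected, where two tiles are considered joined if they have nonempty intersection; (P4/P5) every run consists of exactly three tiles; and (no holes) the complement of the union of the tiles is connected. $\rho$ denotes the number of runs. An $i$-tile is a tile adjacent to exactly $i$ other tiles. The spine of the tiling is the set of its $3$-tiles and $4$-tiles; the tiling is irreducible if the spine is connected under adjacency (any two spine tiles are joined by a sequence of spine tiles, consecutive ones adjacent), and reducible otherwise. *)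

(* Defs.v *)
From HB Require Import structures.
From Stdlib Require Import Relation_Operators.
From mathcomp Require Import all_boot all_order all_algebra finmap.
From mathcomp Require Import all_classical all_reals all_analysis.

Set Implicit Arguments.
Unset Strict Implicit.
Unset Printing Implicit Defensive.

Import Order.TTheory GRing.Theory Num.Theory.
Import numFieldNormedType.Exports.

Local Open Scope classical_set_scope.
Local Open Scope ring_scope.

(* [(a, b) : node] is the lattice point a u + b v, where u = (1, 0) and
   v = (1/2, sqrt 3 / 2). *)
Definition node : Type := (int * int)%type.

Definition node_pt (R : realType) (z : node) : R * R :=
  (z.1%:~R + z.2%:~R / 2, z.2%:~R * (Num.sqrt 3 / 2)).

(* The three edge directions u, v and w = v - u, at angles 0, 60, 120 degrees. *)
Definition dir (d : 'I_3) : node :=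
  if val d is 0%N then (1, 0) else if val d is 1%N then (0, 1) else (-1, 1).

(* [(p, d) : edge] is the lattice edge from p to p + dir d. *)
Definition edge : Type := (node * 'I_3)%type.

Definition segment (R : realType) (e : edge) : set (R * R) :=
  [set x | exists2 a : R, 0 <= a <= 1 &
     x = node_pt R e.1 + a *: node_pt R (dir e.2)].
Arguments segment : clear implicits.

Definition parallel (e f : edge) : bool := e.2 == f.2.

(* [(p, o) : tile] is the unit rhombus with corner p spanned by the two edge
   directions other than o; these are [ordS o] and [ord_pred o].  Every
   lattice rhombus has exactly one such code. *)
Definition tile : Type := (node * 'I_3)%type.

Definition rhombus (R : realType) (t : tile) : set (R * R) :=
  [set x | exists a b : R, [/\ 0 <= a <= 1, 0 <= b <= 1 &
     x = node_pt R t.1 + a *: node_pt R (dir (ordS t.2))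
                       + b *: node_pt R (dir (ord_pred t.2))]].
Arguments rhombus : clear implicits.

Definition corners (t : tile) : seq node :=
  let p := t.1 in let d := dir (ordS t.2) in let d' := dir (ord_pred t.2) in
  [:: p; p + d; p + d'; p + d + d'].

Definition edges (t : tile) : seq edge :=
  let p := t.1 in let d := ordS t.2 in let d' := ord_pred t.2 in
  [:: (p, d); (p + dir d', d); (p, d'); (p + dir d, d')].

Definition opposite_edges (t : tile) (e f : edge) : bool :=
  [&& e \in edges t, f \in edges t, e != f & parallel e f].

Definition common_edge (s t : tile) (e : edge) : bool :=
  (e \in edges s) && (e \in edges t).

Definition tile_adjacent (s t : tile) : bool :=
  (s != t) && has (fun e => e \in edges t) (edges s).

Definition touching (R : realType) (s t : tile) : Prop :=
  rhombus R s `&` rhombus R t !=set0.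

Definition connected_under (r : tile -> tile -> Prop) (A : {fset tile}) : Prop :=
  forall s t, s \in A -> t \in A ->
    clos_refl_trans tile (fun x y => [/\ x \in A, y \in A & r x y]) s t.

(* [es] lists the edges e_1, ..., e_(k-1) along the sequence [s] of tiles
   T_1, ..., T_k, with both lists indexed from 0. *)
Definition run_edges (s : seq tile) (es : seq edge) : Prop :=
  let T i := nth ((0, 0), ord0) s i in
  let e i := nth ((0, 0), ord0) es i in
  [/\ (size es).+1 = size s,
      forall i, (i < size es)%N -> common_edge (T i) (T i.+1) (e i),
      {in es &, forall f g, parallel f g} &
      forall i, (i.+1 < size es)%N -> opposite_edges (T i.+1) (e i) (e i.+1)].

Definition pre_run (T : {fset tile}) (s : seq tile) : Prop :=
  [/\ (2 <= size s)%N, uniq s, {subset s <= T} & exists es, run_edges s es].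

Definition is_run (T : {fset tile}) (s : seq tile) : Prop :=
  pre_run T s /\ forall s', pre_run T s' -> infix s s' -> s' = s.

(* A run read backwards is the same run, so runs are counted as unordered
   pairs {s, rev s}. *)
Definition runs (T : {fset tile}) : set {fset seq tile} :=
  [set [fset s; rev s]%fset | s in [set s | is_run T s]].

Lemma finite_runs (T : {fset tile}) : finite_set (runs T).
Proof.
apply: finite_image.
apply: (@sub_finite_set _ _ (range (fun b : #|` T|%fset.-bseq T => map val b))).
  move=> s /= [[_ us sT _] _].
  have le_s : (size (pmap (insub : tile -> option T) s) <= #|` T|%fset)%N.
    by rewrite size_pmap_sub (leq_trans (count_size _ _)) ?uniq_leq_size.
  exists (Bseq le_s) => //=.
  have : all [in T] s by apply/allP.
  elim: s {us sT le_s} => //= x s IHs /andP[xT sT].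
  by rewrite insubT /= IHs.
by apply: finite_image; apply: finite_finset.
Qed.

Definition num_runs (T : {fset tile}) : nat := #|` fset_set (runs T)|%fset.

Definition properly_meeting (R : realType) (s t : tile) : Prop :=
  let I := rhombus R s `&` rhombus R t in
  [\/ I = set0,
      exists v, [/\ v \in corners s, v \in corners t & I = [set node_pt R v]]
    | exists e, common_edge s t e /\ I = segment R e].

Record tredoku_tiling (R : realType) (T : {fset tile}) : Prop := {
  tredoku_size : (5 <= #|` T|%fset)%N;
  tredoku_connected : connected_under tile_adjacent T;
  tredoku_meeting : {in T &, forall s t, s != t -> properly_meeting R s t};
  tredoku_2connected : forall t, t \in T -> connected_under (touching R) (T `\ t)%fset;
  tredoku_runs : forall s, is_run T s -> size s = 3%N;
  tredoku_no_holes : connected (~` \bigcup_(t in [set` T]) rhombus R t)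
}.

Definition tile_degree (T : {fset tile}) (t : tile) : nat :=
  #|` [fset s in T | tile_adjacent s t]|%fset.

Definition spine (T : {fset tile}) : {fset tile} :=
  [fset t in T | (tile_degree T t == 3%N) || (tile_degree T t == 4%N)]%fset.

Definition irreducible_tredoku (R : realType) (T : {fset tile}) : Prop :=
  tredoku_tiling R T /\ connected_under tile_adjacent (spine T).

(* Main.v *)
Require Import Defs.
From HB Require Import structures.
From Stdlib Require Import Relation_Operators.
From mathcomp Require Import all_boot all_order all_algebra finmap.
From mathcomp Require Import all_classical all_reals all_analysis.
From mathcomp Require Import zify ring lra.

(* A rhombus is a pair of adjacent lattice triangles, so that a tiling is a
   matching in the honeycomb graph of triangles, and the topological hypotheses
   become combinatorial: distinct tiles share no triangle, and the uncovered
   triangles are connected through edges.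

   Each shared edge joins the middle tile of a run to one of its ends.  If a tile
   were the middle of one run and had no other neighbours, a closed lattice curve
   through the remaining tiles would separate its two free sides (parity of
   crossings), so this never happens.  Counting middles and ends then gives
   tau + n_2 = 2 rho + n_4, where n_i is the number of i-tiles.  Every 3-tile is
   the end of exactly one run, and going from ends to middles is a functional
   graph on the spine; as the spine is connected, n_4 <= 1.  The two neighbours of
   a 2-tile are joined in the spine, so by parity again its corner between them is
   surrounded by tiles, and around such a node there are as many 2-tiles as
   4-tiles; hence n_2 <= 4 n_4, which is the lower bound.  If tau > 2 rho, then
   n_4 = 1 and n_2 = 0, no corner of the 4-tile is surrounded, and adding up
   angles at these corners leaves room for at most one 3-tile.

   Conversely, in each family an end tile of a suitable small tiling is turned
   into a 3-tile by adding a leaf on either side of it; alternating between two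
   directions, this continues forever along a staircase. *)

Set Implicit Arguments.
Unset Strict Implicit.
Unset Printing Implicit Defensive.

Import Order.TTheory GRing.Theory Num.Theory.
Import numFieldNormedType.Exports.

(** * The triangular lattice *)

Section Lattice.
Local Open Scope ring_scope.

(** Condition (P3) supplies the closed curve of the first parity argument: a walk through shared
    corners that avoids the tile in question. The second curve runs through the uncovered region
    instead, which is in one piece because there are no holes. Neither curve has to be simple, since
    only the parity with which each edge is used matters.

    The exceptional case rests on an equality. Each corner of the 4-tile has an uncovered sector, so
    at the two ends of its edge with a neighbouring 3-tile the angles add up to at most 10 units of
    60 degrees. These two tiles take 6 and four further tiles take at least 1 each, so nothing else
    fits there.

    For the constructions, absence of holes is preserved by a local test on each added tile: its
    free sides may outnumber its free corners by at most one. *)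

Definition o0 : 'I_3 := @Ordinal 3 0 isT.
Definition o1 : 'I_3 := @Ordinal 3 1 isT.
Definition o2 : 'I_3 := @Ordinal 3 2 isT.

Lemma ord3P (P : 'I_3 -> Prop) : P o0 -> P o1 -> P o2 -> forall d, P d.
Proof.
move=> P0 P1 P2 [[|[|[|//]]] lt_d].
- by rewrite (_ : Ordinal _ = o0) //; apply: val_inj.
- by rewrite (_ : Ordinal _ = o1) //; apply: val_inj.
- by rewrite (_ : Ordinal _ = o2) //; apply: val_inj.
Qed.

Lemma ordSE : (ordS o0 = o1) * (ordS o1 = o2) * (ordS o2 = o0).
Proof. by do 2?split; apply: val_inj. Qed.

Lemma ord_predE : (ord_pred o0 = o2) * (ord_pred o1 = o0) * (ord_pred o2 = o1).
Proof. by do 2?split; apply: val_inj. Qed.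

(* [((x, y), false)] is the triangle p, p + u, p + v and [((x, y), true)] the
   triangle p + u, p + v, p + u + v, where p = (x, y). *)
Definition tri : Type := (node * bool)%type.

(* The triangle on the other side of the edge of [a] in direction [d]. *)
Definition flip (a : tri) (d : 'I_3) : tri :=
  let: ((x, y), b) := a in
  (if b then match val d with 0 => (x, y + 1) | 1 => (x + 1, y) | _ => (x, y) end
   else match val d with 0 => (x, y - 1) | 1 => (x - 1, y) | _ => (x, y) end, ~~ b).

Definition tedge (a : tri) (d : 'I_3) : edge :=
  let: ((x, y), b) := a in
  (match val d, b with
   | 0, false => (x, y) | 0, true => (x, y + 1)
   | 1, false => (x, y) | _, _ => (x + 1, y) end, d).

(** Every lattice edge borders exactly one triangle of each kind, so the boolean that tells the kind
    also selects a side of the edge. *)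
Definition side (e : edge) (b : bool) : tri :=
  let: ((x, y), d) := e in
  (match val d, b with
   | 0, true => (x, y - 1) | 1, true => (x - 1, y)
   | 0, false | 1, false => (x, y) | _, _ => (x - 1, y) end, b).

(* The two halves of a rhombus, which meet along its diagonal of direction
   [t.2]. *)
Definition tri_of (t : tile) (b : bool) : tri :=
  let: ((x, y), o) := t in
  (match val o, b with
   | 0, false => (x - 1, y + 1) | 0, true => (x - 1, y)
   | 1, true => (x - 1, y) | _, _ => (x, y) end, b).

Definition tile_of (a : tri) (o : 'I_3) : tile :=
  let: ((x, y), b) := a in
  (match val o, b with
   | 0, false => (x + 1, y - 1) | 0, true => (x + 1, y)
   | 1, true => (x + 1, y) | _, _ => (x, y) end, o).

Definition verts (a : tri) : seq node :=
  let: ((x, y), b) := a in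
  [:: if b then (x + 1, y + 1) else (x, y); (x + 1, y); (x, y + 1)].

Definition ends (e : edge) : seq node := [:: e.1; e.1 + dir e.2].

Lemma edgesE x y :
  (edges ((x, y), o0) =
     [:: ((x, y), o1); ((x - 1, y + 1), o1); ((x, y), o2); ((x, y + 1), o2)]) *
  (edges ((x, y), o1) =
     [:: ((x, y), o2); ((x + 1, y), o2); ((x, y), o0); ((x - 1, y + 1), o0)]) *
  (edges ((x, y), o2) =
     [:: ((x, y), o0); ((x, y + 1), o0); ((x, y), o1); ((x + 1, y), o1)]).
Proof.
rewrite /edges /= !ordSE !ord_predE /dir /= /GRing.add /= /add_pair /=.
by do 2?split; rewrite !(addr0, add0r).
Qed.

Lemma cornersE x y :
  (corners ((x, y), o0) = [:: (x, y); (x, y + 1); (x - 1, y + 1); (x - 1, y + 2)]) *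
  (corners ((x, y), o1) = [:: (x, y); (x - 1, y + 1); (x + 1, y); (x, y + 1)]) *
  (corners ((x, y), o2) = [:: (x, y); (x + 1, y); (x, y + 1); (x + 1, y + 1)]).
Proof.
rewrite /corners /= !ordSE !ord_predE /dir /= /GRing.add /= /add_pair /=.
by do 2?split; rewrite !(addr0, add0r) -?addrA ?addNr ?addr0.
Qed.

Lemma endsE x y :
  (ends ((x, y), o0) = [:: (x, y); (x + 1, y)]) *
  (ends ((x, y), o1) = [:: (x, y); (x, y + 1)]) *
  (ends ((x, y), o2) = [:: (x, y); (x - 1, y + 1)]).
Proof.
rewrite /ends /dir /= /GRing.add /= /add_pair /=.
by do 2?split; rewrite !(addr0, add0r).
Qed.


Lemma ord3_eqE :
  ((o0 == o1) = false) * ((o0 == o2) = false) * ((o1 == o0) = false) *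
  ((o1 == o2) = false) * ((o2 == o0) = false) * ((o2 == o1) = false).
Proof. by []. Qed.

Lemma flip2 a d : (flip a d).2 = ~~ a.2.
Proof. by case: a => [[x y] b]. Qed.

Lemma flipK a d : flip (flip a d) d = a.
Proof.
case: a => [[x y] []]; elim/ord3P: d => /=; congr ((_, _), _); lia.
Qed.

Lemma flip_injr a : injective (flip a).
Proof.
case: a => [[x y] []]; elim/ord3P => d; elim/ord3P: d => //= => -[]; lia.
Qed.

(* The hexagonal lattice of triangles has no 4-cycle. *)
Lemma flip_flip a d d' e e' : d != d' ->
  flip (flip a d) d' = flip (flip a e) e' -> (d = e) /\ (d' = e').
Proof.
case: a => [[x y] []]; elim/ord3P: d => //; elim/ord3P: d' => //;
  elim/ord3P: e => //; elim/ord3P: e' => //= _ [] => *; lia.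
Qed.

Lemma tri_of2 t b : (tri_of t b).2 = b.
Proof. by case: t => [[x y] o]. Qed.

Lemma tri_of_flip t b : flip (tri_of t b) t.2 = tri_of t (~~ b).
Proof.
case: t b => [[x y] o] []; elim/ord3P: o => /=; congr ((_, _), _); lia.
Qed.

Lemma tri_of_tile_of a o : tri_of (tile_of a o) a.2 = a.
Proof.
case: a => [[x y] []]; elim/ord3P: o => /=; congr ((_, _), _); lia.
Qed.

Lemma tile_of_tri_of t b : tile_of (tri_of t b) t.2 = t.
Proof.
case: t b => [[x y] o] []; elim/ord3P: o => /=; congr ((_, _), _); lia.
Qed.

Lemma tedge2 a d : (tedge a d).2 = d.
Proof. by case: a => [[x y] b]. Qed.

Lemma side_flip e b : flip (side e b) e.2 = side e (~~ b).
Proof.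
case: e b => [[x y] o] []; elim/ord3P: o => /=; congr ((_, _), _); lia.
Qed.

Lemma side_tedge a d : side (tedge a d) a.2 = a.
Proof.
case: a => [[x y] []]; elim/ord3P: d => /=; congr ((_, _), _); lia.
Qed.

Lemma tedge_side e b : tedge (side e b) e.2 = e.
Proof.
case: e b => [[x y] o] []; elim/ord3P: o => /=; congr ((_, _), _); lia.
Qed.

Lemma mem_edges e t :
  (e \in edges t) = (e.2 != t.2) && [exists b, side e b == tri_of t b].
Proof.
have -> : [exists b, side e b == tri_of t b] =
    (side e false == tri_of t false) || (side e true == tri_of t true).
  apply/existsP/orP => [[[] ->]|[]]; [by right|by left|by exists false|by exists true].
case: e t => [[x y] d] [[x' y'] o].
elim/ord3P: o; elim/ord3P: d; rewrite edgesE /= !inE !xpair_eqE ?eqxx ?ord3_eqE /=; lia.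
Qed.

Lemma mem_corners n t :
  (n \in corners t) = (n \in verts (tri_of t false)) || (n \in verts (tri_of t true)).
Proof.
case: n t => [a b] [[x y] o].
elim/ord3P: o; rewrite cornersE /= !inE !xpair_eqE; lia.
Qed.

Lemma mem_ends n e :
  (n \in ends e) = (n \in verts (side e false)) && (n \in verts (side e true)).
Proof.
case: n e => [a b] [[x y] o].
elim/ord3P: o; rewrite endsE /= !inE !xpair_eqE; lia.
Qed.

End Lattice.

(** * Rhombi as unions of triangles *)

Section Geometry.
Local Open Scope classical_set_scope.
Local Open Scope ring_scope.
Variable R : realType.

(* Coordinates with respect to the basis u, v. *)
Definition sx (P : R * R) : R := P.1 - P.2 / Num.sqrt 3.
Definition sy (P : R * R) : R := 2 * P.2 / Num.sqrt 3.

Lemma sqrt3_neq0 : Num.sqrt (3 : R) != 0.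
Proof. by rewrite sqrtr_eq0 -ltNge ltr0n. Qed.

Lemma sx_node z : sx (node_pt R z) = z.1%:~R.
Proof.
rewrite /sx /node_pt /=; have h := sqrt3_neq0.
by field.
Qed.

Lemma sy_node z : sy (node_pt R z) = z.2%:~R.
Proof.
rewrite /sy /node_pt /=; have h := sqrt3_neq0.
by field.
Qed.

Lemma sxD P Q : sx (P + Q) = sx P + sx Q.
Proof. by rewrite /sx /= mulrDl; lra. Qed.

Lemma syD P Q : sy (P + Q) = sy P + sy Q.
Proof. by rewrite /sy /= mulrDr mulrDl. Qed.

Lemma sxZ a P : sx (a *: P) = a * sx P.
Proof. by rewrite /sx /= /GRing.scale /= mulrBr mulrA. Qed.

Lemma syZ a P : sy (a *: P) = a * sy P.
Proof. by rewrite /sy /= /GRing.scale /= mulrCA !mulrA. Qed.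

Lemma sxy_inj P Q : sx P = sx Q -> sy P = sy Q -> P = Q.
Proof.
have h := sqrt3_neq0.
case: P Q => [a b] [c d]; rewrite /sx /sy /= => h1 h2.
have bd : b = d by apply: (mulfI (x := 2 / Num.sqrt 3)); rewrite ?mulf_neq0 ?invr_eq0 //; lra.
by subst d; congr pair; lra.
Qed.

Definition in_tri (a : tri) (P : R * R) : bool :=
  let: ((x, y), b) := a in
  if b then [&& sx P <= x%:~R + 1, sy P <= y%:~R + 1 & x%:~R + y%:~R + 1 <= sx P + sy P]
  else [&& x%:~R <= sx P, y%:~R <= sy P & sx P + sy P <= x%:~R + y%:~R + 1].

Lemma dirE : (dir o0 = (1, 0)) * (dir o1 = (0, 1)) * (dir o2 = (-1, 1)).
Proof. by []. Qed.

Definition skE := (sxD, syD, sxZ, syZ, sx_node, sy_node, dirE, rmorphD, rmorphB, rmorphN, rmorph1,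
  mulr1, mulr0, mulrN1, add0r, addr0).

Lemma rhombusP t P :
  rhombus R t P <-> in_tri (tri_of t false) P \/ in_tri (tri_of t true) P.
Proof.
case: t => [[x y] o]; split.
  case=> a [b] [/andP[a0 a1] /andP[b0 b1] ->].
  elim/ord3P: o; rewrite /= ?ordSE ?ord_predE ?skE /= ?skE.
  - by have [h|h] := leP (a + b) 1; [right|left]; apply/and3P; split; lra.
  - by have [h|h] := leP a b; [left|right]; apply/and3P; split; lra.
  - by have [h|h] := leP (a + b) 1; [left|right]; apply/and3P; split; lra.
elim/ord3P: o => /=; rewrite ?skE => h.
- exists (sx P + sy P - x%:~R - y%:~R), (x%:~R - sx P); split.
  + by case: h => /and3P[? ? ?]; lra.
  + by case: h => /and3P[? ? ?]; lra.
  + by apply: sxy_inj; rewrite ?skE /= ?ordSE ?ord_predE ?skE /= ?skE; lra.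
- exists (sy P - y%:~R), (sx P + sy P - x%:~R - y%:~R); split.
  + by case: h => /and3P[? ? ?]; lra.
  + by case: h => /and3P[? ? ?]; lra.
  + by apply: sxy_inj; rewrite ?skE /= ?ordSE ?ord_predE ?skE /= ?skE; lra.
- exists (sx P - x%:~R), (sy P - y%:~R); split.
  + by case: h => /and3P[? ? ?]; lra.
  + by case: h => /and3P[? ? ?]; lra.
  + by apply: sxy_inj; rewrite ?skE /= ?ordSE ?ord_predE ?skE /= ?skE; lra.
Qed.

Lemma segmentP e P :
  segment R e P <-> in_tri (side e false) P && in_tri (side e true) P.
Proof.
case: e => [[x y] d]; split.
  case=> a /andP[a0 a1] ->.
  by elim/ord3P: d; rewrite /= ?skE /= ?skE; apply/andP; split; apply/and3P; split; lra.
elim/ord3P: d => /=; rewrite ?skE => /andP[/and3P[? ? ?] /and3P[? ? ?]].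
- exists (sx P - x%:~R); first by lra.
  by apply: sxy_inj; rewrite ?skE /= ?skE; lra.
- exists (sy P - y%:~R); first by lra.
  by apply: sxy_inj; rewrite ?skE /= ?skE; lra.
- exists (sy P - y%:~R); first by lra.
  by apply: sxy_inj; rewrite ?skE /= ?skE; lra.
Qed.

Lemma in_tri_node a n : in_tri a (node_pt R n) = (n \in verts a).
Proof.
case: a n => [[x y] b] [m n]; rewrite /= !sx_node !sy_node /= !inE !xpair_eqE.
have i1 (k : int) : k%:~R + 1 = (k + 1)%:~R :> R by rewrite intrD.
by case: b; rewrite -!intrD !i1 !ler_int ?xpair_eqE; lia.
Qed.

(** A triangle touches twelve others, three across its edges and nine at a single vertex. The
    inequalities bound the integer offset of the two triangles, which leaves finitely many cases. *)
Lemma in_tri2 a b P : in_tri a P -> in_tri b P ->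
  [\/ a = b, exists d, b = flip a d |
      exists n, [/\ n \in verts a, n \in verts b & P = node_pt R n]].
Proof.
wlog: a b / (a.2 ==> b.2).
  case: (boolP (a.2 ==> b.2)) => [h /(_ _ _ h) //|h hw ha hb].
  have /hw/(_ hb ha) : b.2 ==> a.2 by case: (a.2) (b.2) h => [] [].
  case=> [->|[d ->]|[n [? ? ?]]].
  - by constructor 1.
  - by constructor 2; exists d; rewrite flipK.
  - by constructor 3; exists n.
have le (m n : int) : m%:~R <= n%:~R + 1 :> R -> m <= n + 1.
  by rewrite (_ : n%:~R + 1 = (n + 1)%:~R) ?ler_int // intrD.
have le' (m n m' n' : int) : m%:~R + n%:~R <= m'%:~R + n'%:~R + 1 :> R -> m + n <= m' + n' + 1.
  by rewrite -!intrD; apply: le.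
have node (m n : int) Q : sx Q = m%:~R -> sy Q = n%:~R -> Q = node_pt R (m, n).
  by move=> h1 h2; apply: sxy_inj; rewrite ?sx_node ?sy_node.
case: a b => [[x y] s] [[x' y'] s'] /= hss ha hb.
have key : (s = s' -> `|x' - x| <= 1 /\ `|y' - y| <= 1 /\ `|x' + y' - (x + y)| <= 1) /\
    (s' && ~~ s -> x <= x' + 1 /\ y <= y' + 1 /\ x' + y' <= x + y).
  split; first move=> hs; subst.
    have [h1 h2 h3 h4] : [/\ x <= x' + 1, x' <= x + 1, y <= y' + 1 & y' <= y + 1].
      case: s' {hss} ha hb => /and3P[? ? ?] /and3P[? ? ?]; split; apply: le; lra.
    have h5 : x + y <= x' + y' + 1.
      by case: s' {hss} ha hb => /and3P[? ? ?] /and3P[? ? ?]; apply: le'; lra.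
    have h6 : x' + y' <= x + y + 1.
      by case: s' {hss} ha hb => /and3P[? ? ?] /and3P[? ? ?]; apply: le'; lra.
    by lia.
  case: s' s {hss} ha hb => [] [] //= /and3P[? ? ?] /and3P[? ? ?] _.
  have h1 : x <= x' + 1 by apply: le; lra.
  have h2 : y <= y' + 1 by apply: le; lra.
  have h3 : x' + y' <= x + y by rewrite -(ler_int R) !intrD; lra.
  by lia.
have vtx (m n : int) : (m, n) \in verts ((x, y), s) -> (m, n) \in verts ((x', y'), s') ->
    sx P = m%:~R -> sy P = n%:~R -> [\/ ((x, y), s) = ((x', y'), s') :> tri,
    exists d, ((x', y'), s') = flip ((x, y), s) d |
      exists n, [/\ n \in verts ((x, y), s), n \in verts ((x', y'), s') & P = node_pt R n]].
  by move=> h1 h2 h3 h4; constructor 3; exists (m, n); split=> //; apply: node.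
(* The offsets that [key] permits: seven for triangles of the same kind, six for different kinds. *)
have cases (Q : Prop) :
    (forall dx dy : int, x' = x + dx -> y' = y + dy ->
       ((s == s') && ((dx, dy) \in [:: (0, 0); (1, 0); (1, -1); (0, 1); (-1, 1); (-1, 0); (0, -1)]))
       || (s != s') && ((dx, dy) \in [:: (-1, -1); (-1, 0); (-1, 1); (0, -1); (0, 0); (1, -1)]) -> Q) -> Q.
  apply; first (by rewrite addrC; symmetry; exact: (subrK x x'));
    first (by rewrite addrC; symmetry; exact: (subrK y y')).
  case: key => k1 k2; rewrite !inE !xpair_eqE.
  by case: s s' hss {ha hb vtx} k1 k2 => [] [] //= _ k1 k2;
    [have := k1 erefl|have := k2 isT|have := k1 erefl]; lia.
apply: cases => dx dy ? ?; subst x' y'.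
case: s s' hss ha hb {key} vtx => [] [] //= _ /and3P[a1 a2 a3] /and3P[b1 b2 b3] vtx;
  rewrite ?orbF !inE !xpair_eqE => h;
  repeat (case/orP: h => h); case/andP: h => /eqP ? /eqP ?; subst dx dy;
  rewrite ?skE in b1 b2 b3;
  first [ by rewrite !addr0; constructor 1
        | by constructor 2; rewrite ?addr0; first [by exists o0|by exists o1|by exists o2]
        | by apply: (vtx (x + 1) y); [rewrite !inE !xpair_eqE; clear; lia|rewrite !inE !xpair_eqE; clear; lia|rewrite ?skE; lra|rewrite ?skE; lra]
        | by apply: (vtx x (y + 1)); [rewrite !inE !xpair_eqE; clear; lia|rewrite !inE !xpair_eqE; clear; lia|rewrite ?skE; lra|rewrite ?skE; lra]
        | by apply: (vtx x y); [rewrite !inE !xpair_eqE; clear; lia|rewrite !inE !xpair_eqE; clear; lia|rewrite ?skE; lra|rewrite ?skE; lra]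
        | by apply: (vtx (x + 1) (y + 1)); [rewrite !inE !xpair_eqE; clear; lia|rewrite !inE !xpair_eqE; clear; lia|rewrite ?skE; lra|rewrite ?skE; lra]
        ].
Qed.
End Geometry.

(** * Proper meeting of rhombi amounts to sharing no triangle *)

Section Meeting.
Local Open Scope classical_set_scope.
Local Open Scope ring_scope.
Variable R : realType.

Definition overlap (s t : tile) : bool := [exists b, tri_of s b == tri_of t b].

Definition share_corner (s t : tile) : bool :=
  has (fun n => n \in corners t) (corners s).

Lemma rhombus_node t n : rhombus R t (node_pt R n) <-> n \in corners t.
Proof. by rewrite rhombusP !in_tri_node mem_corners; split=> [/orP|/orP]. Qed.

Lemma node_pt_inj : injective (node_pt R).
Proof.
move=> [a b] [c d] h; congr pair; apply: (@intr_inj R).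
  by rewrite -[LHS](sx_node R (a, b)) h sx_node.
by rewrite -[LHS](sy_node R (a, b)) h sy_node.
Qed.

(** A tile lies on one side of each of its edges, and two tiles on the same side would share the
    triangle there. *)
Lemma common_edge_neq s t e : ~~ overlap s t -> common_edge s t e ->
  exists b, side e b = tri_of s b /\ side e (~~ b) = tri_of t (~~ b).
Proof.
rewrite /overlap negb_exists => /forallP ov /andP[].
rewrite !mem_edges => /andP[_ /existsP[b /eqP hb]] /andP[_ /existsP[c /eqP hc]].
exists b; split=> //; case: (eqVneq c b) => [ecb|]; last first.
  by case: b c hb hc => [] [].
by subst c; move: (ov b); rewrite -hb hc eqxx.
Qed.

Lemma side_tedge_of t b d : side (tedge (tri_of t b) d) b = tri_of t b.
Proof. by rewrite -{2}(tri_of2 t b) side_tedge. Qed.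

Lemma side_tedge_ofN t b d : side (tedge (tri_of t b) d) (~~ b) = flip (tri_of t b) d.
Proof. by rewrite -side_flip side_tedge_of tedge2. Qed.

Lemma flip_common_edge s t b d : ~~ overlap s t ->
  tri_of t (~~ b) = flip (tri_of s b) d -> common_edge s t (tedge (tri_of s b) d).
Proof.
move=> ov hd; apply/andP; rewrite !mem_edges !tedge2; split; apply/andP; split.
- apply: contraNneq ov => ds; apply/existsP; exists (~~ b).
  by rewrite hd ds tri_of_flip.
- by apply/existsP; exists b; rewrite side_tedge_of.
- apply: contraNneq ov => dt; apply/existsP; exists b.
  by rewrite -(flipK (tri_of s b) d) -hd dt tri_of_flip negbK.
- by apply/existsP; exists (~~ b); rewrite side_tedge_ofN hd.
Qed.

(** Common edges on different halves of [s] would close a 4-cycle of triangles through the two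
    diagonals. *)
Lemma common_edge_uniq s t e f : ~~ overlap s t ->
  common_edge s t e -> common_edge s t f -> e = f.
Proof.
move=> ov; move: e f.
have wl e f b : side e b = tri_of s b -> side e (~~ b) = tri_of t (~~ b) ->
    side f b = tri_of s b -> side f (~~ b) = tri_of t (~~ b) -> e = f.
  move=> h1 h2 h3 h4; have : e.2 = f.2.
    by apply: (@flip_injr (tri_of s b)); rewrite -{1}h1 -h3 !side_flip h2.
  by move=> h; rewrite -(tedge_side e b) -(tedge_side f b) h1 h3 h.
move=> e f /(common_edge_neq ov)[b [h1 h2]] /(common_edge_neq ov)[c [h3 h4]].
case: (eqVneq b c) => [bc|bc]; first by subst c; apply: (wl e f b).
have {}bc : c = ~~ b by case: b c bc {h1 h2 h3 h4} => [] [].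
subst c; rewrite !negbK in h3 h4.
(* Two paths from the half [b] of [s] to the half [b] of [t]: one by the diagonal of [s] and then
   [f], the other by [e] and then the diagonal of [t]. *)
have h5 : flip (flip (tri_of s b) s.2) f.2 = flip (flip (tri_of s b) e.2) t.2.
  by rewrite tri_of_flip -h3 side_flip negbK h4 -h1 side_flip h2 tri_of_flip negbK.
have fs : s.2 != f.2.
  apply: contraNneq ov => sf; apply/existsP; exists b.
  by rewrite -h4 -{2}(negbK b) -side_flip h3 -sf tri_of_flip negbK.
have [se _] := flip_flip fs h5.
case/negP: ov; apply/existsP; exists (~~ b).
by rewrite -h2 -side_flip h1 -se tri_of_flip.
Qed.

Lemma common_edge_corner s t e n : ~~ overlap s t -> common_edge s t e ->
  n \in corners s -> n \in corners t -> n \in ends e.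
Proof.
move=> ov ce; have := ce; rewrite /common_edge !mem_edges => /andP[/andP[es _] /andP[et _]].
have [b [h1 h2]] := common_edge_neq ov ce.
rewrite -(tile_of_tri_of s b) -(tile_of_tri_of t (~~ b)) -h1 -h2.
move: es et; case: e {h1 h2 ce} => [[x y] d] /=; case: n => [m n].
elim/ord3P: (s.2); elim/ord3P: (t.2); elim/ord3P: d => //= _ _; case: b => /=;
  rewrite !cornersE !endsE !inE !xpair_eqE; clear; lia.
Qed.

(** The midpoint of the two corners lies in both tiles and is not a node, so the triangles that
    contain it are neighbours across an edge. *)
Lemma corner_edge s t n n' : ~~ overlap s t -> n != n' ->
  n \in corners s -> n \in corners t -> n' \in corners s -> n' \in corners t ->
  exists e, common_edge s t e.
Proof.
move=> ov nn h1 h2 h3 h4.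
pose P := 2^-1 *: (node_pt R n + node_pt R n').
have mid t' : n \in corners t' -> n' \in corners t' -> rhombus R t' P.
  move=> /rhombus_node[a [b [a01 b01 e]]] /rhombus_node[a' [b' [a01' b01' e']]].
  exists (2^-1 * (a + a')), (2^-1 * (b + b')); split; [clear e e'; lra|clear e e'; lra|].
  have ex := congr1 (@sx R) e; have ey := congr1 (@sy R) e.
  have ex' := congr1 (@sx R) e'; have ey' := congr1 (@sy R) e'.
  by clear e e'; rewrite !skE in ex ey ex' ey'; apply: sxy_inj; rewrite /P !skE; lra.
have tri t' : rhombus R t' P -> exists b, in_tri (tri_of t' b) P.
  by case/rhombusP; [exists false|exists true].
have [b hb] := tri _ (mid s h1 h3); have [c hc] := tri _ (mid t h2 h4).
case: (in_tri2 hb hc) => [bc|[d hd]|[m [_ _ Pm]]].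
- case/negP: ov; apply/existsP; exists b; rewrite bc.
  by move/(congr1 snd): bc; rewrite !tri_of2 => ->.
- have cb : c = ~~ b by move/(congr1 snd): hd; rewrite flip2 !tri_of2.
  by subst c; exists (tedge (tri_of s b) d); exact: flip_common_edge.
- have ex := congr1 (@sx R) Pm; have ey := congr1 (@sy R) Pm.
  rewrite /P !skE in ex ey; clear Pm.
  have {}ex : n.1 + n'.1 = 2 * m.1 by apply: (@intr_inj R); rewrite intrD intrM; lra.
  have {}ey : n.2 + n'.2 = 2 * m.2 by apply: (@intr_inj R); rewrite intrD intrM; lra.
  exfalso; move: h1 h3 nn ex ey; clear.
  case: s n n' m => [[x y] o] [a b] [c d] [k l].
  by elim/ord3P: o; rewrite !cornersE /= !inE !xpair_eqE; lia.
Qed.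

(** A shared triangle puts three nodes into the intersection, while every permitted intersection
    contains at most two. *)
Lemma meeting_not_overlap s t : properly_meeting R s t -> ~~ overlap s t.
Proof.
move=> h; apply/negP => /existsP[b /eqP ov].
have vI n : n \in verts (tri_of s b) -> (rhombus R s `&` rhombus R t) (node_pt R n).
  move=> hn; split; apply/rhombus_node; rewrite mem_corners.
    by case: b {ov} hn => ->; rewrite ?orbT.
  by rewrite ov in hn; case: b {ov} hn => ->; rewrite ?orbT.
have vu : uniq (verts (tri_of s b)).
  by case: (tri_of s b) => [[x y] []] /=; rewrite !inE !xpair_eqE; lia.
suff [m [m' sub]] : exists m m', {subset verts (tri_of s b) <= [:: m; m']}.
  by have := uniq_leq_size vu sub; case: (tri_of s b) => [[x y] c].
case: h => [h0|[v [_ _ hv]]|[e [_ he]]].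
- have [n hn] : exists n, n \in verts (tri_of s b).
    by case: (tri_of s b) => [[x y] c]; eexists; apply: mem_head.
  by have := vI n hn; rewrite h0.
- exists v, v => n /vI; rewrite hv => /node_pt_inj ->; exact: mem_head.
- exists e.1, (e.1 + dir e.2) => n /vI; rewrite he => /segmentP.
  by rewrite !in_tri_node -mem_ends.
Qed.

Lemma not_overlap_meeting s t : ~~ overlap s t -> properly_meeting R s t.
Proof.
move=> ov.
have tri t' P : rhombus R t' P -> exists b, in_tri (tri_of t' b) P.
  by case/rhombusP; [exists false|exists true].
have rho t' b P : in_tri (tri_of t' b) P -> rhombus R t' P.
  by move=> h; apply/rhombusP; case: b h; [right|left].
have cor t' b n : n \in verts (tri_of t' b) -> n \in corners t'.
  by rewrite mem_corners; case: b => ->; rewrite ?orbT.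
have inter P : rhombus R s P -> rhombus R t P ->
    (exists2 e, common_edge s t e & segment R e P) \/
    (exists n, [/\ n \in corners s, n \in corners t & P = node_pt R n]).
  move=> /tri[b hb] /tri[c hc].
  case: (in_tri2 hb hc) => [bc|[d hd]|[m [h1 h2 ->]]].
  - case/negP: ov; apply/existsP; exists b; rewrite bc.
    by move/(congr1 snd): bc; rewrite !tri_of2 => ->.
  - left; have cb : c = ~~ b by move/(congr1 snd): hd; rewrite flip2 !tri_of2.
    subst c; exists (tedge (tri_of s b) d); first exact: flip_common_edge.
    apply/segmentP; move: (side_tedge_of s b d) (side_tedge_ofN s b d) hb hc.
    by rewrite hd; case: b {hd} => /= -> -> -> ->.
  - by right; exists m; split; [apply: cor h1|apply: cor h2|].
have [[e ce]|nce] := pselect (exists e, common_edge s t e).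
  constructor 3; exists e; split=> //; apply/seteqP; split=> P.
    case=> sP tP; case: (inter P sP tP) => [[f cf]|[n [h1 h2 ->]]].
      by rewrite (common_edge_uniq ov ce cf).
    by apply/segmentP; rewrite !in_tri_node -mem_ends (common_edge_corner ov ce).
  have [b [h1 h2]] := common_edge_neq ov ce.
  move=> /segmentP => /andP[e0 e1]; split; [apply: (rho s b)|apply: (rho t (~~ b))].
    by rewrite -h1; case: b {h1 h2}.
  by rewrite -h2; case: b {h1 h2}.
have [[P [sP tP]]|] := pselect (exists P, rhombus R s P /\ rhombus R t P); last first.
  move=> h; constructor 1; apply/seteqP; split=> // P [sP tP].
  by case: h; exists P.
case: (inter P sP tP) => [[e ce]|[n [h1 h2 hP]]]; first by case: nce; exists e.
constructor 2; exists n; split=> //; apply/seteqP; split=> Q /=; last first.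
  by move=> ->; rewrite -hP.
case=> sQ tQ; case: (inter Q sQ tQ) => [[e ce]|[m [h3 h4 ->]]].
  by case: nce; exists e.
by case: (eqVneq n m) => [->//|/(corner_edge ov)]; case/(_ h1 h2 h3 h4)/nce.
Qed.

Lemma share_corner_touching s t : share_corner s t -> touching R s t.
Proof. by case/hasP => n h1 h2; exists (node_pt R n); split; apply/rhombus_node. Qed.

Lemma touching_share_corner s t : s == t \/ ~~ overlap s t ->
  touching R s t -> share_corner s t.
Proof.
case=> [/eqP <- _|ov [P [sP tP]]].
  apply/hasP; exists s.1; exact: mem_head.
case: (not_overlap_meeting ov) => [h|[v [vs vt _]]|[e [ce _]]].
- by have : (rhombus R s `&` rhombus R t) P by []; rewrite h.
- by apply/hasP; exists v.
- have [b [h1 h2]] := common_edge_neq ov ce.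
  have he : e.1 \in ends e by exact: mem_head.
  rewrite mem_ends in he; case/andP: he => e0 e1.
  apply/hasP; exists e.1; rewrite mem_corners.
    by case: b h1 {h2} => <-; rewrite ?e0 ?e1 ?orbT.
  by case: b h2 {h1} => <-; rewrite ?e0 ?e1 ?orbT.
Qed.

End Meeting.

(** * Connectedness of the complement *)

Section Topology.
Local Open Scope classical_set_scope.
Local Open Scope ring_scope.
Variable R : realType.

Lemma sx_continuous : continuous (@sx R).
Proof.
move=> P; rewrite /sx; apply: cvgB; first exact: cvg_fst.
by apply: cvgM; [exact: cvg_snd|exact: cvg_cst].
Qed.

Lemma sy_continuous : continuous (@sy R).
Proof.
move=> P; rewrite /sy; apply: cvgM; last exact: cvg_cst.
by apply: cvgM; [exact: cvg_cst|exact: cvg_snd].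
Qed.

(** Near [r] one stays strictly between [ceil r - 1] and [floor r + 1], so an integer bound that
    holds nearby already holds at [r]. *)
Lemma near_int (r : R) : \forall s \near r, forall m : int,
  (m%:~R <= s -> m%:~R <= r) /\ (s <= m%:~R -> r <= m%:~R).
Proof.
near=> s => m.
have h1 : s < (Num.floor r + 1)%:~R.
  by near: s; apply: lt_nbhsl; rewrite floorD1_gt.
have h2 : (Num.ceil r - 1)%:~R < s.
  by near: s; apply: lt_nbhsr; rewrite ceilB1_lt.
split=> h.
  rewrite -floor_ge_int; have := le_lt_trans h h1; by rewrite ltr_int ltzD1.
rewrite -ceil_le_int; have := lt_le_trans h2 h; by rewrite ltr_int ltrBlDr ltzD1.
Unshelve. all: end_near. Qed.

(** The triangles are cut out by integer bounds on [sx], [sy] and [sx + sy]. The statement combines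
    their closedness with the local finiteness of the triangulation. *)
Lemma near_tri (P : R * R) : \forall Q \near P, forall a, in_tri a Q -> in_tri a P.
Proof.
have cs : continuous (fun Q : R * R => sx Q + sy Q).
  by move=> Q; apply: cvgD; [exact: sx_continuous|exact: sy_continuous].
have h1 := sx_continuous (near_int (sx P)).
have h2 := sy_continuous (near_int (sy P)).
have h3 := cs P _ (near_int (sx P + sy P)).
near=> Q => -[[x y] b].
have k1 : forall m : int, (m%:~R <= sx Q -> m%:~R <= sx P) /\ (sx Q <= m%:~R -> sx P <= m%:~R).
  by near: Q.
have k2 : forall m : int, (m%:~R <= sy Q -> m%:~R <= sy P) /\ (sy Q <= m%:~R -> sy P <= m%:~R).
  by near: Q.
have k3 : forall m : int, (m%:~R <= sx Q + sy Q -> m%:~R <= sx P + sy P) /\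
    (sx Q + sy Q <= m%:~R -> sx P + sy P <= m%:~R).
  by near: Q.
have i1 (k : int) : k%:~R + 1 = (k + 1)%:~R :> R by rewrite intrD.
rewrite /= -!intrD !i1; case: b => /and3P[h4 h5 h6]; apply/and3P; split.
- exact: (proj2 (k1 _)).
- exact: (proj2 (k2 _)).
- exact: (proj1 (k3 _)).
- exact: (proj1 (k1 _)).
- exact: (proj1 (k2 _)).
- exact: (proj2 (k3 _)).
Unshelve. all: end_near. Qed.

(* The six triangles around a node, in counterclockwise order. *)
Definition sectors (n : node) : seq tri :=
  let: (x, y) := n in
  [:: ((x, y), false); ((x - 1, y), true); ((x - 1, y), false);
      ((x - 1, y - 1), true); ((x, y - 1), false); ((x, y - 1), true)].

Definition sector_dirs : seq 'I_3 := [:: o1; o2; o0; o1; o2; o0].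

Lemma mem_sectors n a : (a \in sectors n) = (n \in verts a).
Proof.
case: n a => [x y] [[x' y'] []]; rewrite /= !inE !xpair_eqE /= ?andbT ?andbF /=; lia.
Qed.

Lemma star_connected (Q : tri -> tri -> Prop) n :
  (forall a d, n \in verts a -> n \in verts (flip a d) -> Q a (flip a d)) ->
  forall a b, n \in verts a -> n \in verts b -> clos_refl_trans tri Q a b.
Proof.
move=> hQ.
have hs i : (i < 6)%N -> nth ((0, 0), false) (sectors n) i \in sectors n.
  by move=> h; apply: mem_nth; case: n {hQ}.
have st i : (i < 5)%N -> nth ((0, 0), false) (sectors n) i.+1 =
    flip (nth ((0, 0), false) (sectors n) i) (nth o0 sector_dirs i).
  by case: n {hQ hs} => x y; do 5?[case: i => [_|i] /=; [by congr ((_, _), _); lia|]].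
have up i : (i < 6)%N -> clos_refl_trans tri Q (nth ((0, 0), false) (sectors n) 0)
    (nth ((0, 0), false) (sectors n) i).
  elim: i => [_|i IHi hi]; first exact: rt_refl.
  apply: rt_trans (IHi (ltnW hi)) _; apply: rt_step; rewrite st //.
  by apply: hQ; rewrite -mem_sectors -?st // hs // ltnW.
have dn i : (i < 6)%N -> clos_refl_trans tri Q (nth ((0, 0), false) (sectors n) i)
    (nth ((0, 0), false) (sectors n) 0).
  elim: i => [_|i IHi hi]; first exact: rt_refl.
  apply: rt_trans (IHi (ltnW hi)); apply: rt_step.
  rewrite -[X in Q _ X](flipK _ (nth o0 sector_dirs i)) -st //.
  by apply: hQ; rewrite -mem_sectors ?hs // st // flipK hs // ltnW.
move=> a b; rewrite -!mem_sectors => ha hb.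
have sz : size (sectors n) = 6%N by case: (n).
rewrite -(nth_index ((0, 0), false) ha) -(nth_index ((0, 0), false) hb).
by apply: rt_trans (dn _ _) (up _ _); rewrite -sz index_mem.
Qed.

Definition covered (T : {fset tile}) (a : tri) : bool := [exists o, tile_of a o \in T].

Definition ustep (T : {fset tile}) (a b : tri) : Prop :=
  [/\ ~~ covered T a, ~~ covered T b & exists d, b = flip a d].

Definition uconnected (T : {fset tile}) : Prop := forall a b,
  ~~ covered T a -> ~~ covered T b -> clos_refl_trans tri (ustep T) a b.

Lemma coveredP T a :
  reflect (exists2 t, t \in T & exists b, a = tri_of t b) (covered T a).
Proof.
apply: (iffP existsP) => [[d hd]|[t tT [b ->]]].
  by exists (tile_of a d) => //; exists a.2; rewrite tri_of_tile_of.
by exists t.2; rewrite tile_of_tri_of.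
Qed.

Lemma uncoveredP T P : (~` \bigcup_(t in [set` T]) rhombus R t) P <->
  (forall a, in_tri a P -> ~~ covered T a).
Proof.
split=> [h a aP|h [t /= tT]].
  apply/negP => /coveredP[t tT [b ab]]; apply: h; exists t => //=.
  by apply/rhombusP; rewrite ab in aP; case: b aP {ab}; [right|left].
by case/rhombusP => /h /negP; apply; apply/coveredP; exists t => //; eexists.
Qed.

Definition centroid (a : tri) : R * R :=
  let: ((x, y), b) := a in
  node_pt R (x, y) + (if b then 2 / 3 else 1 / 3) *: (node_pt R (1, 0) + node_pt R (0, 1)).

Lemma sx_centroid a : sx (centroid a) = a.1.1%:~R + if a.2 then 2 / 3 else 1 / 3.
Proof. by case: a => [[x y] b]; rewrite /centroid !skE /= ?skE. Qed.

Lemma sy_centroid a : sy (centroid a) = a.1.2%:~R + if a.2 then 2 / 3 else 1 / 3.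
Proof. by case: a => [[x y] b]; rewrite /centroid !skE /= ?skE. Qed.

Lemma in_centroid a : in_tri a (centroid a).
Proof.
have := sx_centroid a; have := sy_centroid a.
by case: a => [[x y] []] /= -> ->; apply/and3P; split; lra.
Qed.

(** Moving from a point of a triangle towards the centroid enters the interior at once, and interior
    points lie in no other triangle. *)
Lemma near_centroid a b P (k : R) : 0 < k <= 1 -> in_tri a P ->
  in_tri b (P + k *: (centroid a - P)) -> a = b.
Proof.
move=> /andP[k0 k1] aP bQ.
set Q := P + _ in bQ.
have hx : sx Q = sx P + k * (sx (centroid a) - sx P).
  by rewrite /Q sxD sxZ -scaleN1r sxD sxZ; lra.
have hy : sy Q = sy P + k * (sy (centroid a) - sy P).
  by rewrite /Q syD syZ -scaleN1r syD syZ; lra.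
clearbody Q; rewrite sx_centroid in hx; rewrite sy_centroid in hy.
case: a aP hx hy => [[x y] c] aP hx hy.
have interior : if c then [/\ sx Q < x%:~R + 1, sy Q < y%:~R + 1 & x%:~R + y%:~R + 1 < sx Q + sy Q]
  else [/\ x%:~R < sx Q, y%:~R < sy Q & sx Q + sy Q < x%:~R + y%:~R + 1].
  have p z w : z <= w -> 0 <= (1 - k) * (w - z).
    by rewrite -subr_ge0; apply: mulr_ge0; lra.
  case: c aP hx hy => /= /and3P[h1 h2 h3] -> ->;
    by have := p _ _ h1; have := p _ _ h2; have := p _ _ h3; split; lra.
have aQ : in_tri (x, y, c) Q.
  by case: c interior {aP hx hy} => -[? ? ?]; apply/and3P; split; lra.
case: (in_tri2 aQ bQ) => [//|[d hd]|[n [na _ Qn]]]; exfalso; clear aP aQ hx hy.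
  subst b; case: c interior bQ => -[? ? ?];
  elim/ord3P: d => /=; rewrite ?skE => /and3P[? ? ?]; lra.
rewrite Qn sx_node sy_node in interior; clear Qn.
case: c n interior na => [] [m n] /= -[i1 i2 i3];
  rewrite !inE !xpair_eqE => /or3P[] /andP[/eqP ? /eqP ?]; subst m n;
  rewrite ?skE in i1 i2 i3; lra.
Qed.

Lemma centroid_tri a b : in_tri b (centroid a) -> a = b.
Proof.
move=> h; apply: (@near_centroid a b (centroid a) 1 _ (in_centroid a)).
  by rewrite ltr01 lexx.
by rewrite subrr scaler0 addr0.
Qed.

Lemma exists_tri P : exists a, @in_tri R a P.
Proof.
have h1 := floor_le (sx P); have h2 := floor_le (sy P).
have h3 := floorD1_gt (sx P); have h4 := floorD1_gt (sy P).
rewrite !intrD in h3 h4.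
case: (leP (sx P + sy P) ((Num.floor (sx P))%:~R + (Num.floor (sy P))%:~R + 1)) => h5.
  by exists ((Num.floor (sx P), Num.floor (sy P)), false); apply/and3P.
by exists ((Num.floor (sx P), Num.floor (sy P)), true); apply/and3P; split; lra.
Qed.

(** The sets [O1] and [O2] below are open by [near_tri] and split the complement, so [O1] is clopen
    in it. *)
Lemma connected_uconnected T :
  connected (~` \bigcup_(t in [set` T]) rhombus R t) -> uconnected T.
Proof.
set C := ~` _ => conC a b ua ub.
pose reach := clos_refl_trans tri (ustep T) a.
have op (p : tri -> Prop) : open [set Q : R * R | forall c, in_tri c Q -> p c].
  rewrite openE => P hP; have := near_tri P; apply: filterS => Q h c /h; exact: hP.
(* At a node of the complement all six sectors are uncovered, so triangles that meet only there are
   linked by turning around it. *)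
have loc P c d : C P -> in_tri c P -> in_tri d P -> clos_refl_trans tri (ustep T) c d.
  move=> /uncoveredP hP cP dP.
  case: (in_tri2 cP dP) => [->|[e he]|[n [nc nd Pn]]]; first exact: rt_refl.
    by apply: rt_step; split; [exact: hP|exact: hP|exists e].
  apply: (star_connected _ nc nd) => e f he hf.
  by split; [apply: hP; rewrite Pn in_tri_node..|exists f].
have cC c : ~~ covered T c -> C (centroid c).
  by move=> uc; apply/uncoveredP => d /centroid_tri <-.
pose O1 := [set Q : R * R | forall c, in_tri c Q -> reach c].
pose O2 := [set Q : R * R | forall c, in_tri c Q -> ~ reach c].
have BC : C `&` O1 = C.
  apply: conC.
  - exists (centroid a); split; first exact: cC.
    by move=> c /centroid_tri <-; exact: rt_refl.
  - by exists O1 => //; exact: op.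
  - exists (~` O2); first by rewrite closedC; exact: op.
    apply/seteqP; split=> P [CP h]; split=> //.
      by have [c cP] := exists_tri P; move=> /(_ c cP); apply; exact: h.
    move=> c cP; have {h} [d dP hd] : exists2 d, in_tri d P & reach d.
      by apply: contrapT => nh; apply: h => d dP hd; apply: nh; exists d.
    by apply: rt_trans hd _; exact: (loc P).
have : (C `&` O1) (centroid b) by rewrite BC; exact: cC.
by case=> _; apply; exact: in_centroid.
Qed.

Lemma midpoint_tri a d b : in_tri b (2^-1 *: (centroid a + centroid (flip a d))) ->
  b = a \/ b = flip a d.
Proof.
set m := _ *: _ => bm.
have hx : sx m = 2^-1 * (sx (centroid a) + sx (centroid (flip a d))).
  by rewrite /m sxZ sxD.
have hy : sy m = 2^-1 * (sy (centroid a) + sy (centroid (flip a d))).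
  by rewrite /m syZ syD.
clearbody m; rewrite !sx_centroid in hx; rewrite !sy_centroid in hy.
have am : in_tri a m.
  case: a hx hy => [[x y] []]; elim/ord3P: d => /=; rewrite ?skE => -> ->;
  by apply/and3P; split; lra.
case: (in_tri2 am bm) => [->|[e he]|[n [na _ mn]]]; first by left.
  right; rewrite he; congr flip; apply/eqP; subst b; clear am.
  case: a hx hy bm => [[x y] []] /=; elim/ord3P: d; elim/ord3P: e => //=; rewrite ?skE
    => hx hy /and3P[? ? ?]; exfalso; lra.
rewrite mn sx_node sy_node in hx hy; clear am bm mn; exfalso.
case: a n hx hy na => [[x y] []] [k l] /=; elim/ord3P: d => /= hx hy;
  rewrite !inE !xpair_eqE => /or3P[] /andP[/eqP ? /eqP ?]; subst k l;
  rewrite ?skE in hx hy; lra.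
Qed.

Lemma in_midpoint a d : in_tri a (2^-1 *: (centroid a + centroid (flip a d))).
Proof.
set m := _ *: _.
have hx : sx m = 2^-1 * (sx (centroid a) + sx (centroid (flip a d))).
  by rewrite /m sxZ sxD.
have hy : sy m = 2^-1 * (sy (centroid a) + sy (centroid (flip a d))).
  by rewrite /m syZ syD.
clearbody m; rewrite !sx_centroid in hx; rewrite !sy_centroid in hy.
case: a hx hy => [[x y] []]; elim/ord3P: d => /=; rewrite ?skE => -> ->;
  by apply/and3P; split; lra.
Qed.

(** A relatively clopen part of the complement cannot cut a segment. Segments lead from a point to
    the centroid of its triangle and, by way of the midpoint of a common edge, to the next
    centroid. *)
Lemma uconnected_connected T :
  uconnected T -> connected (~` \bigcup_(t in [set` T]) rhombus R t).
Proof.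
set C := ~` _ => uc B [P0 BP0] [U oU BU] [V oV BV].
have seg P Q : (forall k : R, 0 <= k <= 1 -> C (P + k *: (Q - P))) -> B P <-> B Q.
  move=> hC; pose S := [set P + k *: (Q - P) | k in `[0, 1 : R]].
  have SC : S `<=` C by move=> _ [k /= + <-]; rewrite in_itv; apply: hC.
  have cS : connected S.
    apply: connected_continuous_connected; first exact: segment_connected.
    apply: continuous_subspaceT => k; apply: cvgD; first exact: cvg_cst.
    by apply: cvgZr_tmp; exact: cvg_id.
  have SP : S P by exists 0; rewrite /= ?in_itv /= ?lexx ?ler01 // scale0r addr0.
  have SQ : S Q.
    by exists 1; rewrite /= ?in_itv /= ?lexx ?ler01 // scale1r addrC subrK.
  have key : S `&` B !=set0 -> S `&` B = S.
    move=> ne; apply: cS => //.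
      by exists U => //; rewrite BU setIA (setIidl SC).
    by exists V => //; rewrite BV setIA (setIidl SC).
  split=> h.
    have : (S `&` B) Q by rewrite key //; exists P.
    by case.
  have : (S `&` B) P by rewrite key //; exists Q.
  by case.
have cen a P : C P -> in_tri a P -> B P <-> B (centroid a).
  move=> CP aP; apply: seg => k /andP[]; rewrite le_eqVlt => /orP[/eqP <- _|k0 k1].
    by rewrite scale0r addr0.
  apply/uncoveredP => b bP; have <- : a = b by apply: (near_centroid _ aP bP); rewrite k0.
  by move/uncoveredP: CP; apply.
have step a b : ustep T a b -> B (centroid a) <-> B (centroid b).
  case=> ua ub [d hd]; subst b.
  have Cm : C (2^-1 *: (centroid a + centroid (flip a d))).
    by apply/uncoveredP => b /midpoint_tri[] ->.
  rewrite -(cen _ _ Cm (in_midpoint a d)); apply: cen => //.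
  by have := in_midpoint (flip a d) d; rewrite flipK addrC.
apply/seteqP; split=> [Q|Q CQ]; first by rewrite BU => -[].
have CP0 : C P0 by move: BP0; rewrite BU => -[].
have [a aP] := exists_tri P0; have [b bQ] := exists_tri Q.
have ua : ~~ covered T a by move/uncoveredP: (CP0); apply.
have ub : ~~ covered T b by move/uncoveredP: (CQ); apply.
have hB : B (centroid a) by apply/(cen a P0).
apply/(cen b Q) => //.
elim: (uc a b ua ub) hB => [c d /step[]||c d e _ h1 _ h2 /h1/h2] //.
Qed.

End Topology.

(** * Neighbours of a tile *)

Section Combinatorics.

Definition tiles_disjoint (T : {fset tile}) : Prop :=
  {in T &, forall s t, s != t -> ~~ overlap s t}.

Record tredoku_comb (T : {fset tile}) : Prop := {
  comb_size : (5 <= #|` T|%fset)%N;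
  comb_connected : connected_under tile_adjacent T;
  comb_disjoint : tiles_disjoint T;
  comb_2connected : forall t, t \in T -> connected_under share_corner (T `\ t)%fset;
  comb_runs : forall s, is_run T s -> size s = 3%N;
  comb_no_holes : uconnected T
}.

Lemma clos_rt_map (A : Type) (p q : A -> A -> Prop) x y :
  (forall a b, p a b -> q a b) ->
  clos_refl_trans A p x y -> clos_refl_trans A q x y.
Proof.
move=> pq; elim=> [a b /pq ?|a|a b c _ h1 _ h2]; [exact: rt_step|exact: rt_refl|].
exact: rt_trans h1 h2.
Qed.

Lemma tredoku_combP (R : realType) T : tredoku_tiling R T <-> tredoku_comb T.
Proof.
split=> -[h1 h2 h3 h4 h5 h6]; split=> //.
- by move=> s t sT tT st; apply: (@meeting_not_overlap R); exact: h3.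
- move=> t tT a b aT bT; apply: clos_rt_map (h4 t tT a b aT bT) => c d [cT dT tou].
  split=> //; apply: (@touching_share_corner R) tou.
  have [->|cd] := eqVneq c d; [by left|right].
  move: cT dT; rewrite !inE => /andP[_ cT] /andP[_ dT].
  by apply: (@meeting_not_overlap R); exact: h3.
- exact: connected_uconnected h6.
- by move=> s t sT tT st; apply: not_overlap_meeting; exact: h3.
- move=> t tT a b aT bT; apply: clos_rt_map (h4 t tT a b aT bT) => c d [cT dT tou].
  by split=> //; exact: share_corner_touching.
- exact: uconnected_connected h6.
Qed.

Definition out (t : tile) (d : 'I_3) (b : bool) : tri := flip (tri_of t b) d.

Definition slots (t : tile) : seq ('I_3 * bool) :=
  [:: (ordS t.2, false); (ordS t.2, true); (ord_pred t.2, false); (ord_pred t.2, true)].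

Lemma mem_slots t d b : ((d, b) \in slots t) = (d != t.2).
Proof.
rewrite /slots; elim/ord3P: (t.2); elim/ord3P: d;
  by rewrite !ordSE !ord_predE !inE !xpair_eqE ?eqxx ?ord3_eqE; case: b.
Qed.

Lemma uniq_slots t : uniq (slots t).
Proof.
by rewrite /slots; elim/ord3P: (t.2); rewrite !ordSE !ord_predE.
Qed.

(* [lnk d b t s]: crossing the edge of [t] of direction [d] on the half [b]
   leads from [t] to [s]. *)
Definition lnk (d : 'I_3) (b : bool) (t s : tile) : bool :=
  [&& t.2 != d, s.2 != d & tri_of s (~~ b) == flip (tri_of t b) d].

Lemma lnk_sym d b t s : lnk d (~~ b) s t = lnk d b t s.
Proof.
rewrite /lnk negbK; apply/and3P/and3P => -[h1 h2 /eqP h3]; split=> //.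
  by rewrite h3 flipK.
by rewrite h3 flipK.
Qed.

(** Links from different halves of [t] to the same tile would close a 4-cycle of triangles. *)
Lemma lnk_inj d b d' b' t s : lnk d b t s -> lnk d' b' t s -> (d = d') /\ (b = b').
Proof.
move=> /and3P[h1 h2 /eqP h3] /and3P[h4 h5 /eqP h6].
have [bb|bb] := eqVneq b b'.
  by subst b'; split=> //; apply: (@flip_injr (tri_of t b)); rewrite -h3 -h6.
have {}bb : b' = ~~ b by case: b b' bb {h3 h6} => [] [].
subst b'; rewrite negbK in h6.
have h7 : flip (flip (tri_of t b) d) s.2 = flip (flip (tri_of t b) t.2) d'.
  by rewrite -h3 tri_of_flip negbK h6 tri_of_flip.
have ds : d != s.2 by rewrite eq_sym.
by have [dt _] := flip_flip ds h7; rewrite dt eqxx in h1.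
Qed.

Section Fixed.
Variable T : {fset tile}.
Hypothesis disj : tiles_disjoint T.

(** The default [o0] is reached only at uncovered triangles; [coveringP] assumes coverage. *)
Definition covering (a : tri) : tile :=
  tile_of a (odflt o0 [pick o | tile_of a o \in T]).

Definition has_nb (t : tile) (d : 'I_3) (b : bool) : bool := covered T (out t d b).
Definition nb (t : tile) (d : 'I_3) (b : bool) : tile := covering (out t d b).

Lemma coveringP a : covered T a -> covering a \in T /\ tri_of (covering a) a.2 = a.
Proof.
move=> /existsP ca; rewrite /covering; case: pickP => [d /= hd|h].
  by split=> //; rewrite tri_of_tile_of.
by case: ca => d; rewrite h.
Qed.

Lemma disjP s t b : s \in T -> t \in T -> tri_of s b = tri_of t b -> s = t.
Proof.
move=> sT tT st; apply/eqP; apply: contraT => /(disj sT tT) /negP; case.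
by apply/existsP; exists b; rewrite st.
Qed.

Lemma tile_covered t b : t \in T -> covered T (tri_of t b).
Proof. by move=> tT; apply/coveredP; exists t => //; exists b. Qed.

Lemma covering_tri t b : t \in T -> covering (tri_of t b) = t.
Proof.
move=> tT; have [h1 h2] := coveringP (tile_covered b tT).
by apply: (disjP (b := b)) => //; rewrite -{2}h2 tri_of2.
Qed.

Lemma lnk_has_nb d b t s : s \in T -> lnk d b t s -> has_nb t d b.
Proof. by move=> sT /and3P[_ _ /eqP h]; rewrite /has_nb /out -h tile_covered. Qed.

Lemma lnk_nb d b t s : s \in T -> lnk d b t s -> nb t d b = s.
Proof. by move=> sT /and3P[_ _ /eqP h]; rewrite /nb /out -h covering_tri. Qed.

Lemma nbP t d b : t \in T -> d != t.2 -> has_nb t d b ->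
  nb t d b \in T /\ lnk d b t (nb t d b).
Proof.
move=> tT dt /coveringP[h1 h2]; split=> //.
rewrite /out flip2 tri_of2 -/(out t d b) -/(nb t d b) in h2.
apply/and3P; split=> //; [by rewrite eq_sym| |exact/eqP].
(* If [d] were the diagonal of the neighbour, its other half would be the triangle of [t] from which
   it was reached, and the neighbour would be [t] itself. *)
apply/eqP => ds; have := h2; rewrite /out -{2}ds => h3.
have : tri_of (nb t d b) b = tri_of t b.
  by rewrite -(flipK (tri_of t b) (nb t d b).2) -h3 tri_of_flip negbK.
by move/(disjP h1 tT); rewrite -/(nb t d b) => h; move: dt; rewrite -ds h eqxx.
Qed.

Lemma lnk_neq d b t s : s \in T -> t \in T -> lnk d b t s -> s != t.
Proof.
move=> sT tT /and3P[h1 h2 /eqP h3]; apply/eqP => st; subst s.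
by move: h3; rewrite -tri_of_flip => /flip_injr h; rewrite h eqxx in h1.
Qed.

Lemma adjacentP s t : s \in T -> t \in T ->
  reflect (exists d b, lnk d b t s) (tile_adjacent s t).
Proof.
move=> sT tT; apply: (iffP andP) => [[st /hasP[e es et]]|[d [b h]]].
  have ov := disj sT tT st.
  have ce : common_edge s t e by rewrite /common_edge es et.
  have [b [h1 h2]] := common_edge_neq ov ce.
  move: es et; rewrite !mem_edges => /andP[e1 _] /andP[e2 _].
  exists e.2, (~~ b); apply/and3P; split; [by rewrite eq_sym|by rewrite eq_sym|].
  by rewrite negbK -h1 -h2 side_flip negbK.
have st := lnk_neq sT tT h; split=> //.
have ts : t != s by rewrite eq_sym.
have /and3P[_ _ /eqP h3] := h.
have /andP[e1 e2] := flip_common_edge (disj tT sT ts) h3.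
by apply/hasP; exists (tedge (tri_of t b) d).
Qed.

Lemma has_nb_sym t d b : t \in T -> d != t.2 -> has_nb t d b ->
  has_nb (nb t d b) d (~~ b) /\ nb (nb t d b) d (~~ b) = t.
Proof.
move=> tT dt h; have [h1 h2] := nbP tT dt h.
have h3 : lnk d (~~ b) (nb t d b) t by rewrite lnk_sym.
by split; [exact: lnk_has_nb h3|exact: lnk_nb h3].
Qed.

Lemma tile_degreeE t : t \in T -> tile_degree T t =
  (has_nb t (ordS t.2) false + has_nb t (ordS t.2) true
   + has_nb t (ord_pred t.2) false + has_nb t (ord_pred t.2) true)%N.
Proof.
move=> tT; rewrite /tile_degree.
pose S := [seq db <- slots t | has_nb t db.1 db.2].
have SP db : db \in S -> db.1 != t.2 /\ has_nb t db.1 db.2.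
  by case: db => d b; rewrite mem_filter mem_slots => /andP[].
have -> : [fset s in T | tile_adjacent s t]%fset =
    [fset s in [seq nb t db.1 db.2 | db <- S]]%fset.
  apply/fsetP => s; rewrite !inE /=; apply/andP/mapP => [[sT]|[[d b] /SP /= [h1 h2] ->]].
    move=> /(adjacentP sT tT)[d [b h]]; exists (d, b); last by rewrite /= (lnk_nb sT h).
    rewrite mem_filter mem_slots /= (lnk_has_nb sT h) /= eq_sym.
    by case/and3P: h.
  have [h3 h4] := nbP tT h1 h2; split=> //.
  by apply/(adjacentP h3 tT); exists d, b.
rewrite card_fseq undup_id.
  by rewrite size_map size_filter /= -!addnA addn0.
rewrite map_inj_in_uniq ?filter_uniq ?uniq_slots // => -[d b] [d' b'].
move=> /SP /= [h1 h2] /SP /= [h3 h4] h.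
have [_ l1] := nbP tT h1 h2; have [_ l2] := nbP tT h3 h4.
by rewrite h in l1; have [-> ->] := lnk_inj l1 l2.
Qed.

End Fixed.

Lemma degree_dirs T t d d' : tiles_disjoint T -> t \in T -> d != t.2 -> d' != t.2 -> d != d' ->
  tile_degree T t = (has_nb T t d false + has_nb T t d true
                     + has_nb T t d' false + has_nb T t d' true)%N.
Proof.
move=> disj tT dt dt' dd; rewrite (tile_degreeE disj tT); move: dt dt' dd.
elim/ord3P: (t.2); elim/ord3P: d => //; elim/ord3P: d' => // _ _ _;
  rewrite !ordSE !ord_predE; lia.
Qed.

End Combinatorics.

(** * Runs *)

Section Runs.
Variable T : {fset tile}.
Hypothesis disj : tiles_disjoint T.

Local Notation has_nb := (has_nb T).
Local Notation nb := (nb T).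

(* Strictly monotone along a strip of tiles crossing edges of direction [d]. *)
Definition height (d : 'I_3) (t : tile) : int :=
  let: ((x, y), _) := tri_of t false in
  (match val d with 0 => - y | 1 => - x | _ => x + y end)%R.

Lemma lnk_height d b t s : lnk d b t s ->
  (height d s = height d t + if b then -1 else 1)%R.
Proof.
move=> /and3P[h1 h2 /eqP h3]; move: h1 h2.
rewrite -{2}(tile_of_tri_of s (~~ b)) -{2}(tile_of_tri_of t b) h3 {h3}.
move: (tri_of2 t b); case: (tri_of t b) => [[x y] c] /= -> {c}.
by elim/ord3P: (t.2); elim/ord3P: (s.2); elim/ord3P: d => //= _ _;
  case: b; rewrite /height /=; lia.
Qed.

Lemma sorted_lnk_uniq d b s : sorted (lnk d b) s -> uniq s.
Proof.
pose r t t' := (if b then height d t' < height d t else height d t < height d t')%R.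
move=> so; apply: (@sorted_uniq _ r).
- by move=> x y z; rewrite /r; case: (b); lia.
- by move=> x; rewrite /r; case: (b); lia.
- apply: sub_sorted so => x y /lnk_height; rewrite /r => ->; case: (b); lia.
Qed.

(** Since [opposite_edges] demands distinct edges, a run leaves each inner tile by the half other
    than the one it entered. Hence a single [b] serves along the whole sequence. *)
Lemma run_edgesP s : uniq s -> {subset s <= T} -> (2 <= size s)%N ->
  (exists es, run_edges s es) <-> exists d b, sorted (lnk d b) s.
Proof.
move=> us sT s2; set x0 := ((0%R, 0%R), ord0) : tile.
have in_s i : (i < size s)%N -> nth x0 s i \in T by move=> h; apply/sT/mem_nth.
have ov i : (i.+1 < size s)%N -> ~~ overlap (nth x0 s i) (nth x0 s i.+1).
  move=> h; apply: disj; [exact/in_s/ltnW|exact: in_s|].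
  by rewrite nth_uniq ?(ltnW h) // ltn_eqF.
split=> [[es [h1 h2 h3 h4]]|[d [b so]]].
  have es0 : (0 < size es)%N by rewrite -ltnS h1.
  pose e i := nth x0 es i.
  have dE i : (i < size es)%N -> (e i).2 = (e 0%N).2.
    by move=> hi; apply/eqP/h3; apply: mem_nth.
  have [b [b1 b2]] : exists b, side (e 0%N) b = tri_of (nth x0 s 0) b /\
      side (e 0%N) (~~ b) = tri_of (nth x0 s 1) (~~ b).
    by apply: common_edge_neq (h2 _ es0); apply: ov.
  exists (e 0%N).2, b.
  have key i : (i < size es)%N -> side (e i) b = tri_of (nth x0 s i) b /\
      side (e i) (~~ b) = tri_of (nth x0 s i.+1) (~~ b).
    elim: i => [//|i IHi hi]; have [_ k2] := IHi (ltnW hi).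
    have [c [c1 c2]] := common_edge_neq (ov i.+1 ltac:(by rewrite -h1)) (h2 _ hi).
    have [bc|bc] := eqVneq c b; first by subst c.
    have {}bc : c = ~~ b by case: (b) (c) bc => [] [].
    subst c; have /and4P[_ _ /eqP neq /eqP par] := h4 _ hi.
    case: neq; rewrite -(tedge_side (nth x0 es i) (~~ b)).
    by rewrite -(tedge_side (nth x0 es i.+1) (~~ b)) par -/(e i) k2 c1.
  apply/(sortedP x0) => i; rewrite -h1 ltnS => hi.
  have [k1 k2] := key i hi; have /andP[] := h2 i hi.
  rewrite !mem_edges -/(e i) dE // => /andP[n1 _] /andP[n2 _].
  apply/and3P; split; [by rewrite eq_sym|by rewrite eq_sym|].
  by rewrite -k1 -k2 -(dE i hi) side_flip.
have so' i : (i.+1 < size s)%N -> lnk d b (nth x0 s i) (nth x0 s i.+1).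
  by move/(sortedP x0): so; apply.
pose es := mkseq (fun i => tedge (tri_of (nth x0 s i) b) d) (size s).-1.
have ses : (size es).+1 = size s by rewrite size_mkseq prednK // ltnW.
have esE i : (i < size es)%N -> nth x0 es i = tedge (tri_of (nth x0 s i) b) d.
  by rewrite size_mkseq => h; rewrite nth_mkseq.
have ce i : (i < size es)%N -> common_edge (nth x0 s i) (nth x0 s i.+1) (nth x0 es i).
  move=> hi; rewrite esE //; apply: flip_common_edge; first by apply: ov; rewrite -ses.
  by have /and3P[_ _ /eqP] := so' i ltac:(by rewrite -ses).
exists es; split=> //.
  by move=> f g /mapP[i _ ->] /mapP[j _ ->]; rewrite /parallel !tedge2.
move=> i hi; have /andP[_ c1] := ce i (ltnW hi); have /andP[c2 _] := ce i.+1 hi.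
apply/and4P; split=> //; last by rewrite /parallel !esE ?(ltnW hi) // !tedge2.
rewrite !esE ?(ltnW hi) //; apply: contraNneq (ov i ltac:(by rewrite -ses ltnS ltnW)) => h.
by apply/existsP; exists b; rewrite -(side_tedge_of _ b d) h side_tedge_of.
Qed.

Lemma pre_runP s : pre_run T s <->
  [/\ (2 <= size s)%N, {subset s <= T} & exists d b, sorted (lnk d b) s].
Proof.
split=> [[h1 h2 h3 h4]|[h1 h2 h3]].
  by split=> //; apply/run_edgesP.
have us : uniq s by case: h3 => d [b]; exact: sorted_lnk_uniq.
by split=> //; apply/run_edgesP.
Qed.

Lemma pre_run_extends s : pre_run T s -> exists2 s', is_run T s' & infix s s'.
Proof.
have [k] := ubnP (#|` T|%fset - size s); elim: k s => // k IHk s hk ps.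
have [mx|] := pselect (forall s', pre_run T s' -> infix s s' -> s' = s).
  by exists s => //; exact: infix_refl.
move=> nmx; have [s' [ps' ss' ne]] : exists s', [/\ pre_run T s', infix s s' & s' <> s].
  apply: contrapT => h; apply: nmx => s' ps' ss'; apply: contrapT => ne.
  by apply: h; exists s'.
have lt : (size s < size s')%N.
  rewrite ltnNge; apply/negP => le; apply: ne.
  case/infixP: ss' => p [q e]; move: le; rewrite e !size_cat.
  by case: p {e} => [|? p]; case: q => [|? q] /=; rewrite ?cats0 //; lia.
have le : (size s' <= #|` T|%fset)%N.
  by case: ps' => _ us sub _; exact: uniq_leq_size.
have [|s'' r h] := IHk s' _ ps'; first by lia.
by exists s'' => //; exact: infix_trans ss' h.
Qed.

(** The local form of the condition that all runs have three tiles: two linked tiles continue to a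
    further tile on exactly one side. On neither side would give a run of two tiles, on both sides
    one of at least four. *)
Definition three_runs : Prop := forall t d b, t \in T -> d != t.2 -> has_nb t d b ->
  has_nb t d (~~ b) = ~~ has_nb (nb t d b) d b.

Lemma lnk_slot d b t s : lnk d b t s -> d != t.2.
Proof. by case/and3P; rewrite eq_sym. Qed.

Lemma three_runs_size : three_runs -> forall s, is_run T s -> size s = 3%N.
Proof.
move=> L s [/pre_runP[s2 sT [d [b so]]] mx].
case: s s2 sT so mx => [|t [|t' s]] //= _ sT /andP[l so] mx.
have tT : t \in T by apply: sT; rewrite mem_head.
have tT' : t' \in T by apply: sT; rewrite !inE eqxx orbT.
have hn := lnk_has_nb tT' l; have en := lnk_nb disj tT' l.
case: s sT so mx => [|t2 [|t3 s]] //= sT so mx.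
  have := L t d b tT (lnk_slot l) hn; rewrite en.
  case h : (has_nb t d (~~ b)).
    have [x1 x2] := nbP disj tT (lnk_slot l) h.
    suff /(congr1 size) /= : [:: nb t d (~~ b); t; t'] = [:: t; t'].
      by [].
    apply: mx; last by apply/infixP; exists [:: nb t d (~~ b)], [::].
    apply/pre_runP; split=> //.
      by move=> x; rewrite !inE => /or3P[] /eqP ->.
    by exists d, b; rewrite /= l -lnk_sym x2.
  move/esym/negbFE => h'.
  have l' : d != t'.2 by move: l; rewrite -lnk_sym; exact: lnk_slot.
  have [x1 x2] := nbP disj tT' l' h'.
  suff /(congr1 size) /= : [:: t; t'; nb t' d b] = [:: t; t'].
    by [].
  apply: mx; last by apply/infixP; exists [::], [:: nb t' d b].
  apply/pre_runP; split=> //.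
    by move=> x; rewrite !inE => /or3P[] /eqP ->.
  by exists d, b; rewrite /= l x2.
have tT2 : t2 \in T by apply: sT; rewrite !inE eqxx !orbT.
have tT3 : t3 \in T by apply: sT; rewrite !inE eqxx !orbT.
case/and3P: so => l2 l3 _.
have := L t' d b tT' (lnk_slot l2) (lnk_has_nb tT2 l2).
rewrite (lnk_nb disj tT2 l2) (lnk_has_nb tT3 l3) /=.
by rewrite (@lnk_has_nb T d (~~ b) t' t tT) // lnk_sym.
Qed.

Lemma size_three_runs : (forall s, is_run T s -> size s = 3%N) -> three_runs.
Proof.
move=> r3 t d b tT dt h.
have [sT l] := nbP disj tT dt h; set s := nb t d b in sT l *.
have ds : d != s.2 by move: l; rewrite -lnk_sym; exact: lnk_slot.
case h1 : (has_nb t d (~~ b)); case h2 : (has_nb s d b) => //; exfalso.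
  have [x1 x2] := nbP disj tT dt h1; have [y1 y2] := nbP disj sT ds h2.
  have [|r /r3 r3r /size_infix] := @pre_run_extends [:: nb t d (~~ b); t; s; nb s d b].
    apply/pre_runP; split=> //.
      by move=> x; rewrite !inE => /or4P[] /eqP ->.
    by exists d, b; rewrite /= l y2 -lnk_sym x2.
  by rewrite r3r.
have [|r rr] := @pre_run_extends [:: t; s].
  apply/pre_runP; split=> //; first by move=> x; rewrite !inE => /orP[] /eqP ->.
  by exists d, b; rewrite /= l.
case/infixP => p [q e]; have := r3 r rr; case: rr => /pre_runP[_ rT [d' [b' so]]] _.
rewrite e size_cat /= => sz; rewrite e in rT so.
case: p q sz {e} rT so => [|x [|? p]] [|y [|? q]] //= sz rT;
  try (exfalso; clear -sz; rewrite ?size_cat /= in sz; lia).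
- case/and3P=> l1 l2 _; have [? ?] := lnk_inj l l1; subst d' b'.
  have yT : y \in T by apply: rT; rewrite !inE eqxx !orbT.
  by rewrite (lnk_has_nb yT l2) in h2.
- case/and3P=> l1 l2 _; have [? ?] := lnk_inj l l2; subst d' b'.
  have xT : x \in T by apply: rT; rewrite mem_head.
  by rewrite (@lnk_has_nb T d (~~ b) t x xT) ?lnk_sym in h1.
Qed.

End Runs.

(** * Counting runs by their middles and by their ends *)

Section Counting.
Variable T : {fset tile}.

Local Notation has_nb := (has_nb T).
Local Notation nb := (nb T).

Definition mid_dir (t : tile) (d : 'I_3) : bool := has_nb t d false && has_nb t d true.

Definition mids (t : tile) : nat := mid_dir t (ordS t.2) + mid_dir t (ord_pred t.2).

Definition run_ends (t : tile) : nat :=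
  (has_nb t (ordS t.2) false (+) has_nb t (ordS t.2) true)
  + (has_nb t (ord_pred t.2) false (+) has_nb t (ord_pred t.2) true).

Hypothesis disj : tiles_disjoint T.
Hypothesis L : three_runs T.

Definition run3 (x : tile * 'I_3) : seq tile :=
  [:: nb x.1 x.2 true; x.1; nb x.1 x.2 false].

Lemma is_run3 t d : t \in T -> d != t.2 -> mid_dir t d -> is_run T (run3 (t, d)).
Proof.
move=> tT dt /andP[h0 h1].
have [x1 x2] := nbP disj tT dt h0; have [y1 y2] := nbP disj tT dt h1.
have pr : pre_run T (run3 (t, d)).
  apply/(pre_runP disj); split=> //.
    by move=> x; rewrite !inE => /or3P[] /eqP ->.
  by exists d, false; rewrite /= x2 -lnk_sym y2.
split=> // s ps sub; have [r rr sr] := pre_run_extends ps.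
have sz : (size s <= 3)%N by rewrite -(three_runs_size disj L rr) size_infix.
case/infixP: sub => p [q e]; move: sz; rewrite e !size_cat /=.
by case: p {e} => [|? p]; case: q => [|? q] //=; lia.
Qed.

Lemma is_run_run3 s : is_run T s ->
  exists t d, [/\ t \in T, d != t.2, mid_dir t d & s = run3 (t, d) \/ s = rev (run3 (t, d))].
Proof.
move=> rs; have := three_runs_size disj L rs; case: rs => /(pre_runP disj)[_ sT [d [b so]]] _.
case: s sT so => [|x [|t [|y [|? ?]]]] //= sT /and3P[l1 l2 _] _.
have xT : x \in T by apply: sT; rewrite mem_head.
have tT : t \in T by apply: sT; rewrite !inE eqxx !orbT.
have yT : y \in T by apply: sT; rewrite !inE eqxx !orbT.
rewrite -lnk_sym in l1; exists t, d; split=> //; first exact: lnk_slot l2.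
  have := lnk_has_nb xT l1; have := lnk_has_nb yT l2.
  by rewrite /mid_dir; case: (b) => /= -> ->.
have := lnk_nb disj xT l1; have := lnk_nb disj yT l2.
by rewrite /run3 /rev /=; case: (b) => /= -> ->; [right|left].
Qed.

Definition mid_pairs : seq (tile * 'I_3) :=
  [seq x <- [seq (t, d) | t <- enum_fset T, d <- [:: ordS t.2; ord_pred t.2]] | mid_dir x.1 x.2].

Lemma mem_mid_pairs t d :
  ((t, d) \in mid_pairs) = [&& t \in T, d != t.2 & mid_dir t d].
Proof.
have dE : (d \in [:: ordS t.2; ord_pred t.2]) = (d != t.2).
  by elim/ord3P: (t.2); elim/ord3P: d; rewrite !ordSE !ord_predE !inE.
rewrite mem_filter andbC andbA; congr andb.
apply/allpairsPdep/andP => [[t' [d' [h1 h2 [-> ->]]]]|[h1 h2]].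
  by split=> //; move: h2; elim/ord3P: (t'.2); elim/ord3P: d';
    rewrite !ordSE !ord_predE !inE.
by exists t, d; rewrite dE.
Qed.

Lemma size_mid_pairs : size mid_pairs = (\sum_(t <- enum_fset T) mids t)%N.
Proof.
rewrite size_filter -sum1_count big_mkcond big_allpairs_dep /=.
apply: eq_bigr => t _; rewrite !big_cons big_nil /mids /=.
by do 2?case: ifP.
Qed.

Lemma uniq_mid_pairs : uniq mid_pairs.
Proof.
apply/filter_uniq/allpairs_uniq_dep; first exact: fset_uniq.
  by move=> t _; elim/ord3P: (t.2); rewrite !ordSE !ord_predE.
by move=> [t d] [t' d'] _ _ /= [-> ->].
Qed.

(** A run is determined by its middle tile and its direction, and reading it backwards keeps
    both. *)
Lemma num_runsE : num_runs T = (\sum_(t <- enum_fset T) mids t)%N.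
Proof.
rewrite /num_runs -size_mid_pairs.
pose F x : {fset seq tile} := [fset run3 x; rev (run3 x)]%fset.
have -> : fset_set (runs T) = [fset F x | x in mid_pairs]%fset.
  apply/fsetP => r; rewrite in_fset_set; last exact: finite_runs.
  apply/idP/imfsetP => [|[[t d]]] /=.
    rewrite inE => -[s /is_run_run3[t [d [h1 h2 h3 h4]]] <-].
    exists (t, d); first by rewrite mem_mid_pairs h1 h2.
    by rewrite /F; case: h4 => ->; [reflexivity|rewrite revK; exact: fsetUC].
  rewrite mem_mid_pairs => /and3P[h1 h2 h3] ->.
  by rewrite inE; exists (run3 (t, d)) => //; exact: is_run3.
rewrite card_in_imfset /=; last first.
  move=> [t d] [t' d'] /=; rewrite !mem_mid_pairs => /and3P[h1 h2 h3] /and3P[k1 k2 k3] e.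
  have : run3 (t, d) \in F (t', d') by rewrite -e /F in_fset2 eqxx.
  have [/andP[n1 n2] /andP[n3 n4]] := (h3, k3).
  have [_ l1] := nbP disj h1 h2 n1; have [_ l2] := nbP disj k1 k2 n3.
  have [_ l3] := nbP disj k1 k2 n4.
  rewrite /F in_fset2 /run3 /rev /= => /orP[] /eqP [_ ? h]; subst t'; rewrite h in l1.
    by have [-> _] := lnk_inj l1 l2.
  by have [_] := lnk_inj l1 l3.
by rewrite undup_id ?uniq_mid_pairs.
Qed.

Definition flags : seq (tile * ('I_3 * bool)) :=
  [seq (t, db) | t <- enum_fset T, db <- slots t].

Lemma mem_flags t d b : ((t, (d, b)) \in flags) = (t \in T) && (d != t.2).
Proof.
apply/allpairsPdep/andP => [[t' [d' [h1 h2 [-> e]]]]|[h1 h2]].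
  by split=> //; move: h2; rewrite -e mem_slots.
by exists t, (d, b); rewrite mem_slots.
Qed.

Lemma uniq_flags : uniq flags.
Proof.
apply/allpairs_uniq_dep => [|t _|]; [exact: fset_uniq|exact: uniq_slots|].
by move=> [t d] [t' d'] _ _ /= [-> ->].
Qed.

(** Crossing a shared side is an involution on sides. By [three_runs] it exchanges the sides at
    which a tile is a middle with those at which it is an end, and a middle has two sides in the
    direction of its run. *)
Lemma sum_run_ends :
  (\sum_(t <- enum_fset T) run_ends t = 2 * \sum_(t <- enum_fset T) mids t)%N.
Proof.
pose p1 (x : tile * ('I_3 * bool)) :=
  has_nb x.1 x.2.1 x.2.2 && has_nb x.1 x.2.1 (~~ x.2.2).
pose p2 (x : tile * ('I_3 * bool)) :=
  has_nb x.1 x.2.1 x.2.2 && ~~ has_nb x.1 x.2.1 (~~ x.2.2).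
pose phi (x : tile * ('I_3 * bool)) :=
  (nb x.1 x.2.1 x.2.2, (x.2.1, ~~ x.2.2)).
have flagP x : x \in flags -> has_nb x.1 x.2.1 x.2.2 ->
    [/\ phi x \in flags, phi (phi x) = x, p1 (phi x) = p2 x & p2 (phi x) = p1 x].
  case: x => t [d b]; rewrite mem_flags /= => /andP[tT dt] h.
  have [h1 h2] := nbP disj tT dt h.
  have [h3 h4] := has_nb_sym disj tT dt h; have h5 := L tT dt h.
  rewrite /phi mem_flags h1 /=; split.
  - by rewrite -lnk_sym in h2; exact: lnk_slot h2.
  - by rewrite h4 negbK.
  - by rewrite /p1 /p2 /= h h3 negbK h5 negbK.
  - by rewrite /p1 /p2 /= h h3 negbK h5.
have sz : size [seq x <- flags | p2 x] = size [seq x <- flags | p1 x].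
  have le (p q : pred _) : (forall x, x \in flags -> p x ->
      [/\ phi x \in flags, phi (phi x) = x & q (phi x)]) ->
      (size [seq x <- flags | p x] <= size [seq x <- flags | q x])%N.
    move=> h; have -> : size [seq x <- flags | p x] = size [seq phi x | x <- flags & p x].
      by rewrite size_map.
    apply: uniq_leq_size.
      rewrite map_inj_in_uniq ?filter_uniq ?uniq_flags // => x y.
      rewrite !mem_filter => /andP[px /h/(_ px)[_ hx _]] /andP[py /h/(_ py)[_ hy _]] e.
      by rewrite -hx -hy e.
    move=> z /mapP[x]; rewrite mem_filter => /andP[px /h/(_ px)[h1 h2 h3]] ->.
    by rewrite mem_filter h3.
  apply/eqP; rewrite eqn_leq; apply/andP; split; apply: le => x xf px.
    have /andP[hx _] := px; have [h1 h2 h3 h4] := flagP x xf hx.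
    by split=> //; rewrite h3.
  have /andP[hx _] := px; have [h1 h2 h3 h4] := flagP x xf hx.
  by split=> //; rewrite h4.
have sizeE (p : pred (tile * ('I_3 * bool))) : size [seq x <- flags | p x] =
    (\sum_(t <- enum_fset T) count (fun db => p (t, db)) (slots t))%N.
  rewrite size_filter -sum1_count big_mkcond big_allpairs_dep /=.
  apply: eq_bigr => t _; rewrite /slots !big_cons big_nil.
  by do 4!case: (p _).
rewrite !sizeE in sz; rewrite big_distrr /=.
transitivity (\sum_(t <- enum_fset T) count (fun db => p2 (t, db)) (slots t))%N.
  apply: eq_bigr => t _; rewrite /run_ends /p2 /=.
  by do 4!case: (has_nb _ _ _).
rewrite sz; apply: eq_bigr => t _; rewrite /mids /mid_dir /p1 /=.
by do 4!case: (has_nb _ _ _).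
Qed.

End Counting.

(** * A discrete Jordan argument *)

Section Parity.

(* Does the leftward horizontal ray from the triangle [a] cross the edge [f]? *)
Definition crossing (f : edge) (a : tri) : bool :=
  let: ((p, q), d) := f in let: ((x, y), b) := a in
  (q == y) && (if b then (d == o1) && (p <= x) || (d == o2) && (p <= x + 1)
               else (d != o0) && (p <= x))%R.

(* Corrects [crossing] at horizontal edges; in [crossing_flip] it telescopes along
   a walk. *)
Definition chi (g : edge) (n : node) : bool :=
  [&& g.2 == o0, n.2 == g.1.2 & (n.1 <= g.1.1)%R].

Definition fst_end (e : edge) : node := e.1.
Definition snd_end (e : edge) : node := (e.1 + dir e.2)%R.

Lemma snd_endE x y :
  (snd_end ((x, y), o0) = (x + 1, y)%R) * (snd_end ((x, y), o1) = (x, y + 1)%R) *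
  (snd_end ((x, y), o2) = (x - 1, y + 1)%R).
Proof.
rewrite /snd_end /dir /= /GRing.add /= /add_pair /=.
by do 2?split; rewrite !(addr0, add0r).
Qed.

Lemma mem_endsE n e : (n \in ends e) = (n == fst_end e) || (n == snd_end e).
Proof. by rewrite !inE. Qed.

(** A flip within a row changes the ray only at the edge crossed. A flip across a horizontal edge
    moves the ray to the next row, and the parity for a non-horizontal [f] changes once for each end
    of [f] on that line at or left of the edge. *)
Lemma crossing_flip f a d : crossing f a (+) crossing f (flip a d) =
  (f == tedge a d) (+) chi (tedge a d) (fst_end f) (+) chi (tedge a d) (snd_end f).
Proof.
case: f a => [[p q] c] [[x y] []]; elim/ord3P: c; elim/ord3P: d;
  rewrite snd_endE /chi /= !xpair_eqE ?eqxx ?ord3_eqE /= ?andbT ?andbF /=; lia.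
Qed.

Definition edge_step (K : edge -> Prop) (n n' : node) : Prop :=
  exists2 f, K f & (n \in ends f) && (n' \in ends f).

Lemma walk_potential K p q : clos_refl_trans node (edge_step K) p q ->
  exists r : tri -> bool, exists2 m : edge -> bool, (forall g, m g -> K g) &
    forall a d, r a (+) r (flip a d) =
      m (tedge a d) (+) chi (tedge a d) p (+) chi (tedge a d) q.
Proof.
elim=> {p q} [p q [f Kf]|p|p q s _ [r1 [m1 K1 h1]] _ [r2 [m2 K2 h2]]].
- rewrite !mem_endsE => /andP[/orP[]/eqP-> /orP[]/eqP->].
  + exists (fun=> false), (fun=> false) => // a d; by rewrite /= addbb.
  + exists (crossing f), (pred1 f) => [g /eqP -> //|a d].
    by rewrite crossing_flip /= eq_sym.
  + exists (crossing f), (pred1 f) => [g /eqP -> //|a d].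
    by rewrite crossing_flip /= eq_sym addbAC.
  + exists (fun=> false), (fun=> false) => // a d; by rewrite /= addbb.
- by exists (fun=> false), (fun=> false) => // a d; rewrite /= addbb.
- exists (fun a => r1 a (+) r2 a), (fun g => m1 g (+) m2 g).
    by move=> g; case e : (m1 g) => /=; [move=> _; exact: K1|exact: K2].
  move=> a d; rewrite addbACA h1 h2.
  by case: (m1 _); case: (m2 _); case: (chi _ p); case: (chi _ q); case: (chi _ s).
Qed.

Lemma edge_step_sym K n n' : edge_step K n n' -> edge_step K n' n.
Proof. by case=> f Kf /andP[h1 h2]; exists f; rewrite ?h1 ?h2. Qed.

Lemma corners_connected t n n' : n \in corners t -> n' \in corners t ->
  clos_refl_trans node (edge_step (fun e => e \in edges t)) n n'.
Proof.
set Q := clos_refl_trans _ _.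
have sym x y : Q x y -> Q y x.
  elim=> {x y} [x y h|x|x y z _ h1 _ h2]; [exact/rt_step/edge_step_sym|exact: rt_refl|].
  exact: rt_trans h2 h1.
have st x y e : e \in edges t -> x \in ends e -> y \in ends e -> Q x y.
  by move=> et xe ye; apply: rt_step; exists e => //; rewrite xe ye.
suff h x : x \in corners t -> Q t.1 x.
  by move=> /h h1 /h h2; apply: rt_trans h2; exact: sym.
have e0 : (t.1, ordS t.2) \in edges t by rewrite !inE eqxx.
have e2 : (t.1, ord_pred t.2) \in edges t by rewrite !inE eqxx !orbT.
have e3 : ((t.1 + dir (ordS t.2))%R, ord_pred t.2) \in edges t by rewrite !inE eqxx !orbT.
have q1 : Q t.1 (t.1 + dir (ordS t.2))%R.
  by apply: (st _ _ _ e0); rewrite mem_endsE eqxx ?orbT.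
rewrite !inE => /or4P[] /eqP ->.
- exact: rt_refl.
- exact: q1.
- by apply: (st _ _ _ e2); rewrite mem_endsE eqxx ?orbT.
- by apply: rt_trans q1 _; apply: (st _ _ _ e3); rewrite mem_endsE eqxx ?orbT.
Qed.

Lemma touch_walk (A : {fset tile}) s s' : s \in A ->
  clos_refl_trans tile (fun x y => [/\ x \in A, y \in A & share_corner x y]) s s' ->
  s' \in A /\ forall n n', n \in corners s -> n' \in corners s' ->
    clos_refl_trans node (edge_step (fun e => exists2 x, x \in A & e \in edges x)) n n'.
Proof.
have loc x : x \in A -> forall n n', n \in corners x -> n' \in corners x ->
    clos_refl_trans node (edge_step (fun e => exists2 x, x \in A & e \in edges x)) n n'.
  move=> xA n n' h1 h2; apply: clos_rt_map (corners_connected h1 h2) => y z [e et h].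
  by exists e => //; exists x.
move=> sA c; elim: c sA => {s s'} [x y [xA yA /hasP[n h1 h2]] _|x xA|x y z _ h1 _ h2 xA].
- split=> // p q hp hq.
  by apply: rt_trans (loc x xA p n hp h1) (loc y yA n q h2 hq).
- by split=> //; exact: loc.
- have [yA k1] := h1 xA; have [zA k2] := h2 yA; split=> // p q hp hq.
  by apply: rt_trans (k1 p y.1 hp _) (k2 y.1 q _ hq); exact: mem_head.
Qed.

Lemma verts_connected a n n' : n \in verts a -> n' \in verts a ->
  exists d, (n \in ends (tedge a d)) && (n' \in ends (tedge a d)).
Proof.
case: a n n' => [[x y] []] [p q] [p' q'] /=; rewrite !inE !xpair_eqE
  => /or3P[] /andP[/eqP-> /eqP->] /or3P[] /andP[/eqP-> /eqP->];
  first [exists o0; rewrite endsE !inE !xpair_eqE; clear; lia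
        |exists o1; rewrite endsE !inE !xpair_eqE; clear; lia
        |exists o2; rewrite endsE !inE !xpair_eqE; clear; lia].
Qed.

Definition tile_edge (t : tile) (d : 'I_3) (b : bool) : edge := tedge (tri_of t b) d.

Lemma tile_edge_ends t d d' b b' : d != t.2 -> d' != t.2 -> d != d' ->
  (fst_end (tile_edge t d b) \in ends (tile_edge t d' b')) &&
  (snd_end (tile_edge t d b) \in ends (tile_edge t d' (~~ b'))) ||
  (snd_end (tile_edge t d b) \in ends (tile_edge t d' b')) &&
  (fst_end (tile_edge t d b) \in ends (tile_edge t d' (~~ b'))).
Proof.
case: t => [[x y] o]; elim/ord3P: o; elim/ord3P: d => //=; elim/ord3P: d' => //= _ _ _;
  case: b; case: b'; rewrite /tile_edge /= ?snd_endE ?endsE !inE !xpair_eqE /=; clear; lia.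
Qed.

Lemma opposite_ends t d b n : d != t.2 ->
  n \in ends (tile_edge t d b) -> n \notin ends (tile_edge t d (~~ b)).
Proof.
case: t n => [[x y] o] [p q]; elim/ord3P: o; elim/ord3P: d => //= _; case: b;
  rewrite /tile_edge /= ?endsE !inE !xpair_eqE /=; clear; lia.
Qed.

Lemma ends_verts a d n : n \in ends (tedge a d) -> n \in verts a /\ n \in verts (flip a d).
Proof.
rewrite mem_ends => h.
have s1 : side (tedge a d) a.2 = a := side_tedge a d.
have s2 : side (tedge a d) (~~ a.2) = flip a d by rewrite -side_flip s1 tedge2.
by move: h s1 s2; case: (a.2) => /andP[h1 h2] /= e1 e2; rewrite -{1}e1 -e2.
Qed.

Section Tiling.
Variable T : {fset tile}.
Hypothesis disj : tiles_disjoint T.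
Hypothesis uc : uconnected T.

Local Notation has_nb := (has_nb T).
Local Notation nb := (nb T).

Lemma edge_of_tile s a d : tedge a d \in edges s ->
  exists b, tri_of s b = a \/ tri_of s b = flip a d.
Proof.
rewrite mem_edges => /andP[_ /existsP[b /eqP h]]; exists b; rewrite -h.
have s1 : side (tedge a d) a.2 = a := side_tedge a d.
have s2 : side (tedge a d) (~~ a.2) = flip a d by rewrite -side_flip s1 tedge2.
have [->|ne] := eqVneq b a.2; first by left.
by right; have -> : b = ~~ a.2 by case: (b) (a.2) ne => [] [].
Qed.

Lemma uconnected_const (R : tri -> bool) :
  (forall a d, ~~ covered T a -> ~~ covered T (flip a d) -> R a = R (flip a d)) ->
  forall a b, ~~ covered T a -> ~~ covered T b -> R a = R b.
Proof.
move=> h a b ua ub; elim: (uc ua ub) => {a b ua ub} [a b [ua ub [d e]]||a b c _ -> _ ->] //.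
by rewrite e; apply: h; rewrite -?e.
Qed.

(** A walk through the other tiles joins the two occupied sides of [t] and is closed up by the free
    side [f0]. It would separate the uncovered triangles beyond the two free sides of [t]. *)
Lemma no_straight_tile t d d' : t \in T -> d != t.2 -> d' != t.2 -> d != d' ->
  connected_under share_corner (T `\ t)%fset ->
  has_nb t d false -> has_nb t d true -> ~~ has_nb t d' false -> ~~ has_nb t d' true -> False.
Proof.
move=> tT dt dt' dd' con n0 n1 m0 m1.
have [s0T l0] := nbP disj tT dt n0; have [s1T l1] := nbP disj tT dt n1.
set s0 := nb t d false in s0T l0; set s1 := nb t d true in s1T l1.
have s0t := lnk_neq s0T tT l0; have s1t := lnk_neq s1T tT l1.
pose K e := exists2 s, s \in (T `\ t)%fset & e \in edges s.
pose f0 := tile_edge t d' false.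
have link (b : bool) s n : lnk d b t s -> n \in ends (tile_edge t d b) -> n \in corners s.
  move=> /and3P[_ _ /eqP h] /ends_verts[_]; rewrite -h mem_corners.
  by case: b {h} => -> ; rewrite ?orbT.
have walk n n' : n \in ends (tile_edge t d false) -> n' \in ends (tile_edge t d true) ->
    clos_refl_trans node (edge_step K) n n'.
  move=> /(link _ _ _ l0) h1 /(link _ _ _ l1) h2.
  have s0T' : s0 \in (T `\ t)%fset by rewrite !inE s0t.
  have s1T' : s1 \in (T `\ t)%fset by rewrite !inE s1t.
  by have [_] := touch_walk s0T' (con _ _ s0T' s1T'); apply.
have [r [m mK hr]] : exists r : tri -> bool, exists2 m : edge -> bool, (forall g, m g -> K g) &
    forall a c, r a (+) r (flip a c) =
      m (tedge a c) (+) chi (tedge a c) (fst_end f0) (+) chi (tedge a c) (snd_end f0).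
  have dd : d' != d by rewrite eq_sym.
  case/orP: (tile_edge_ends false false dt' dt dd) => /andP[h1 h2].
    exact: walk_potential (walk _ _ h1 h2).
  have [r [m mK hr]] := walk_potential (walk _ _ h1 h2).
  by exists r, m => // a c; rewrite hr addbAC.
(* The [chi] terms of the walk and of [f0] cancel, so this parity changes only across edges of the
   closed curve. *)
have {}hr a c : (r a (+) crossing f0 a) = (m (tedge a c) (+) (f0 == tedge a c)) (+)
    (r (flip a c) (+) crossing f0 (flip a c)).
  have := hr a c; have := crossing_flip f0 a c.
  case: (r a); case: (r (flip a c)); case: (crossing f0 a);
  case: (crossing f0 (flip a c)); case: (m _); case: (f0 == _);
  by case: (chi _ (fst_end _)); case: (chi _ (snd_end _)).
set R := fun a => r a (+) crossing f0 a.
have KN a c : K (tedge a c) -> exists2 s, s \in T & (s != t) /\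
    exists b, tri_of s b = a \/ tri_of s b = flip a c.
  by case=> s; rewrite in_fsetD1 => /andP[st sT] /edge_of_tile h; exists s.
have KT b : ~~ m (tedge (tri_of t b) t.2).
  apply/negP => /mK/KN[s sT [st [c h]]]; case/negP: st; apply/eqP.
  case: h; rewrite ?tri_of_flip => h; have := congr1 snd h; rewrite !tri_of2 => e;
    by subst c; apply: (disjP disj sT tT h).
have KU b : ~~ m (tile_edge t d' b).
  apply/negP => /mK/KN[s sT [st [c [h|h]]]].
    have := congr1 snd h; rewrite !tri_of2 => e; subst c.
    by rewrite (disjP disj sT tT h) eqxx in st.
  have : has_nb t d' b by rewrite /has_nb /out -h tile_covered.
  by move: m0 m1; case: (b) => [_ /negP|/negP].
have Rdiag : R (tri_of t false) = R (tri_of t true).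
  rewrite /R (hr _ t.2) (negbTE (KT _)) tri_of_flip /=.
  suff -> : (f0 == tedge (tri_of t false) t.2) = false by [].
  by apply: contraNF dt' => /eqP/(congr1 snd); rewrite !tedge2 => ->.
have R0 : R (tri_of t false) = ~~ R (out t d' false).
  by rewrite /R (hr _ d') (negbTE (KU false)) eqxx.
have R1 : R (tri_of t true) = R (out t d' true).
  rewrite /R (hr _ d') (negbTE (KU true)) /=.
  suff -> : (f0 == tedge (tri_of t true) d') = false by [].
  apply: contraNF dt' => /eqP e; apply/eqP/(@flip_injr (tri_of t false)).
  have := side_tedge_ofN t true d'; rewrite -e side_tedge_of => h.
  by rewrite tri_of_flip h flipK.
(* An edge between two uncovered triangles is not on the curve, so the parity is constant on the
   uncovered region. Passing through [t] from one free side to the other, however, crosses the curve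
   exactly once, at [f0]. *)
have : R (out t d' false) = R (out t d' true).
  apply: uconnected_const => // a c ua ub; rewrite /R (hr _ c).
  have -> : m (tedge a c) = false.
    apply/negP => /mK/KN[s sT [_ [b h]]]; have := tile_covered b sT.
    by case: h => -> h; [rewrite h in ua|rewrite h in ub].
  suff -> : (f0 == tedge a c) = false by [].
  apply/negP => /eqP e; have := tile_covered false tT.
  have : tedge a c \in edges t.
    by rewrite -e mem_edges tedge2 dt'; apply/existsP; exists false; rewrite side_tedge_of.
  case/edge_of_tile => b h; have := tile_covered b tT.
  by case: h => -> h; [rewrite h in ua|rewrite h in ub].
by rewrite -R1 -Rdiag R0; case: (R _).
Qed.

End Tiling.
End Parity.

(** * The corner between the two neighbours of a tile is surrounded *)

Section CornerTile.
Variable T : {fset tile}.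
Hypothesis disj : tiles_disjoint T.
Hypothesis uc : uconnected T.

Local Notation has_nb := (has_nb T).
Local Notation nb := (nb T).

Definition uedge (e : edge) : Prop := exists b, ~~ covered T (side e b).

Lemma uedge_tedge a d : ~~ covered T a -> uedge (tedge a d).
Proof. by exists a.2; rewrite side_tedge. Qed.

Lemma uwalk a a' n n' : ~~ covered T a -> ~~ covered T a' ->
  n \in verts a -> n' \in verts a' -> clos_refl_trans node (edge_step uedge) n n'.
Proof.
have loc b p q : ~~ covered T b -> p \in verts b -> q \in verts b ->
    clos_refl_trans node (edge_step uedge) p q.
  move=> ub hp hq; have [d h] := verts_connected hp hq.
  by apply: rt_step; exists (tedge b d) => //; exact: uedge_tedge.
move=> ua ub; move: (uc ua ub) n n' => c.
elim: c ua ub => {a a'} [a b [ua ub [d e]] _ _|a ua _|a b c h1' h1 _ h2 ua uc'] n n' hn hn'.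
- have h : fst_end (tedge a d) \in ends (tedge a d) by rewrite mem_endsE eqxx.
  have [k1 k2] := ends_verts h; rewrite -e in k2.
  exact: rt_trans (loc a _ _ ua hn k1) (loc b _ _ ub k2 hn').
- exact: (loc a).
- have ub : ~~ covered T b.
    elim: h1' ua {h1 h2 uc' hn hn'} => [x y [_ h _] _|x h|x y z _ k1 _ k2 h].
    - exact: h.
    - exact: h.
    - exact: k2 (k1 h).
  have [v hv] : exists v, v \in verts b by case: (b) => [[x y] s]; eexists; exact: mem_head.
  exact: rt_trans (h1 ua ub _ _ hn hv) (h2 ub uc' _ _ hv hn').
Qed.

Lemma covered_edge_not_uedge a d : covered T a -> covered T (flip a d) -> ~ uedge (tedge a d).
Proof.
move=> ca cb [b]; case: (eqVneq b a.2) => [->|ne].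
  by rewrite side_tedge ca.
have -> : b = ~~ a.2 by case: (b) (a.2) ne => [] [].
by rewrite -side_flip side_tedge tedge2 cb.
Qed.

(** If a triangle at [v] were uncovered, a closed curve could run through the uncovered region and
    along two sides of [x]. Among the links between [x], [y1], [y2] and the tiles connecting them,
    only the one from [x] to [y1] crosses it, and only once. *)
Lemma corner_tile_interior x d b d' b' v a :
  x \in T -> d != x.2 -> d' != x.2 -> d != d' ->
  has_nb x d b -> has_nb x d' b' -> ~~ has_nb x d' (~~ b') ->
  clos_refl_trans tile (fun s t => [/\ s \in (T `\ x)%fset, t \in (T `\ x)%fset & tile_adjacent s t])
    (nb x d b) (nb x d' b') ->
  v \in ends (tile_edge x d b) -> v \in ends (tile_edge x d' b') -> v \in verts a ->
  covered T a.
Proof.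
move=> xT dx dx' dd n1 n2 m2 con v1 v2 va; apply: contraT => ua.
have [y1T l1] := nbP disj xT dx n1; have [y2T l2] := nbP disj xT dx' n2.
set y1 := nb x d b in y1T l1 con; set y2 := nb x d' b' in y2T l2 con.
pose e1 := tile_edge x d b; pose f2 := tile_edge x d' (~~ b').
have dd' : d' != d by rewrite eq_sym.
(* [c] is the other end of [e1]; it lies on [f2] *)
have [c [c1 c2 e1E]] : exists c, [/\ c \in ends e1, c \in ends f2 &
    forall g, chi g v (+) chi g c = chi g (fst_end e1) (+) chi g (snd_end e1)].
  have [/andP[h1 h2]|/andP[h1 h2]] := orP (tile_edge_ends b b' dx dx' dd).
    exists (snd_end e1); split=> //; first by rewrite mem_endsE eqxx orbT.
    move=> g; move: v1; rewrite mem_endsE => /orP[]/eqP ev; rewrite ev // in v2 *.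
    by have := opposite_ends dx' v2; rewrite h2.
  exists (fst_end e1); split=> //; first by rewrite mem_endsE eqxx.
  move=> g; move: v1; rewrite mem_endsE => /orP[]/eqP ev; rewrite ev // in v2 *.
    by have := opposite_ends dx' v2; rewrite h2.
  by rewrite addbC.
have [w [w2 f2E]] : exists w, w \in ends f2 /\
    forall g, chi g c (+) chi g w = chi g (fst_end f2) (+) chi g (snd_end f2).
  move: c2; rewrite mem_endsE => /orP[]/eqP ->.
    by exists (snd_end f2); rewrite mem_endsE eqxx orbT.
  by exists (fst_end f2); rewrite mem_endsE eqxx; split=> // g; rewrite addbC.
have [_ wv] := ends_verts w2.
have [r [m mK hr]] := walk_potential (uwalk ua m2 va wv).
(* The closed curve: through edges of uncovered triangles from [v] to [w], along [f2] to [c], and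
   along [e1] back to [v]. *)
pose R a := r a (+) crossing e1 a (+) crossing f2 a.
pose M g := m g (+) (e1 == g) (+) (f2 == g).
have {}hr p k : R p = M (tedge p k) (+) R (flip p k).
  rewrite /R /M; move: (hr p k) (crossing_flip e1 p k) (crossing_flip f2 p k).
  rewrite -!addbA -e1E -f2E.
  case: (r p); case: (r (flip p k)); case: (m _); case: (e1 == _); case: (f2 == _);
  case: (crossing e1 p); case: (crossing e1 (flip p k)); case: (crossing f2 p);
  case: (crossing f2 (flip p k)); case: (chi _ v); case: (chi _ c); by case: (chi _ w).
have f2N p k : covered T p -> covered T (flip p k) -> (f2 == tedge p k) = false.
  move=> cp ck; apply/negP => /eqP e; apply: (covered_edge_not_uedge cp ck).
  rewrite -e; exists b'; rewrite -{1}(negbK b') side_tedge_ofN; exact: m2.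
have mN p k : covered T p -> covered T (flip p k) -> m (tedge p k) = false.
  by move=> cp ck; apply/negP => /mK; exact: covered_edge_not_uedge.
have e1x p k : e1 == tedge p k -> p = tri_of x b \/ flip p k = tri_of x b.
  move=> /eqP e; have := side_tedge_of x b d; rewrite -/(tile_edge x d b) -/e1 e.
  have [->|ne] := eqVneq b p.2; first by rewrite side_tedge; left.
  have eb : b = ~~ p.2 by move: ne; case: (b); case: (p.2).
  by rewrite {1}eb -side_flip side_tedge tedge2; right.
have Rdiag s c' : s \in T -> R (tri_of s c') = R (tri_of s (~~ c')).
  move=> sT; rewrite (hr _ s.2) tri_of_flip /M.
  have k1 := tile_covered c' sT; have k2 : covered T (flip (tri_of s c') s.2).
    by rewrite tri_of_flip tile_covered.
  rewrite mN // f2N // addbF /=.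
  suff -> : (e1 == tedge (tri_of s c') s.2) = false by [].
  apply/negP => h; case: (e1x _ _ h); rewrite ?tri_of_flip => e;
    (have := congr1 snd e; rewrite !tri_of2 => eb; rewrite eb in e;
     have sx := disjP disj sT xT e; subst s;
     by move/eqP: h => /(congr1 snd); rewrite !tedge2 => h; rewrite h eqxx in dx).
have Rs s c' c'' : s \in T -> R (tri_of s c') = R (tri_of s c'').
  move=> sT; have [->//|ne] := eqVneq c' c''; rewrite Rdiag //.
  by case: c' c'' ne => [] [].
have Rl k c' s t : s \in T -> t \in T -> lnk k c' t s -> ~~ (e1 == tedge (tri_of t c') k) ->
    R (tri_of t false) = R (tri_of s false).
  move=> sT tT /and3P[_ _ /eqP h] ne.
  rewrite (Rs t false c') // (Rs s false (~~ c')) // h (hr _ k) /M.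
  have k1 := tile_covered c' tT; have k2 := tile_covered (~~ c') sT; rewrite h in k2.
  by rewrite mN // f2N // (negbTE ne).
(* The tiles from [y1] to [y2] avoid [x], and [e1] borders [x]; so none of their links crosses the
   curve. *)
have Ry : R (tri_of y1 false) = R (tri_of y2 false).
  elim: con => {y1 y2 y1T l1 y2T l2} [s t [sT tT ad]|//|s t k _ -> _ -> //].
  move: sT tT; rewrite !in_fsetD1 => /andP[sx sT] /andP[tx tT].
  have [k [c' l]] := adjacentP disj sT tT ad.
  symmetry; apply: (Rl k c') => //; apply/negP => /e1x; have /and3P[_ _ /eqP <-] := l.
  case=> e; have := congr1 snd e; rewrite !tri_of2 => eb; rewrite eb in e.
    by rewrite (disjP disj tT xT e) eqxx in tx.
  by rewrite (disjP disj sT xT e) eqxx in sx.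
have R2 : R (tri_of x false) = R (tri_of y2 false).
  apply: (Rl d' b') => //; apply: contra dd => /eqP/(congr1 snd).
  by rewrite !tedge2 => ->.
have R1 : R (tri_of x false) = ~~ R (tri_of y1 false).
  have /and3P[_ _ /eqP h] := l1.
  rewrite (Rs x false b) // (Rs y1 false (~~ b)) // h (hr _ d) /M.
  have k1 := tile_covered b xT; have k2 := tile_covered (~~ b) y1T; rewrite h in k2.
  by rewrite mN // f2N // eqxx.
by move: R1; rewrite R2 Ry; case: (R _).
Qed.

End CornerTile.

(** * Tiles by degree *)

Lemma rt1n_cases (A : Type) (r : A -> A -> Prop) x y : clos_refl_trans_1n A r x y ->
  x = y \/ exists2 z, r x z & clos_refl_trans_1n A r z y.
Proof. by case=> [|z k h1 h2]; [left|right; exists z]. Qed.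

Section Degrees.
Variable T : {fset tile}.
Hypothesis comb : tredoku_comb T.
Hypothesis spine_con : connected_under tile_adjacent (spine T).

Local Notation has_nb := (has_nb T).
Local Notation nb := (nb T).
Local Notation mid := (mid_dir T).
Local Notation deg := (tile_degree T).

Let disj := comb_disjoint comb.
Let L : three_runs T := size_three_runs disj (comb_runs comb).
Let uc := comb_no_holes comb.

Lemma degE t d d' : t \in T -> d != t.2 -> d' != t.2 -> d != d' ->
  deg t = (has_nb t d false + has_nb t d true + has_nb t d' false + has_nb t d' true)%N.
Proof.
by move=> tT dt dt' dd; exact: degree_dirs.
Qed.

Lemma deg_gt0 t : t \in T -> (0 < deg t)%N.
Proof.
move=> tT; have [s sT st] : exists2 s, s \in T & s != t.
  have : (0 < #|` (T `\ t)%fset|)%N.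
    by have := comb_size comb; rewrite (cardfsD1 t) tT; lia.
  by rewrite cardfs_gt0 => /fset0Pn[s]; rewrite in_fsetD1 => /andP[]; exists s.
have [s' [sT' ad]] : exists s', s' \in T /\ tile_adjacent s' t.
  elim: (comb_connected comb sT tT) st => [x y [xT yT ad] _|x /eqP//|x y z _ h1 _ h2 xz].
    by exists x.
  have [yz|/h2//] := eqVneq y z; by subst z; exact: h1.
by rewrite /tile_degree cardfs_gt0; apply/fset0Pn; exists s'; rewrite !inE /= sT'.
Qed.

Lemma straight t d d' : t \in T -> d != t.2 -> d' != t.2 -> d != d' ->
  mid t d -> has_nb t d' false || has_nb t d' true.
Proof.
move=> tT dt dt' dd /andP[h1 h2]; apply: contraT; rewrite negb_or => /andP[h3 h4].
by case: (no_straight_tile disj uc tT dt dt' dd (comb_2connected comb tT) h1 h2 h3 h4).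
Qed.

Lemma other_dir (t : tile) d : d != t.2 -> exists d', [/\ d' != t.2 & d != d'].
Proof.
elim/ord3P: (t.2); elim/ord3P: d => // _;
  first [by exists o0|by exists o1|by exists o2].
Qed.

Lemma ordS_pred (d : 'I_3) : [/\ ordS d != d, ord_pred d != d & ordS d != ord_pred d].
Proof. by elim/ord3P: d; rewrite !ordSE !ord_predE. Qed.

(** An i-tile is an end of 1, 2, 1, 0 runs for i = 1, 2, 3, 4. By [straight], a 2-tile is never a
    middle. *)
Lemma tile_types t : t \in T ->
  [/\ (run_ends T t + (deg t == 4) = 1 + (deg t == 2))%N,
      mids T t = ((deg t == 3) + 2 * (deg t == 4))%N & (deg t <= 4)%N].
Proof.
move=> tT; have [h1 h2 h3] := ordS_pred t.2; have h4 : ord_pred t.2 != ordS t.2 by rewrite eq_sym.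
have := deg_gt0 tT; have := straight tT h1 h2 h3; have := straight tT h2 h1 h4.
rewrite (degE tT h1 h2 h3) /run_ends /mids /mid_dir.
by case: (has_nb _ _ _); case: (has_nb _ _ _); case: (has_nb _ _ _); case: (has_nb _ _ _) => //= a b;
  try (by have := a isT); try (by have := b isT).
Qed.

Lemma spineE t : (t \in spine T) = (t \in T) && (3 <= deg t)%N.
Proof.
rewrite !inE /=; case tT : (t \in T) => //=; have [_ _] := tile_types tT.
by case: (deg t) => [|[|[|[|[|]]]]].
Qed.

Lemma mid_spine t d : t \in T -> d != t.2 -> mid t d -> t \in spine T.
Proof.
move=> tT dt md; have [d' [dt' dd]] := other_dir dt.
rewrite spineE tT (degE tT dt dt' dd) /=; have := straight tT dt dt' dd md.
by case/andP: md => -> -> /orP[] ->; rewrite ?addn1 // addnC.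
Qed.

Definition n_deg k : nat := count (fun t => deg t == k) (enum_fset T).

Lemma sum_pred (p : pred tile) : (\sum_(t <- enum_fset T) p t)%N = count p (enum_fset T).
Proof. by rewrite -sum1_count [RHS]big_mkcond; apply: eq_bigr => t _; case: (p t). Qed.

Lemma count_tiles : (#|` T|%fset + n_deg 2 = 2 * num_runs T + n_deg 4)%N.
Proof.
rewrite (num_runsE disj L) -(sum_run_ends disj L) /n_deg -!sum_pred -big_split /=.
have -> : #|` T|%fset = (\sum_(t <- enum_fset T) 1)%N by rewrite sum1_size.
rewrite -big_split /= !big_seq; apply: eq_bigr => t tT.
by have [->] := tile_types tT.
Qed.

Lemma count_runs : num_runs T = (n_deg 3 + 2 * n_deg 4)%N.
Proof.
rewrite (num_runsE disj L) /n_deg -!sum_pred big_distrr -big_split /= !big_seq.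
by apply: eq_bigr => t tT; have [_ ->] := tile_types tT.
Qed.

(* [t] is an end of a run whose middle tile is [s]. *)
Definition points (t s : tile) : Prop :=
  exists d b, [/\ lnk d b t s, ~~ has_nb t d (~~ b) & has_nb s d b].

Lemma lnk_points d b t s : t \in T -> s \in T -> lnk d b t s ->
  (points t s /\ ~~ has_nb t d (~~ b)) \/ (points s t /\ has_nb t d (~~ b)).
Proof.
move=> tT sT l; have := L tT (lnk_slot l) (lnk_has_nb sT l); rewrite (lnk_nb disj sT l).
case h : (has_nb t d (~~ b)) => h'; [right|left]; split=> //.
  by exists d, (~~ b); rewrite lnk_sym negbK h -h'.
by exists d, b; rewrite h -[has_nb s d b]negbK -h'.
Qed.

Lemma points4 t s : t \in T -> points t s -> deg t != 4.
Proof.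
move=> tT [d [b [l h _]]]; have dt := lnk_slot l; have [d' [dt' dd]] := other_dir dt.
rewrite (degE tT dt dt' dd); move: h; case: b {l} => /= /negbTE ->;
  by do 3!case: (has_nb _ _ _).
Qed.

Lemma points_uniq t s s' : t \in T -> s \in T -> s' \in T -> deg t != 2 ->
  points t s -> points t s' -> s = s'.
Proof.
move=> tT sT sT' t3 [d [b [l h _]]] [d' [b' [l' h' _]]].
have n1 := lnk_has_nb sT l; have n2 := lnk_has_nb sT' l'.
have dt := lnk_slot l; have dt' := lnk_slot l'.
have [e|ne] := eqVneq d d'; last first.
  move: t3; rewrite (degE tT dt dt' ne); move: h h' n1 n2 {l l'}.
  by case: b; case: b' => /= /negbTE-> /negbTE-> -> ->.
subst d'; have [e|ne] := eqVneq b b'.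
  by subst b'; rewrite -(lnk_nb disj sT l) -(lnk_nb disj sT' l').
have e : b' = ~~ b by move: ne; case: (b); case: (b').
by subst b'; rewrite n2 in h.
Qed.

(** A spine tile points to at most one tile, and a 4-tile to none; so a connected spine drains into
    a single 4-tile. *)
Lemma four_uniq t s : t \in T -> s \in T -> deg t = 4 -> deg s = 4 -> t = s.
Proof.
move=> tT sT t4 s4.
have tS : t \in spine T by rewrite spineE tT t4.
have sS : s \in spine T by rewrite spineE sT s4.
have TS x : x \in spine T -> x \in T by rewrite spineE => /andP[].
(* [P x] says that following [points] from [x] leads to [t]. It passes along an adjacency both ways:
   a tile that points to [x] continues through [x], and a tile to which [x] points is the next one
   on the path from [x]. *)
pose P x := clos_refl_trans_1n tile (fun x y => y \in T /\ points x y) x t.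
have pres x y : clos_refl_trans tile
    (fun x y => [/\ x \in spine T, y \in spine T & tile_adjacent x y]) x y -> P x -> P y.
  elim=> [{}x {}y [xS yS ad] Px|//|{}x {}y z _ h1 _ h2 /h1/h2//].
  have xT := TS _ xS; have yT := TS _ yS.
  have [d [b l]] := adjacentP disj xT yT ad.
  case: (lnk_points yT xT l) => [[py _]|[px _]].
    exact: rt1n_trans _ Px.
  case: (rt1n_cases Px) => [e|[z [zT pz] Pz]].
    subst x; by have := points4 tT px; rewrite t4.
  rewrite (points_uniq xT yT zT _ px pz) //.
  by move: xS; rewrite spineE => /andP[_]; case: (deg x) => [|[|[|?]]].
have Ps := pres t s (spine_con tS sS) (rt1n_refl _ _ _).
case: (rt1n_cases Ps) => [//|[z [zT pz] _]].
by have := points4 sT pz; rewrite s4.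
Qed.

Lemma n4_le1 : (n_deg 4 <= 1)%N.
Proof.
rewrite /n_deg -size_filter.
set s := [seq _ <- _ | _].
have us : uniq s by apply/filter_uniq/fset_uniq.
have hs t : t \in s -> t \in T /\ deg t = 4.
  by rewrite mem_filter => /andP[/eqP-> ->].
case: s us hs => [|t [|t' s]] //= /andP[h _] hs.
have [tT t4] := hs t (mem_head _ _).
have [tT' t4'] : t' \in T /\ deg t' = 4 by apply: hs; rewrite !inE eqxx orbT.
by rewrite (four_uniq tT tT' t4 t4') mem_head in h.
Qed.

End Degrees.

(** * Tiles around an interior node *)

Section Vertex.
Variable T : {fset tile}.
Hypothesis comb : tredoku_comb T.
Hypothesis spine_con : connected_under tile_adjacent (spine T).

Local Notation has_nb := (has_nb T).
Local Notation nb := (nb T).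
Local Notation mid := (mid_dir T).
Local Notation deg := (tile_degree T).

Let disj := comb_disjoint comb.
Let L : three_runs T := size_three_runs disj (comb_runs comb).
Let uc := comb_no_holes comb.

Definition interior_node (n : node) : bool := all (covered T) (sectors n).

Section AtNode.
Variable n : node.
Hypothesis int_n : interior_node n.

(** Indices are read modulo 6, and those of the directions modulo 3, so that one can count around
    the node without wrapping. The predecessor of [i] then appears as [i + 5]. *)
Definition sec (i : nat) : tri := nth ((0, 0), false)%R (sectors n) (i %% 6).
Definition sdir (i : nat) : 'I_3 := nth o0 [:: o1; o2; o0] (i %% 3).

Lemma size_sectors : size (sectors n) = 6.
Proof. by clear; case: n. Qed.

Lemma sec_mem i : n \in verts (sec i).
Proof. by rewrite -mem_sectors mem_nth // size_sectors ltn_mod. Qed.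

Lemma sec_covered i : covered T (sec i).
Proof. by apply: (allP int_n); rewrite mem_sectors sec_mem. Qed.

Lemma sdir3 i : sdir i.+3 = sdir i.
Proof. by have e : i.+3 %% 3 = i %% 3 by lia; rewrite /sdir e. Qed.

Lemma sdir_neq i : [/\ sdir i != sdir i.+1, sdir i != sdir i.+2 & sdir i.+1 != sdir i.+2].
Proof.
have : i %% 3 = 0 /\ i.+1 %% 3 = 1 /\ i.+2 %% 3 = 2 \/
       i %% 3 = 1 /\ i.+1 %% 3 = 2 /\ i.+2 %% 3 = 0 \/
       i %% 3 = 2 /\ i.+1 %% 3 = 0 /\ i.+2 %% 3 = 1 by lia.
by rewrite /sdir; case=> [[-> [-> ->]]|[[-> [-> ->]]|[-> [-> ->]]]].
Qed.

Lemma sdir_cases i (d : 'I_3) : [\/ d = sdir i, d = sdir i.+1 | d = sdir i.+2].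
Proof.
have [h1 h2 h3] := sdir_neq i; move: h1 h2 h3.
elim/ord3P: (sdir i); elim/ord3P: (sdir i.+1) => //; elim/ord3P: (sdir i.+2) => // _ _ _;
  elim/ord3P: d; by [constructor 1|constructor 2|constructor 3].
Qed.

Lemma secS i : sec i.+1 = flip (sec i) (sdir i).
Proof.
have : exists2 k, (k < 6)%N & [/\ i %% 6 = k, i %% 3 = k %% 3 & i.+1 %% 6 = k.+1 %% 6].
  by exists (i %% 6); [rewrite ltn_mod|split; lia].
case=> k lt_k [e1 e2 e3]; rewrite /sec /sdir e1 e2 e3; move: lt_k; clear; case: n => x y.
by do 6!(case: k => [_|k] /=; [by congr ((_, _), _); lia|]).
Qed.

Lemma sec_out i : n \notin verts (flip (sec i) (sdir i.+1)).
Proof.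
have : exists2 k, (k < 6)%N & [/\ i %% 6 = k & i.+1 %% 3 = k.+1 %% 3].
  by exists (i %% 6); [rewrite ltn_mod|split; lia].
case=> k lt_k [e1 e2]; rewrite /sec /sdir e1 e2; move: lt_k; clear; case: n => x y.
by do 6!(case: k => [_|k] /=; [by rewrite !inE !xpair_eqE; lia|]).
Qed.

Lemma sec_period i j : i = j %[mod 6] -> sec i = sec j.
Proof. by rewrite /sec => ->. Qed.

Lemma sec_pred i : sec i.+4.+1 = flip (sec i) (sdir i.+2).
Proof.
have -> : sec i = sec (i.+4.+1).+1 by apply: sec_period; lia.
by rewrite (secS i.+4.+1) -(sdir3 i.+2) flipK.
Qed.

Lemma sec_inj i j : sec i = sec j -> i = j %[mod 6].
Proof.
have us : uniq (sectors n).
  by clear; case: n => x y; rewrite /= !inE !xpair_eqE /= ?andbF ?orbF /=; lia.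
by move=> /eqP; rewrite nth_uniq ?size_sectors ?ltn_mod // => /eqP.
Qed.

Definition ctile (i : nat) : tile := covering T (sec i).

Lemma ctile_in i : ctile i \in T.
Proof. by have [] := coveringP (sec_covered i). Qed.

Lemma ctile_sec i : tri_of (ctile i) (sec i).2 = sec i.
Proof. by have [] := coveringP (sec_covered i). Qed.

Lemma ctile_eq t i b : t \in T -> tri_of t b = sec i -> ctile i = t.
Proof. by move=> tT h; rewrite /ctile -h covering_tri. Qed.

Lemma ctile_sameS i : (ctile i).2 = sdir i -> ctile i.+1 = ctile i.
Proof.
move=> h; apply: (@ctile_eq _ _ (~~ (sec i).2)); first exact: ctile_in.
by rewrite secS -h -tri_of_flip ctile_sec.
Qed.

Lemma ctile_samep i : (ctile i.+1).2 = sdir i -> ctile i.+1 = ctile i.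
Proof.
move=> h; symmetry; apply: (@ctile_eq _ _ (~~ (sec i.+1).2)); first exact: ctile_in.
by rewrite -tri_of_flip ctile_sec h secS flipK.
Qed.

(* Is sector [i] the second half of a tile that also contains sector [i - 1]? *)
Definition second (i : nat) : bool := (ctile i).2 == sdir i.+2.

Definition start_mid (i : nat) : bool := mid (ctile i) (sdir i.+2).
(** The direction of the edge by which a counterclockwise turn around the node leaves the tile. If
    the diagonal comes next, the tile also fills the following sector and is left one step later. *)
Definition end_dir (i : nat) : 'I_3 := if (ctile i).2 == sdir i then sdir i.+1 else sdir i.
Definition end_mid (i : nat) : bool := mid (ctile i) (end_dir i).

Lemma end_dir_neq i : end_dir i != (ctile i).2.
Proof.
have [h1 _ _] := sdir_neq i; rewrite /end_dir; case: ifP => [/eqP ->|/negbT h]; by rewrite eq_sym.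
Qed.

Lemma start_has_nb i : ~~ second i -> has_nb (ctile i) (sdir i.+2) (sec i).2.
Proof.
by move=> _; rewrite /has_nb /out ctile_sec -sec_pred sec_covered.
Qed.

Lemma end_has_nb i : exists b, has_nb (ctile i) (end_dir i) b.
Proof.
rewrite /end_dir; case: eqP => h.
  exists (sec i.+1).2; rewrite -(ctile_sameS h) /has_nb /out ctile_sec -secS.
  exact: sec_covered.
by exists (sec i).2; rewrite /has_nb /out ctile_sec -secS sec_covered.
Qed.

Lemma boundary i : second i.+1 -> end_mid i.+1 = end_mid i.
Proof.
rewrite /second sdir3 => /eqP h; have e := ctile_samep h; rewrite /end_mid e.
congr mid_dir; rewrite /end_dir e; rewrite e in h.
by rewrite h eqxx; have [/negbTE -> _ _] := sdir_neq i.
Qed.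

(** Of two tiles linked across an edge at the node, exactly one is the middle of their run. *)
Lemma boundaryN i : ~~ second i.+1 -> start_mid i.+1 = ~~ end_mid i.
Proof.
rewrite /second sdir3 => ne.
have ne' : (ctile i).2 != sdir i.
  by apply: contra ne => /eqP h; rewrite (ctile_sameS h) h.
have l : lnk (sdir i) (sec i).2 (ctile i) (ctile i.+1).
  apply/and3P; split=> //; have := ctile_sec i.+1; rewrite secS flip2 => ->.
  by rewrite ctile_sec.
rewrite /start_mid /end_mid /end_dir (negbTE ne') sdir3.
have l' := l; rewrite -lnk_sym in l'.
have n1 := lnk_has_nb (ctile_in i.+1) l; have n2 := lnk_has_nb (ctile_in i) l'.
have := L (ctile_in i) (lnk_slot l) n1; rewrite (lnk_nb disj (ctile_in i.+1) l).
move: n1 n2; rewrite /mid_dir; case: ((sec i).2) => /= -> ->; rewrite ?andbT /=.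
  by move=> ->; rewrite negbK.
by move=> ->; rewrite negbK.
Qed.

(** By [first_deg] these mark the 2-tiles and the 4-tiles. In the turn around the node a 2-tile
    switches [end_mid] off, a 4-tile switches it on, and a 3-tile leaves it as it was. *)
Definition rise i := [&& ~~ second i, ~~ start_mid i & ~~ end_mid i].
Definition fall i := [&& ~~ second i, start_mid i & end_mid i].

Lemma rise_fall i : (rise i.+1 + ~~ end_mid i = fall i.+1 + ~~ end_mid i.+1)%N.
Proof.
rewrite /rise /fall; case h : (second i.+1) => /=; first by rewrite boundary.
by rewrite (boundaryN (negbT h)); case: (end_mid i); case: (end_mid i.+1).
Qed.

Lemma end_mid_period : end_mid 6 = end_mid 0.
Proof. by []. Qed.

Lemma first_deg i : ~~ second i -> (deg (ctile i) == 2) = rise i /\ (deg (ctile i) == 4) = fall i.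
Proof.
move=> ns; have [b hb] := end_has_nb i; have hs := start_has_nb ns.
have ns' : sdir i.+2 != (ctile i).2 by rewrite eq_sym.
have dd : sdir i.+2 != end_dir i.
  have [_ h2 h3] := sdir_neq i; rewrite /end_dir; case: ifP => _; by rewrite eq_sym.
rewrite /rise /fall ns /start_mid /end_mid /mid_dir.
rewrite (degE comb (ctile_in i) ns' (end_dir_neq i) dd).
move: hs hb; case: ((sec i).2) => ->; case: b => ->; rewrite ?andbT ?andTb /=;
  by do 2!case: (has_nb _ _ _).
Qed.

Definition tiles_at : seq tile := [seq ctile i | i <- iota 1 6 & ~~ second i].

Lemma tiles_at_uniq : uniq tiles_at.
Proof.
rewrite map_inj_in_uniq ?filter_uniq ?iota_uniq // => i j.
rewrite !mem_filter !mem_iota => /andP[si hi] /andP[sj hj] e.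
have [sij|sij] := eqVneq (sec i) (sec j); first by have := sec_inj sij; lia.
(* Different sectors of one tile are its two halves. As both lie at the node, one directly follows
   the other, and the later one is [second]. *)
have h : sec j = flip (sec i) (ctile i).2.
  rewrite -{1}(ctile_sec j) -{1}(ctile_sec i) -e tri_of_flip; congr tri_of.
  have := ctile_sec j; have := ctile_sec i; rewrite -e => h1 h2.
  move: sij h1 h2; case: ((sec i).2); case: ((sec j).2) => // sij h1 h2;
    by rewrite -h1 -h2 eqxx in sij.
case: (sdir_cases i (ctile i).2) => k.
- rewrite k -secS in h; have := sec_inj h => hij; case/negP: sj; rewrite /second -e k.
  by apply/eqP; rewrite /sdir; congr nth; lia.
- by have := sec_mem j; rewrite h k (negbTE (sec_out i)).
- by rewrite /second k eqxx in si.
Qed.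

Lemma mem_tiles_at t : (t \in tiles_at) = (t \in T) && (n \in corners t).
Proof.
apply/mapP/andP => [[i _ ->]|[tT nt]].
  split; first exact: ctile_in.
  have := sec_mem i; rewrite -{1}(ctile_sec i) mem_corners.
  by case: ((sec i).2) => ->; rewrite ?orbT.
have [b hb] : exists b, n \in verts (tri_of t b).
  by move: nt; rewrite mem_corners => /orP[]; [exists false|exists true].
rewrite -mem_sectors in hb; have := nth_index ((0, 0), false)%R hb.
set k := index _ _ => hk; have lt_k : (k < 6)%N by rewrite -size_sectors index_mem.
(* Adding 6 keeps the sector and guarantees a positive predecessor index. *)
have ck : ctile k.+4.+2 = t.
  by apply: (@ctile_eq _ _ b) => //; rewrite /sec (_ : k.+4.+2 %% 6 = k) ?hk //; lia.
have wrap i : (0 < i)%N -> exists2 j, j \in iota 1 6 & sec j = sec i /\ sdir j.+2 = sdir i.+2.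
  move=> hi; exists (i.-1 %% 6).+1; first by rewrite mem_iota; lia.
  by split; [apply: sec_period; lia|rewrite /sdir; congr nth; lia].
have first i : (0 < i)%N -> ctile i = t -> ~~ second i ->
    exists2 j, j \in [seq j <- iota 1 6 | ~~ second j] & t = ctile j.
  move=> hi ci si; have [j hj [e1 e2]] := wrap i hi; exists j; last by rewrite /ctile e1.
  by rewrite mem_filter hj andbT /second /ctile e1 e2.
have [sk|sk] := boolP (second k.+4.+2); last exact: (first k.+4.+2).
have e : (ctile k.+4.+2).2 = sdir k.+4.+1 by move: sk => /eqP ->; rewrite sdir3.
have cp := ctile_samep e.
apply: (first k.+4.+1) => //; first by rewrite -cp.
rewrite /second -cp e; have [_ h _] := sdir_neq k.+4.+1; exact: h.
Qed.

(** After a full turn [end_mid] has its initial value again, so it was switched off as often as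
    on. *)
Lemma count_at : count (fun t => deg t == 2) tiles_at = count (fun t => deg t == 4) tiles_at.
Proof.
have cnt (p : pred tile) (q : pred nat) :
    (forall i, ~~ second i -> p (ctile i) = q i) -> (forall i, q i -> ~~ second i) ->
    count p tiles_at = (q 1 + q 2 + q 3 + q 4 + q 5 + q 6)%N.
  move=> h1 h2; rewrite count_map count_filter /= addn0 !addnA.
  suff e i : (p (ctile i) && ~~ second i) = q i by rewrite !e.
  case si : (second i) => /=; last by rewrite andbT h1 ?si.
  by rewrite andbF; apply/esym/negP => /h2; rewrite si.
rewrite (cnt _ rise) ?(cnt _ fall).
- have := rise_fall 0; have := rise_fall 1; have := rise_fall 2; have := rise_fall 3.
  have := rise_fall 4; have := rise_fall 5; rewrite end_mid_period.
  move: (nat_of_bool (rise 1)) (nat_of_bool (rise 2)) (nat_of_bool (rise 3))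
    (nat_of_bool (rise 4)) (nat_of_bool (rise 5)) (nat_of_bool (rise 6))
    (nat_of_bool (fall 1)) (nat_of_bool (fall 2)) (nat_of_bool (fall 3))
    (nat_of_bool (fall 4)) (nat_of_bool (fall 5)) (nat_of_bool (fall 6))
    (nat_of_bool (~~ end_mid 0)) (nat_of_bool (~~ end_mid 1)) (nat_of_bool (~~ end_mid 2))
    (nat_of_bool (~~ end_mid 3)) (nat_of_bool (~~ end_mid 4)) (nat_of_bool (~~ end_mid 5)).
  by clear; lia.
- by move=> i /first_deg[].
- by move=> i /and3P[].
- by move=> i /first_deg[].
- by move=> i /and3P[].
Qed.

End AtNode.
Lemma interior_nodeP n : reflect (forall a, n \in verts a -> covered T a) (interior_node n).
Proof.
apply: (iffP allP) => h a; first by rewrite -mem_sectors; exact: h.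
by rewrite mem_sectors; exact: h.
Qed.

(** Both neighbours are middles of runs ending at [x], so the spine joins them, and [x] is not in
    the spine. The interior node is the corner between them. *)
Lemma two_interior x : x \in T -> deg x = 2 -> exists2 n, n \in corners x & interior_node n.
Proof.
move=> xT x2; have [h1 h2 h3] := ordS_pred x.2.
have h4 : ord_pred x.2 != ordS x.2 by rewrite eq_sym.
have [[b n1 m1] [b' n2 m2]] : (exists2 b, has_nb x (ordS x.2) b & ~~ has_nb x (ordS x.2) (~~ b)) /\
    (exists2 b, has_nb x (ord_pred x.2) b & ~~ has_nb x (ord_pred x.2) (~~ b)).
  have := straight comb xT h1 h2 h3; have := straight comb xT h2 h1 h4.
  move: x2; rewrite (degE comb xT h1 h2 h3) /mid_dir.
  case a1 : (has_nb x (ordS x.2) false); case a2 : (has_nb x (ordS x.2) true);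
  case a3 : (has_nb x (ord_pred x.2) false); case a4 : (has_nb x (ord_pred x.2) true) => //= _ k1 k2;
    try (by have := k1 isT); try (by have := k2 isT);
    split; first [by exists false; rewrite ?a1 ?a2 ?a3 ?a4|by exists true; rewrite ?a1 ?a2 ?a3 ?a4].
have sp d c : d != x.2 -> has_nb x d c -> ~~ has_nb x d (~~ c) -> nb x d c \in spine T.
  move=> dx nc mc; have [yT l] := nbP disj xT dx nc.
  have := L xT dx nc; rewrite (negbTE mc) => /esym/negbFE k1.
  have l' := l; rewrite -lnk_sym in l'; have k2 := lnk_has_nb xT l'.
  apply: (mid_spine comb yT (lnk_slot l')); rewrite /mid_dir.
  by move: k1 k2; case: (c) => -> ->.
have con : clos_refl_trans tile
    (fun s t => [/\ s \in (T `\ x)%fset, t \in (T `\ x)%fset & tile_adjacent s t])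
    (nb x (ordS x.2) b) (nb x (ord_pred x.2) b').
  apply: clos_rt_map (spine_con (sp _ _ h1 n1 m1) (sp _ _ h2 n2 m2)) => s t [sS tS ad].
  have ne y : y \in spine T -> y \in (T `\ x)%fset.
    rewrite (spineE comb) in_fsetD1 => /andP[-> k]; rewrite andbT.
    by apply: contraTneq k => ->; rewrite x2.
  by split; [exact: ne|exact: ne|].
have [v v1 v2] : exists2 v, v \in ends (tile_edge x (ordS x.2) b) &
    v \in ends (tile_edge x (ord_pred x.2) b').
  case/orP: (tile_edge_ends b b' h1 h2 h3) => /andP[k _].
    by exists (fst_end (tile_edge x (ordS x.2) b)) => //; rewrite mem_endsE eqxx.
  by exists (snd_end (tile_edge x (ordS x.2) b)) => //; rewrite mem_endsE eqxx orbT.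
exists v.
  have [k _] := ends_verts v1; rewrite mem_corners.
  by case: (b) k => ->; rewrite ?orbT.
apply/interior_nodeP => a va.
exact: (corner_tile_interior disj uc xT h1 h2 h3 n1 n2 m2 con v1 v2 va).
Qed.

(** Two 2-tiles at an interior node would require two 4-tiles there. *)
Lemma interior_two n x y : interior_node n -> x \in T -> y \in T ->
  n \in corners x -> n \in corners y -> deg x = 2 -> deg y = 2 -> x = y.
Proof.
move=> int_n xT yT nx ny x2 y2; apply/eqP; apply: contraT => xy.
have c4 : (count (fun t => deg t == 4) (tiles_at n) <= 1)%N.
  rewrite -size_filter; set s := [seq _ <- _ | _].
  have us : uniq s by apply/filter_uniq/tiles_at_uniq.
  apply: leq_trans (n4_le1 comb spine_con); rewrite /n_deg -size_filter.
  apply: uniq_leq_size => // t; rewrite !mem_filter (mem_tiles_at int_n).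
  by case/and3P=> -> ->.
have : (size [:: x; y] <= count (fun t => deg t == 2) (tiles_at n))%N.
  rewrite -size_filter; apply: uniq_leq_size; first by rewrite /= inE xy.
  move=> t; rewrite !inE mem_filter (mem_tiles_at int_n) => /orP[] /eqP ->.
    by rewrite x2 xT nx.
  by rewrite y2 yT ny.
by rewrite (count_at int_n) /=; lia.
Qed.

Lemma interior_four n x : interior_node n -> x \in T -> n \in corners x -> deg x = 2 ->
  exists r, [/\ r \in T, n \in corners r & deg r = 4].
Proof.
move=> int_n xT nx x2.
have : has (fun t => deg t == 4) (tiles_at n).
  rewrite has_count -(count_at int_n) -has_count; apply/hasP; exists x.
    by rewrite (mem_tiles_at int_n) xT.
  by rewrite x2.
by case/hasP=> r; rewrite (mem_tiles_at int_n) => /andP[rT nr] /eqP r4; exists r.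
Qed.

Lemma four_not_interior n r : n_deg T 2 = 0 -> r \in T -> n \in corners r -> deg r = 4 ->
  ~~ interior_node n.
Proof.
move=> n2 rT nr r4; apply/negP => int_n.
have : has (fun t => deg t == 2) (tiles_at n).
  rewrite has_count (count_at int_n) -has_count; apply/hasP; exists r.
    by rewrite (mem_tiles_at int_n) rT.
  by rewrite r4.
case/hasP=> x; rewrite (mem_tiles_at int_n) => /andP[xT _] x2.
have : has (fun t => deg t == 2) (enum_fset T) by apply/hasP; exists x.
by rewrite has_count -/(n_deg T 2) n2.
Qed.

(** Each 2-tile is sent to one of its interior corners. Distinct 2-tiles have distinct images, and
    all images are corners of the only 4-tile, which has four. *)
Lemma n2_bound : (n_deg T 2 <= 4 * n_deg T 4)%N.
Proof.
have [n4|] := posnP (n_deg T 4).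
  rewrite leqNgt n4 muln0; apply/negP; rewrite -has_count => /hasP[x xT /eqP x2].
  have [n nx int_n] := two_interior xT x2.
  have [r [rT _ r4]] := interior_four int_n xT nx x2.
  have : has (fun t => deg t == 4) (enum_fset T) by apply/hasP; exists r => //; rewrite r4.
  by rewrite has_count -/(n_deg T 4) n4.
rewrite -has_count => /hasP[r rT /eqP r4].
have n4 : n_deg T 4 = 1.
  apply/eqP; rewrite eqn_leq (n4_le1 comb spine_con) -has_count; apply/hasP; exists r => //.
  by rewrite r4.
rewrite n4 muln1 /n_deg -size_filter; set X := [seq _ <- _ | _].
pose v x := nth (0, 0)%R (corners x) (find interior_node (corners x)).
have vP x : x \in X -> [/\ x \in T, deg x = 2, v x \in corners x & interior_node (v x)].
  rewrite mem_filter => /andP[/eqP x2 xT]; have [n nx int_n] := two_interior xT x2.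
  have hx : has interior_node (corners x) by apply/hasP; exists n.
  by split=> //; [rewrite mem_nth -?has_find|exact: nth_find].
rewrite -(size_map v) -[4]/(size (corners r)); apply: uniq_leq_size.
  rewrite map_inj_in_uniq; first by apply/filter_uniq/fset_uniq.
  move=> x y /vP[xT x2 vx ix] /vP[yT y2 vy iy] e.
  by rewrite -e in vy; exact: (interior_two ix xT yT vx vy x2 y2).
move=> n /mapP[x /vP[xT x2 vx ix] ->].
have [r' [rT' nr r4']] := interior_four ix xT vx x2.
by rewrite (four_uniq comb spine_con rT rT' r4 r4').
Qed.

End Vertex.

(** * The tree case *)

Section TreeCase.
Variable T : {fset tile}.
Hypothesis comb : tredoku_comb T.
Hypothesis spine_con : connected_under tile_adjacent (spine T).

Local Notation has_nb := (has_nb T).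
Local Notation nb := (nb T).
Local Notation deg := (tile_degree T).

Let disj := comb_disjoint comb.

(* The angle of [t] at [n] in units of 60 degrees. *)
Definition angle (t : tile) (n : node) : nat :=
  (n \in verts (tri_of t false)) + (n \in verts (tri_of t true)).

Lemma angle_edge t d b : d != t.2 ->
  (angle t (fst_end (tile_edge t d b)) + angle t (snd_end (tile_edge t d b)) = 3)%N.
Proof.
case: t => [[x y] o]; elim/ord3P: o; elim/ord3P: d => //= _; case: b;
  rewrite /angle /tile_edge /= ?snd_endE !inE !xpair_eqE /=; clear; lia.
Qed.

Lemma angle_gt0 t n : n \in corners t -> (0 < angle t n)%N.
Proof. by rewrite mem_corners /angle => /orP[] ->; rewrite ?addn1. Qed.

(** Distinct tiles cover distinct sectors at [n], and at least one of the six sectors is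
    uncovered. *)
Lemma angle_sum s n : uniq s -> {subset s <= T} -> ~~ interior_node T n ->
  (\sum_(t <- s) angle t n <= 5)%N.
Proof.
move=> us sT; rewrite /interior_node all_count size_sectors => ni.
pose P := [seq a <- [seq tri_of t b | t <- s, b <- [:: false; true]] | n \in verts a].
have -> : (\sum_(t <- s) angle t n)%N = size P.
  rewrite size_filter -sum1_count [RHS]big_mkcond big_allpairs_dep /=.
  apply: eq_bigr => t _; rewrite !big_cons big_nil /angle /=.
  by do 2!case: (n \in _).
have : (size P <= size [seq a <- sectors n | covered T a])%N.
  apply: uniq_leq_size.
    apply/filter_uniq/allpairs_uniq => // -[t b] [t' b'].
    move=> h h' /= e; have {}h : t \in s by case/allpairsP: h => -[x y] [/= hx _ [-> _]].
    have {}h' : t' \in s by case/allpairsP: h' => -[x y] [/= hx _ [-> _]].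
    have := congr1 snd e; rewrite !tri_of2 => eb; subst b'.
    by rewrite (disjP disj (sT _ h) (sT _ h') e).
  move=> a; rewrite !mem_filter mem_sectors => /andP[-> h].
  case/allpairsP: h => -[t b] [/= h _ ->].
  by rewrite andbT tile_covered // sT.
have : (count (covered T) (sectors n) <= 6)%N by rewrite -(size_sectors n) count_size.
rewrite (size_filter (covered T)); move: ni; move: (size P) (count _ _); clear; lia.
Qed.

Lemma tedge_flip a d : tedge (flip a d) d = tedge a d.
Proof.
case: a => [[x y] []]; elim/ord3P: d => /=; congr ((_, _), _); lia.
Qed.

Lemma lnk_edge d b t s : lnk d b t s -> tile_edge s d (~~ b) = tile_edge t d b.
Proof. by move=> /and3P[_ _ /eqP h]; rewrite /tile_edge h tedge_flip. Qed.

Lemma edge_corner t d b n : n \in ends (tile_edge t d b) -> n \in corners t.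
Proof. by move=> /ends_verts[h _]; rewrite mem_corners; case: b h => ->; rewrite ?orbT. Qed.

Lemma lnk_corner d b t s n : lnk d b t s -> n \in ends (tile_edge t d b) -> n \in corners s.
Proof. by move=> l; rewrite -(lnk_edge l); exact: edge_corner. Qed.

Lemma turn t d b d' n : d != t.2 -> d' != t.2 -> d != d' -> n \in ends (tile_edge t d b) ->
  exists c, n \in ends (tile_edge t d' c).
Proof.
move=> dt dt' dd; rewrite mem_endsE => h.
case/orP: (tile_edge_ends b false dt dt' dd) => /andP[h1 h2].
  by case/orP: h => /eqP ->; [exists false|exists true].
by case/orP: h => /eqP ->; [exists true|exists false].
Qed.

Lemma connected_exit (S : {fset tile}) (p : pred tile) x y :
  connected_under tile_adjacent S -> x \in S -> y \in S -> p x -> ~~ p y ->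
  exists u w, [/\ u \in S, w \in S, p u, ~~ p w & tile_adjacent u w].
Proof.
move=> con xS yS px py; elim: (con x y xS yS) px py => {x y xS yS}.
- by move=> u w [uS wS ad] pu pw; exists u, w.
- by move=> u ->.
- move=> u w z _ h1 _ h2 pu pz; case pw : (p w); first exact: h2.
  by apply: h1 => //; rewrite pw.
Qed.

Hypothesis n20 : n_deg T 2 = 0.
Variable R : tile.
Hypothesis RT : R \in T.
Hypothesis R4 : deg R = 4.

Lemma no2 t : t \in T -> deg t != 2.
Proof.
move=> tT; apply/negP => t2.
have : has (fun t => deg t == 2) (enum_fset T) by apply/hasP; exists t.
by rewrite has_count -/(n_deg T 2) n20.
Qed.

Lemma pointsE t s s' : t \in T -> s \in T -> s' \in T -> points T t s -> points T t s' -> s = s'.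
Proof. by move=> tT sT sT'; apply: (points_uniq comb) => //; exact: no2. Qed.

Lemma R_points s : ~ points T R s.
Proof. by move=> /(points4 comb RT); rewrite R4. Qed.

Lemma points_neq t s : t \in T -> s \in T -> points T t s -> t != s.
Proof.
by move=> tT sT [d [b [l _ _]]]; rewrite eq_sym; exact: (lnk_neq sT tT l).
Qed.

Lemma R_has_nb d b : d != R.2 -> has_nb R d b.
Proof.
move=> dR; have [d' [dR' dd]] := other_dir dR.
have := R4; rewrite (degE comb RT dR dR' dd).
by case: b; do 4!case: (has_nb _ _ _).
Qed.

(** A 3-tile that is an end in direction [d] is a middle in the other direction. Both neighbours
    there point to it, and each end of its [d]-edge lies on one of them. *)
Lemma child Z d b n : Z \in T -> deg Z = 3 -> d != Z.2 -> ~~ has_nb Z d (~~ b) ->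
  n \in ends (tile_edge Z d b) -> exists C, [/\ C \in T, n \in corners C & points T C Z].
Proof.
move=> ZT Z3 dZ m nn; have [d' [dZ' dd]] := other_dir dZ.
have [c hc] := turn dZ dZ' dd nn.
have hn e : has_nb Z d' e.
  move: Z3; rewrite (degE comb ZT dZ dZ' dd); move: m.
  by case: b {nn} => /negbTE /= ->; case: e; do 3!case: (has_nb _ _ _).
have [CT l] := nbP disj ZT dZ' (hn c).
exists (nb Z d' c); split=> //; first exact: lnk_corner l hc.
by case: (lnk_points comb ZT CT l) => [[_]|[]//]; rewrite hn.
Qed.

Lemma R_side d c : d != R.2 -> [/\ nb R d c \in T, lnk d c R (nb R d c) & points T (nb R d c) R].
Proof.
move=> dR; have [YT l] := nbP disj RT dR (R_has_nb c dR); split=> //.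
by case: (lnk_points comb RT YT l) => [[/R_points]|[]//].
Qed.

Section Arm.
Variables (X : tile) (d : 'I_3) (b : bool).
Hypothesis XT : X \in T.
Hypothesis X3 : deg X = 3.
Hypothesis lX : lnk d b R X.

Let dR : d != R.2 := lnk_slot lX.
Let lX' : lnk d (~~ b) X R. Proof. by rewrite lnk_sym. Qed.
Let dX : d != X.2 := lnk_slot lX'.

Lemma arm_points : points T X R.
Proof. by case: (lnk_points comb RT XT lX) => [[/R_points]|[]//]. Qed.

Lemma arm_end : ~~ has_nb X d b.
Proof.
by case: (lnk_points comb XT RT lX') => [[_]|[/R_points//]]; rewrite negbK.
Qed.

Lemma arm_child n : n \in ends (tile_edge R d b) ->
  exists A, [/\ A \in T, n \in corners A & points T A X].
Proof.
move=> nn; apply: (@child X d (~~ b)) => //; first by rewrite negbK arm_end.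
by rewrite (lnk_edge lX).
Qed.

Lemma arm_uniq d' c A : d' != R.2 -> d != d' -> A \in T -> points T A X ->
  uniq [:: R; X; nb R d' c; A].
Proof.
move=> dR' dd AT pA; have [YT l pY] := R_side c dR'.
have h1 : R != X by rewrite eq_sym (points_neq XT RT arm_points).
have h2 : R != nb R d' c by rewrite eq_sym (points_neq YT RT pY).
have h3 : R != A by apply/eqP => e; subst A; exact: R_points pA.
have h4 : X != nb R d' c.
  apply: contra dd => /eqP e; rewrite -e in l.
  by have [-> _] := lnk_inj lX l.
have h5 : X != A by rewrite eq_sym (points_neq AT XT pA).
have h6 : nb R d' c != A.
  apply/eqP => e; rewrite e in pY; case/eqP: h1; exact: pointsE pY pA.
by rewrite /= !inE !negb_or h1 h2 h3 h4 h5 h6.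
Qed.

Lemma arm_sum n d' c A s : n \in ends (tile_edge R d b) -> d' != R.2 -> d != d' -> A \in T ->
  points T A X -> {subset s <= T} -> uniq (s ++ [:: R; X; nb R d' c; A]) ->
  (\sum_(t <- s) angle t n + (angle R n + angle X n + angle (nb R d' c) n + angle A n) <= 5)%N.
Proof.
move=> nn dR' dd AT pA sT us; have [YT _ _] := R_side c dR'.
have := angle_sum (n := n) us; rewrite big_cat !big_cons big_nil /= addn0 !addnA; apply.
  by move=> t; rewrite mem_cat => /orP[/sT//|]; rewrite !inE => /or4P[] /eqP ->.
exact: (four_not_interior comb n20 RT (edge_corner nn) R4).
Qed.

(** The angles at the two ends of the common edge of [R] and [X] add up to at most 10. Each of these
    two tiles contributes 3, and at either end two more tiles contribute at least 1 each, so
    equality holds throughout. *)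
Lemma arm_angles n d' c A : n \in ends (tile_edge R d b) -> d' != R.2 -> d != d' ->
  n \in ends (tile_edge R d' c) -> A \in T -> points T A X -> n \in corners A ->
  (angle R n + angle X n + angle (nb R d' c) n + angle A n = 5)%N /\ angle (nb R d' c) n = 1.
Proof.
move=> nn dR' dd nc AT pA nA.
have [n' nn' [eR eX]] : exists2 n', n' \in ends (tile_edge R d b) &
    (angle R n + angle R n' = 3)%N /\ (angle X n + angle X n' = 3)%N.
  have hR := angle_edge b dR; have hX := angle_edge (~~ b) dX.
  rewrite (lnk_edge lX) in hX.
  move: nn; rewrite mem_endsE => /orP[] /eqP ->.
    by exists (snd_end (tile_edge R d b)) => //; rewrite mem_endsE eqxx orbT.
  by exists (fst_end (tile_edge R d b)); rewrite ?mem_endsE ?eqxx // ![(angle _ (snd_end _) + _)%N]addnC.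
have [c' nc'] := turn dR dR' dd nn'; have [A' [AT' nA' pA']] := arm_child nn'.
have [YT l _] := R_side c dR'; have [YT' l' _] := R_side c' dR'.
have sub0 : {subset [::] <= T} by [].
have h1 := arm_sum nn dR' dd AT pA sub0 (arm_uniq c dR' dd AT pA).
have h2 := arm_sum nn' dR' dd AT' pA' sub0 (arm_uniq c' dR' dd AT' pA').
rewrite big_nil add0n in h1; rewrite big_nil add0n in h2.
have k1 := angle_gt0 nA; have k2 := angle_gt0 nA'.
have k3 := angle_gt0 (lnk_corner l nc); have k4 := angle_gt0 (lnk_corner l' nc').
by move: h1 h2 k1 k2 k3 k4 eR eX; clear; lia.
Qed.

(* A fifth tile at [n] would close up the star of [n]. *)
Lemma arm_no_fifth n d' c A C Z : n \in ends (tile_edge R d b) -> d' != R.2 -> d != d' ->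
  n \in ends (tile_edge R d' c) -> A \in T -> points T A X -> n \in corners A ->
  C \in T -> n \in corners C -> Z \in T -> points T C Z -> Z = A \/ Z = nb R d' c -> False.
Proof.
move=> nn dR' dd nc AT pA nA CT nC ZT pC hZ.
have [YT l pY] := R_side c dR'; have ua := arm_uniq c dR' dd AT pA.
have : uniq ([:: C] ++ [:: R; X; nb R d' c; A]).
  rewrite cat_uniq ua andbT /= orbF !inE !negb_or.
  move: ua; rewrite /= !inE !negb_or => /and4P[/and3P[u1 u2 u3] /andP[u4 u5] u6 _].
  apply/and4P; split; apply/eqP => e; rewrite -e in pC CT.
  - exact: R_points pC.
  - have eZ := pointsE XT ZT RT pC arm_points; case: hZ => e'.
      by rewrite -e' eZ eqxx in u3.
    by rewrite -e' eZ eqxx in u2.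
  - case: hZ => e'; last by have := points_neq CT ZT pC; rewrite e' eqxx.
    by have eZ := pointsE CT ZT RT pC pY; rewrite -e' eZ eqxx in u3.
  - case: hZ => e'; first by have := points_neq CT ZT pC; rewrite e' eqxx.
    by have eZ := pointsE CT ZT XT pC pA; rewrite -e' eZ eqxx in u4.
move=> us; have sC : {subset [:: C] <= T} by move=> t; rewrite inE => /eqP ->.
have := arm_sum nn dR' dd AT pA sC us; rewrite big_cons big_nil.
have [-> _] := arm_angles nn dR' dd nc AT pA nA; have := angle_gt0 nC.
by move: (angle C n); clear; lia.
Qed.

End Arm.

Lemma spine_deg3 t : t \in spine T -> t != R -> t \in T /\ deg t = 3.
Proof.
move=> tS tR; have := tS; rewrite (spineE comb) => /andP[tT t3]; split=> //.
have [_ _ t4] := tile_types comb tT; apply/eqP; rewrite eqn_leq t3 andbT.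
rewrite -ltnS ltn_neqAle t4 andbT; apply: contra tR => /eqP t4'.
by rewrite (four_uniq comb spine_con tT RT t4' R4).
Qed.

(** With two 3-tiles, the connected spine would contain a 3-tile [X] next to [R] and another one [Z]
    next to [R] or [X]. Every position of [Z] contradicts [arm_angles]. *)
Lemma n3_le1 : (n_deg T 3 <= 1)%N.
Proof.
rewrite leqNgt; apply/negP => n3.
have R_spine : R \in spine T by rewrite (spineE comb) RT R4.
have ex3 x : exists2 t, t \in spine T & (t != R) && (t != x).
  move: n3; rewrite /n_deg -size_filter; set s := [seq _ <- _ | _] => n3.
  have us : uniq s by apply/filter_uniq/fset_uniq.
  have hs t : t \in s -> t \in spine T /\ t != R.
    rewrite mem_filter => /andP[/eqP t3 tT]; rewrite (spineE comb) tT t3; split=> //.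
    by apply/eqP => e; rewrite e R4 in t3.
  case: s us hs n3 => [|t [|t' s]] //= /andP[h _] hs _.
  have [h1 h2] := hs t (mem_head _ _); have [h3 h4] : t' \in spine T /\ t' != R.
    by apply: hs; rewrite !inE eqxx orbT.
  have [tx|tx] := eqVneq t x; last by exists t => //; rewrite h2.
  exists t' => //; rewrite h4 /=; apply: contra h => /eqP e; subst x.
  by rewrite e inE eqxx.
have [y yS /andP[yR _]] := ex3 R.
have [R' [X [_ XS /eqP eR XR ad]]] := connected_exit (p := pred1 R) spine_con R_spine yS (eqxx _) yR.
rewrite {}eR {R'} in ad; have [XT X3] := spine_deg3 XS XR.
have ad' : tile_adjacent X R.
  by move: ad; rewrite /tile_adjacent eq_sym => /andP[-> /hasP[e e1 e2]]; apply/hasP; exists e.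
have [d [b lX]] := adjacentP disj XT RT ad'.
have [Z0 Z0S /andP[Z0R Z0X]] := ex3 X.
have nZ0 : ~~ pred2 R X Z0 by rewrite /= negb_or Z0R.
have pR : pred2 R X R by rewrite /= eqxx.
have [U [Z [US ZS UP ZP adZ]]] := connected_exit spine_con R_spine Z0S pR nZ0.
rewrite /= negb_or in ZP; case/andP: ZP => ZR ZX; have [ZT Z3] := spine_deg3 ZS ZR.
have adZ' : tile_adjacent Z U.
  by move: adZ; rewrite /tile_adjacent eq_sym => /andP[-> /hasP[e e1 e2]]; apply/hasP; exists e.
have dR := lnk_slot lX; have lX' : lnk d (~~ b) X R by rewrite lnk_sym.
have dX := lnk_slot lX'.
case/orP: UP => /eqP eU; subst U.
- have [d2 [b2 lZ]] := adjacentP disj ZT RT adZ'.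
  have dR2 := lnk_slot lZ.
  have [e|dd] := eqVneq d d2.
    (* [Z] is opposite to [X] across [R]. A neighbour of [R] on another side then has angle 1 at
       both ends of its edge with [R], but angles along an edge add up to 3. *)
    subst d2; have eb : b2 = ~~ b.
      have [e|] := eqVneq b2 b; last by case: (b2); case: (b).
      by subst b2; rewrite -(lnk_nb disj XT lX) -(lnk_nb disj ZT lZ) eqxx in ZX.
    subst b2; have [d' [dR' dd]] := other_dir dR.
    have dd' : d' != d by rewrite eq_sym.
    have [YT lY pY] := R_side false dR'.
    have one n : n \in ends (tile_edge R d' false) -> angle (nb R d' false) n = 1.
      move=> nn; have [c nc] := turn dR' dR dd' nn.
      have [e|ne] := eqVneq c b.
        subst c; have [A [AT nA pA]] := arm_child XT X3 lX nc.
        by have [] := arm_angles XT X3 lX nc dR' dd nn AT pA nA.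
      have e : c = ~~ b by move: ne; case: (c); case: (b).
      subst c; have [A [AT nA pA]] := arm_child ZT Z3 lZ nc.
      by have [] := arm_angles ZT Z3 lZ nc dR' dd nn AT pA nA.
    have lY' : lnk d' true (nb R d' false) R by rewrite -lnk_sym.
    have := angle_edge true (lnk_slot lY'); rewrite (lnk_edge lY).
    by rewrite !one // mem_endsE eqxx ?orbT.
  (* [X] and [Z] lie on sides of [R] with a common corner [n], and a tile at [n] that points to [Z]
     is the fifth one there. *)
  have dd' : d2 != d by rewrite eq_sym.
  have eZ := lnk_nb disj ZT lZ.
  have [n n1 n2] : exists2 n, n \in ends (tile_edge R d b) & n \in ends (tile_edge R d2 b2).
    case/orP: (tile_edge_ends b b2 dR dR2 dd) => /andP[k _].
      by exists (fst_end (tile_edge R d b)) => //; rewrite mem_endsE eqxx.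
    by exists (snd_end (tile_edge R d b)) => //; rewrite mem_endsE eqxx orbT.
  have [A [AT nA pA]] := arm_child XT X3 lX n1.
  have [C [CT nC pC]] := arm_child ZT Z3 lZ n2.
  by apply: (arm_no_fifth XT X3 lX n1 dR2 dd n2 AT pA nA CT nC ZT pC); right.
(* [Z] now points to [X] and shares a corner [n] with [R], and a tile at [n] that points to [Z] is
   the fifth one there. *)
- have [d2 [b2 lZ]] := adjacentP disj ZT XT adZ'.
  have dX2 := lnk_slot lZ.
  have [e|dd] := eqVneq d d2.
    subst d2; have [e|ne] := eqVneq b2 b.
      by subst b2; have := arm_end XT lX; rewrite (lnk_has_nb ZT lZ).
    have e : b2 = ~~ b by move: ne; case: (b2); case: (b).
    by subst b2; rewrite -(lnk_nb disj ZT lZ) (lnk_nb disj RT lX') eqxx in ZR.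
  have [n n1 n2] : exists2 n, n \in ends (tile_edge R d b) & n \in ends (tile_edge X d2 b2).
    rewrite -(lnk_edge lX); case/orP: (tile_edge_ends (~~ b) b2 dX dX2 dd) => /andP[k _].
      by exists (fst_end (tile_edge X d (~~ b))) => //; rewrite mem_endsE eqxx.
    by exists (snd_end (tile_edge X d (~~ b))) => //; rewrite mem_endsE eqxx orbT.
  have [d' [dR' dd']] := other_dir dR; have [c nc] := turn dR dR' dd' n1.
  have [pZ hZ] : points T Z X /\ ~~ has_nb Z d2 b2.
    have lZ' : lnk d2 (~~ b2) Z X by rewrite lnk_sym.
    case: (lnk_points comb ZT XT lZ') => [[p h]|[p _]]; first by rewrite negbK in h.
    have := pointsE XT ZT RT p (arm_points XT lX) => e; by rewrite e eqxx in ZR.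
  have lZ' : lnk d2 (~~ b2) Z X by rewrite lnk_sym.
  have nZ := lnk_corner lZ n2.
  have [||C [CT nC pC]] := @child Z d2 (~~ b2) n ZT Z3 (lnk_slot lZ').
  - by rewrite negbK.
  - by rewrite (lnk_edge lZ).
  by apply: (arm_no_fifth XT X3 lX n1 dR' dd' nc ZT pZ nZ CT nC ZT pC); left.
Qed.

End TreeCase.

Lemma irreducible_bounds (R : realType) (T : {fset tile}) (tau rho : nat) :
  irreducible_tredoku R T -> #|` T|%fset = tau -> num_runs T = rho ->
  (tau, rho) <> (5, 2) -> (tau, rho) <> (7, 3) ->
  2 * rho - 3 <= tau <= 2 * rho.
Proof.
move=> [/tredoku_combP comb sp] eT er n52 n73.
have h1 := count_tiles comb; have h2 := count_runs comb.
have h3 := n4_le1 comb sp; have h4 := n2_bound comb sp.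
rewrite eT er in h1; rewrite er in h2.
(* The counts give the bounds unless [n_2 = 0] and [n_4 = 1]. Then [tau = 2 rho + 1] and
   [rho = n_3 + 2] with [n_3 <= 1], which are the two excluded pairs. *)
have : (0 < n_deg T 2) || (n_deg T 4 == 0) || (n_deg T 2 == 0) && (0 < n_deg T 4) by lia.
case/orP=> [h|/andP[/eqP h5]]; first by lia.
rewrite -has_count => /hasP[r rT /eqP r4].
have h6 := n3_le1 comb sp h5 rT r4.
have h7 : n_deg T 4 = 1.
  apply/eqP; rewrite eqn_leq h3 -has_count; apply/hasP; exists r => //; by rewrite r4.
rewrite h5 h7 in h1; rewrite h7 in h2.
case e3 : (n_deg T 3) h6 h2 => [|[|]] // _ h2.
  by case: n52; congr pair; lia.
by case: n73; congr pair; lia.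
Qed.

(** * Building tilings tile by tile *)

Section Shelling.

Definition in_tile (t : tile) (a : tri) : bool := (a == tri_of t false) || (a == tri_of t true).

Lemma in_tileP t a : reflect (exists b, a = tri_of t b) (in_tile t a).
Proof.
apply: (iffP orP) => [[]/eqP ->|[[] ->]]; [by exists false|by exists true|by right|by left].
Qed.

(** A tile fills one sector at an acute corner and two consecutive ones at an obtuse corner, so [m]
    is 5 or 4 and the remaining sectors form an arc. *)
Lemma sectors_arc t n : n \in corners t -> exists k m,
  all (predC (in_tile t)) (take m (rot k (sectors n))) /\
  all (in_tile t) (drop m (rot k (sectors n))).
Proof.
case: t n => [[x y] o] [p q]; elim/ord3P: o; rewrite cornersE !inE !xpair_eqE
  => /or4P[] /andP[/eqP-> /eqP->].
- by exists 2, 5; split; rewrite /rot /in_tile /= !xpair_eqE /=; lia.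
- by exists 4, 4; split; rewrite /rot /in_tile /= !xpair_eqE /=; lia.
- by exists 1, 4; split; rewrite /rot /in_tile /= !xpair_eqE /=; lia.
- by exists 5, 5; split; rewrite /rot /in_tile /= !xpair_eqE /=; lia.
- by exists 2, 4; split; rewrite /rot /in_tile /= !xpair_eqE /=; lia.
- by exists 0, 5; split; rewrite /rot /in_tile /= !xpair_eqE /=; lia.
- by exists 3, 5; split; rewrite /rot /in_tile /= !xpair_eqE /=; lia.
- by exists 5, 4; split; rewrite /rot /in_tile /= !xpair_eqE /=; lia.
- by exists 1, 5; split; rewrite /rot /in_tile /= !xpair_eqE /=; lia.
- by exists 3, 4; split; rewrite /rot /in_tile /= !xpair_eqE /=; lia.
- by exists 0, 4; split; rewrite /rot /in_tile /= !xpair_eqE /=; lia.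
- by exists 4, 5; split; rewrite /rot /in_tile /= !xpair_eqE /=; lia.
Qed.

Definition flip_adj (a b : tri) : bool := [exists d, b == flip a d].

Lemma sectors_cycle n : cycle flip_adj (sectors n).
Proof.
have h a d b : b = flip a d -> flip_adj a b by move=> ->; apply/existsP; exists d.
case: n => x y /=; rewrite !andbT; do !(apply/andP; split);
  [apply: (h _ o1)|apply: (h _ o2)|apply: (h _ o0)|apply: (h _ o1)|apply: (h _ o2)|apply: (h _ o0)];
  rewrite /=; congr ((_, _), _); lia.
Qed.

Lemma sorted_clos (Q : tri -> tri -> Prop) (s : seq tri) :
  (forall a b, a \in s -> b \in s -> flip_adj a b -> Q a b) -> sorted flip_adj s ->
  forall a b, a \in s -> b \in s -> clos_refl_trans tri Q a b.
Proof.
have fs a b : flip_adj a b = flip_adj b a.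
  by apply/existsP/existsP => -[d /eqP ->]; exists d; rewrite flipK.
move=> hQ so.
suff h : forall a, a \in s -> clos_refl_trans tri Q (head a s) a /\ clos_refl_trans tri Q a (head a s).
  move=> a b ha hb; have [_ h1] := h a ha; have [h2 _] := h b hb.
  have e : head a s = head b s by case: (s) ha.
  by apply: rt_trans h1 _; rewrite e.
elim: s so hQ => // x s IHs so hQ a; rewrite inE => /orP[/eqP ->|ha].
  by split; exact: rt_refl.
case: s IHs so hQ ha => // y s IHs /= /andP[xy so] hQ ha.
have [|h1 h2] := IHs so _ a ha.
  by move=> u v hu hv; apply: hQ; rewrite inE ?hu ?hv orbT.
have q1 : Q x y by apply: hQ => //; rewrite !inE eqxx ?orbT.
have q2 : Q y x by apply: hQ; rewrite ?(fs y) // !inE eqxx ?orbT.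
by split; [apply: rt_trans h1; exact: rt_step|apply: rt_trans h2 _; exact: rt_step].
Qed.

Lemma arc_connected t n (Q : tri -> tri -> Prop) : n \in corners t ->
  (forall a b, n \in verts a -> n \in verts b -> ~~ in_tile t a -> ~~ in_tile t b ->
     flip_adj a b -> Q a b) ->
  forall a b, n \in verts a -> n \in verts b -> ~~ in_tile t a -> ~~ in_tile t b ->
    clos_refl_trans tri Q a b.
Proof.
move=> nt hQ a b na nb' ta tb; have [k [m [h1 h2]]] := sectors_arc nt.
set s := take m (rot k (sectors n)) in h1.
have ms c : c \in s -> n \in verts c /\ ~~ in_tile t c.
  move=> cs; split; last exact: (allP h1 _ cs).
  by rewrite -mem_sectors -(mem_rot k); exact: mem_take cs.
have sm c : n \in verts c -> ~~ in_tile t c -> c \in s.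
  rewrite -mem_sectors -(mem_rot k) -(cat_take_drop m (rot k (sectors n))) mem_cat.
  by case/orP=> // /(allP h2) ->.
apply: (@sorted_clos Q s) => //; [| |exact: sm|exact: sm].
- by move=> c d /ms[? ?] /ms[? ?]; exact: hQ.
- apply: take_sorted; have := sectors_cycle n; rewrite -(rot_cycle k).
  by case: (rot k _) => //= x s'; rewrite rcons_path => /andP[].
Qed.

Lemma uconnected0 : uconnected fset0.
Proof.
have u0 a : ~~ covered fset0 a by rewrite /covered; apply/existsPn => d; rewrite in_fset0.
have st a d : ustep fset0 a (flip a d) by split; [exact: u0|exact: u0|exists d].
pose Q := clos_refl_trans tri (ustep fset0).
have sym a b : Q a b -> Q b a.
  elim=> {a b} [a b [ua ub [d ->]]|a|a b c _ h1 _ h2].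
  - by rewrite -{2}(flipK a d); apply: rt_step; exact: st.
  - exact: rt_refl.
  - exact: rt_trans h2 h1.
pose z : tri := ((0, 0), false)%R.
have mv a d d' : Q a (flip (flip a d) d').
  by apply: rt_trans (rt_step _ _ _ _ (st a d)) (rt_step _ _ _ _ (st _ d')).
have row (x y : int) : Q ((0, y), false)%R ((x, y), false)%R.
  elim/int_rect: x => [|k IH|k IH]; first exact: rt_refl.
  - apply: rt_trans IH _; have := mv ((Posz k, y), false) o2 o1; rewrite /=.
    by rewrite (_ : (Posz k + 1)%R = Posz k.+1) //; lia.
  - apply: rt_trans IH _; have := mv ((- Posz k, y), false)%R o1 o2; rewrite /=.
    by rewrite (_ : (- Posz k - 1)%R = (- Posz k.+1)%R) //; lia.
have col (y : int) : Q z ((0, y), false)%R.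
  elim/int_rect: y => [|k IH|k IH]; first exact: rt_refl.
  - apply: rt_trans IH _; have := mv ((0%R, Posz k), false) o2 o0; rewrite /=.
    by rewrite (_ : (Posz k + 1)%R = Posz k.+1) //; lia.
  - apply: rt_trans IH _; have := mv ((0, - Posz k), false)%R o0 o2; rewrite /=.
    by rewrite (_ : (- Posz k - 1)%R = (- Posz k.+1)%R) //; lia.
have all a : Q z a.
  case: a => [[x y] b]; have h : Q z ((x, y), false) by exact: rt_trans (col y) (row x y).
  case: b => //; apply: rt_trans h _; exact: rt_step (st ((x, y), false) o2).
by move=> a b _ _; apply: rt_trans (all b); apply: sym.
Qed.

(* The common end of [tile_edge t (ordS t.2) b] and [tile_edge t (ord_pred t.2) b']. *)
Definition cnr (t : tile) (b b' : bool) : node :=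
  let: ((x, y), o) := t in
  (match val o, b, b' with
   | 0, false, false => (x - 1, y + 2) | 0, false, true => (x - 1, y + 1)
   | 0, true, false => (x, y + 1) | 0, true, true => (x, y)
   | 1, false, false => (x + 1, y) | 1, false, true => (x, y + 1)
   | 1, true, false => (x, y) | 1, true, true => (x - 1, y + 1)
   | _, false, false => (x, y) | _, false, true => (x + 1, y)
   | _, true, false => (x, y + 1) | _, true, true => (x + 1, y + 1) end)%R.

Lemma cnr_ends t b b' : (cnr t b b' \in ends (tile_edge t (ordS t.2) b)) &&
  (cnr t b b' \in ends (tile_edge t (ord_pred t.2) b')).
Proof.
case: t => [[x y] o]; elim/ord3P: o; rewrite /= ?ordSE ?ord_predE /tile_edge /=;
  case: b; case: b'; rewrite /= !endsE !inE !xpair_eqE; lia.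
Qed.

Definition free_node (K : seq tile) (n : node) : bool := all (fun s => n \notin corners s) K.

(** Sides and corners alternate around [t], and at a free corner the triangles beyond its two sides
    are joined through uncovered sectors. The count ensures that all triangles beyond free sides
    stay joined after [t] is added. *)
Definition shell (K : {fset tile}) (t : tile) : bool :=
  [&& ~~ covered K (tri_of t false), ~~ covered K (tri_of t true) &
   ~~ has_nb K t (ordS t.2) false + ~~ has_nb K t (ordS t.2) true
   + ~~ has_nb K t (ord_pred t.2) false + ~~ has_nb K t (ord_pred t.2) true
   <= 1 + free_node K (cnr t false false) + free_node K (cnr t false true)
      + free_node K (cnr t true false) + free_node K (cnr t true true)].

Lemma coveredU1 K t a : covered (t |` K)%fset a = in_tile t a || covered K a.
Proof.
apply/coveredP/orP => [[s]|[/in_tileP[b ->]|/coveredP[s sK h]]].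
- rewrite in_fset1U => /orP[/eqP -> h|sK h]; [left|right]; first exact/in_tileP.
  by apply/coveredP; exists s.
- by exists t; rewrite ?fset1U1 //; exists b.
- by exists s; rewrite // in_fset1U sK orbT.
Qed.

Lemma out_not_in_tile t d b : d != t.2 -> ~~ in_tile t (out t d b).
Proof.
move=> dt; apply/negP => /in_tileP[c h]; have := congr1 snd h.
rewrite /out flip2 !tri_of2 => e; subst c; move: h.
by rewrite /out -tri_of_flip => /flip_injr e; rewrite e eqxx in dt.
Qed.

(** The vertices are the free sides, in cyclic order [a], [b], [c], [e]; the edges are the free
    corners. A subgraph of a 4-cycle with at most one more vertex than edges is connected, because
    it is a forest unless it is the whole cycle. *)
Lemma four_cycle (X : Type) (Q : X -> X -> Prop) (a b c e : X)
    (ua ub uc ue f00 f01 f10 f11 : bool) :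
  (forall x y, Q x y -> Q y x) -> (forall x y z, Q x y -> Q y z -> Q x z) ->
  (f00 -> [/\ ua, ub & Q a b]) -> (f01 -> [/\ ua, ue & Q a e]) ->
  (f10 -> [/\ uc, ub & Q c b]) -> (f11 -> [/\ uc, ue & Q c e]) ->
  ua + uc + ub + ue <= 1 + f00 + f01 + f10 + f11 ->
  [/\ ua -> ub -> Q a b, ua -> ue -> Q a e, uc -> ub -> Q c b & uc -> ue -> Q c e] /\
  (ua -> uc -> Q a c) /\ (ub -> ue -> Q b e).
Proof.
move=> sym tr l00 l01 l10 l11.
have q00 : f00 -> Q a b by case/l00.
have q01 : f01 -> Q a e by case/l01.
have q10 : f10 -> Q c b by case/l10.
have q11 : f11 -> Q c e by case/l11.
have u00 : f00 -> ua && ub by case/l00 => -> ->.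
have u01 : f01 -> ua && ue by case/l01 => -> ->.
have u10 : f10 -> uc && ub by case/l10 => -> ->.
have u11 : f11 -> uc && ue by case/l11 => -> ->.
clear l00 l01 l10 l11.
have sy x y : Q x y -> Q y x := sym x y.
move=> cnt; split; [split|split] => h1 h2; rewrite ?h1 ?h2 in cnt u00 u01 u10 u11.
- have [/q00//|/and3P[/q01 k1 /q11 k2 /q10 k3]] : f00 \/ [&& f01, f11 & f10].
    by move: cnt u00 u01 u10 u11; clear; lia.
  exact: tr k1 (tr _ _ _ (sy _ _ k2) k3).
- have [/q01//|/and3P[/q00 k1 /q10 k2 /q11 k3]] : f01 \/ [&& f00, f10 & f11].
    by move: cnt u00 u01 u10 u11; clear; lia.
  exact: tr k1 (tr _ _ _ (sy _ _ k2) k3).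
- have [/q10//|/and3P[/q11 k1 /q01 k2 /q00 k3]] : f10 \/ [&& f11, f01 & f00].
    by move: cnt u00 u01 u10 u11; clear; lia.
  exact: tr k1 (tr _ _ _ (sy _ _ k2) k3).
- have [/q11//|/and3P[/q10 k1 /q00 k2 /q01 k3]] : f11 \/ [&& f10, f00 & f01].
    by move: cnt u00 u01 u10 u11; clear; lia.
  exact: tr k1 (tr _ _ _ (sy _ _ k2) k3).
- have [/andP[/q00 k1 /q10 k2]|/andP[/q01 k1 /q11 k2]] : f00 && f10 \/ f01 && f11.
    by move: cnt u00 u01 u10 u11; clear; lia.
  + exact: tr k1 (sy _ _ k2).
  + exact: tr k1 (sy _ _ k2).
- have [/andP[/q00 k1 /q01 k2]|/andP[/q10 k1 /q11 k2]] : f00 && f01 \/ f10 && f11.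
    by move: cnt u00 u01 u10 u11; clear; lia.
  + exact: tr (sy _ _ k1) k2.
  + exact: tr (sy _ _ k1) k2.
Qed.

(** A path of triangles uncovered by [K] that runs through [t] is rerouted around it. *)
Lemma shell_uconnected K t : uconnected K -> shell K t -> uconnected (t |` K)%fset.
Proof.
move=> uK /and3P[t0 t1 cnt]; have [h1 h2 h3] := ordS_pred t.2.
set d1 := ordS t.2 in cnt h1 h3; set d2 := ord_pred t.2 in cnt h2 h3.
pose Q := clos_refl_trans tri (ustep (t |` K)%fset).
have sym a b : Q a b -> Q b a.
  elim=> {a b} [a b [ua ub [d e]]|a|a b c _ k1 _ k2].
  - by apply: rt_step; split=> //; exists d; rewrite e flipK.
  - exact: rt_refl.
  - exact: rt_trans k2 k1.
have link b b' : free_node K (cnr t b b') ->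
    [/\ ~~ has_nb K t d1 b, ~~ has_nb K t d2 b' & Q (out t d1 b) (out t d2 b')].
  have /andP[c1 c2] := cnr_ends t b b'; set n := cnr t b b' in c1 c2 * => fr.
  have fr' a : n \in verts a -> ~~ covered K a.
    move=> na; apply/negP => /coveredP[s sK [c e]]; have := allP fr s sK.
    by rewrite mem_corners; case: c e => <-; rewrite na ?orbT.
  have [v1 w1] := ends_verts c1; have [v2 w2] := ends_verts c2.
  split; [exact: fr'|exact: fr'|].
  apply: (@arc_connected t n) => //; [exact: edge_corner c1| |exact: out_not_in_tile..].
  move=> a c na nc ta tc /existsP[d /eqP e].
  by split; [rewrite coveredU1 negb_or ta fr'|rewrite coveredU1 negb_or tc fr'|exists d].
have outs d b d' b' : d != t.2 -> d' != t.2 -> ~~ has_nb K t d b -> ~~ has_nb K t d' b' ->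
    Q (out t d b) (out t d' b').
  have [[k00 k01 k10 k11] [k1 k2]] := four_cycle sym (fun x y z => @rt_trans _ _ x y z)
    (link false false) (link false true) (link true false) (link true true) cnt.
  have dd e : e != t.2 -> e = d1 \/ e = d2.
    move=> et; have := mem_slots t e false; rewrite et !inE !xpair_eqE !andbF !orbF !andbT.
    by case/orP => /eqP ->; [left|right].
  move=> /dd[]-> /dd[]->; case: b; case: b' => n1 n2.
  - exact: rt_refl.
  - exact/sym/k1.
  - exact: k1.
  - exact: rt_refl.
  - exact: k11.
  - exact: k10.
  - exact: k01.
  - exact: k00.
  - exact/sym/k11.
  - exact/sym/k01.
  - exact/sym/k10.
  - exact/sym/k00.
  - exact: rt_refl.
  - exact/sym/k2.
  - exact: k2.
  - exact: rt_refl.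
(* The invariant along the path: outside [t] the current triangle can be reached, inside [t] every
   free outer neighbour of [t] can. *)
pose P a x := (~~ in_tile t x -> Q a x) /\
  (in_tile t x -> forall d b, d != t.2 -> ~~ has_nb K t d b -> Q a (out t d b)).
move=> a b; rewrite !coveredU1 => /norP[ta ua] /norP[tb ub].
suff [h _] : P a b by exact: h.
have pa : P a a by split=> [_|ha]; [exact: rt_refl|rewrite ha in ta].
have st x y : ustep K x y -> P a x -> P a y.
  case=> ux uy [d e] [p1 p2]; subst y.
  have isout z e : ~~ in_tile t z -> in_tile t (flip z e) -> exists c, z = out t e c /\ e != t.2.
    move=> tz /in_tileP[c hc]; exists c; split; first by rewrite /out -hc flipK.
    apply/eqP => ee; case/negP: tz; apply/in_tileP; exists (~~ c).
    by rewrite -tri_of_flip -ee -hc flipK.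
  split=> ty; case tx : (in_tile t x) p1 p2 => p1 p2.
  - have [|c [hc dt]] := isout (flip x d) d ty; first by rewrite flipK.
    by rewrite hc; apply: p2 => //; rewrite /has_nb -hc.
  - apply: rt_trans (p1 isT) _; apply: rt_step.
    by split; [rewrite coveredU1; apply/norP; rewrite tx|rewrite coveredU1; exact/norP|exists d].
  - by move=> e c et nc; exact: p2.
  - move=> e c et nc; have [|c' [hc dt]] := isout x d _ ty; first by rewrite tx.
    apply: rt_trans (p1 isT) _; rewrite hc; apply: outs => //.
    by rewrite /has_nb -hc.
suff gen x y : clos_refl_trans tri (ustep K) x y -> P a x -> P a y by exact: gen (uK a b ua ub) pa.
elim=> {x y} [x y|x|x y z _ k1 _ k2 h]; [exact: st|by []|exact: k2 (k1 h)].
Qed.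

End Shelling.

(** * Adding tiles while keeping the connectedness conditions *)

Section Growth.

Lemma tile_adjacent_sym s t : tile_adjacent s t = tile_adjacent t s.
Proof.
rewrite /tile_adjacent eq_sym; congr andb.
by apply/hasP/hasP => -[e e1 e2]; exists e.
Qed.

Lemma share_corner_sym s t : share_corner s t = share_corner t s.
Proof. by apply/hasP/hasP => -[n n1 n2]; exists n. Qed.

Lemma adjacent_share_corner s t : tile_adjacent s t -> share_corner s t.
Proof.
case/andP=> _ /hasP[e es et].
have mem u : e \in edges u -> e.1 \in corners u.
  rewrite mem_edges mem_corners => /andP[_ /existsP[b /eqP h]].
  have : e.1 \in ends e by exact: mem_head.
  by rewrite mem_ends; case: b h => -> /andP[h1 h2]; rewrite ?h1 ?h2 ?orbT.
by apply/hasP; exists e.1; exact: mem.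
Qed.

Lemma connected_underU1 (r : rel tile) (A : {fset tile}) s t : symmetric r ->
  connected_under r A -> s \in A -> r t s -> connected_under r (t |` A)%fset.
Proof.
move=> sym con sA ts.
pose Q := clos_refl_trans tile
  (fun x y => [/\ x \in (t |` A)%fset, y \in (t |` A)%fset & r x y]).
have emb x : x \in A -> x \in (t |` A)%fset by rewrite in_fset1U => ->; rewrite orbT.
have old x y : x \in A -> y \in A -> Q x y.
  by move=> xA yA; apply: clos_rt_map (con x y xA yA) => u v [uA vA uv]; split; rewrite ?emb.
have t1 : t \in (t |` A)%fset by exact: fset1U1.
have q1 : Q t s by apply: rt_step; split=> //; exact: emb.
have q2 : Q s t by apply: rt_step; split; [exact: emb|exact: t1|rewrite sym].
move=> x y; rewrite !in_fset1U => /orP[/eqP->|xA] /orP[/eqP->|yA].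
- exact: rt_refl.
- exact: rt_trans q1 (old _ _ sA yA).
- exact: rt_trans (old _ _ xA sA) q2.
- exact: old.
Qed.

Record good (K : {fset tile}) : Prop := {
  good_disjoint : tiles_disjoint K;
  good_uconnected : uconnected K;
  good_connected : connected_under tile_adjacent K;
  good_2connected : forall t, t \in K -> connected_under share_corner (K `\ t)%fset
}.

(** A tile that touches two old ones stays joined when any single old tile is removed, as (P3)
    demands. With at most one old tile, the removal leaves only the new one. *)
Definition attach (K : seq tile) (t : tile) : bool :=
  has (tile_adjacent t) K && ((size K <= 1) || (2 <= count (share_corner t) K)).

Lemma good1 t : good [fset t]%fset.
Proof.
have e : [fset t]%fset = (t |` fset0)%fset by rewrite fsetU0.
split.
- by move=> x y /fset1P -> /fset1P ->; rewrite eqxx.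
- rewrite e; apply: shell_uconnected; first exact: uconnected0.
  have u0 a : covered fset0 a = false.
    by apply/negbTE/existsPn => d; rewrite in_fset0.
  have f0 n : free_node (fset0 : {fset tile}) n by apply/allP => s; rewrite in_fset0.
  by rewrite /shell /has_nb !u0 !f0.
- by move=> x y /fset1P -> /fset1P ->; exact: rt_refl.
- by move=> s /fset1P -> x y; rewrite fsetDv in_fset0.
Qed.

Lemma good_step (K : {fset tile}) t : good K -> shell K t -> attach K t -> good (t |` K)%fset.
Proof.
move=> [gd gu gc g2] sh /andP[/hasP[s sK ts] at2]; have /and3P[t0 t1 _] := sh.
have tK x b : x \in K -> tri_of x b <> tri_of t b.
  move=> xK e; have := tile_covered b xK; rewrite e.
  by case: b {e} => h; [rewrite h in t1|rewrite h in t0].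
have ntK : t \notin K by apply/negP => h; exact: (tK t false h).
have con2 : connected_under share_corner K.
  move=> x y xK yK; apply: clos_rt_map (gc x y xK yK) => u v [uK vK uv].
  by split=> //; exact: adjacent_share_corner.
split.
- move=> x y; rewrite !in_fset1U => /orP[/eqP->|xK] /orP[/eqP->|yK] xy.
  + by rewrite eqxx in xy.
  + by apply/negP => /existsP[b /eqP e]; apply: (tK y b yK).
  + by apply/negP => /existsP[b /eqP e]; apply: (tK x b xK).
  + exact: gd.
- exact: shell_uconnected.
- by apply: connected_underU1 ts => //; exact: tile_adjacent_sym.
- move=> r; rewrite in_fset1U => rtK.
  have [->|rt] := eqVneq r t.
    by rewrite fsetU1K.
  have rK : r \in K by move: rtK; rewrite (negbTE rt).
  have -> : ((t |` K) `\ r)%fset = (t |` (K `\ r))%fset.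
    by apply/fsetP => x; rewrite !inE; case: (eqVneq x t) => [->|] //=; rewrite eq_sym rt.
  have [e|[q qK]] := fset_0Vmem (K `\ r)%fset.
    by rewrite e fsetU0 => x y /fset1P -> /fset1P ->; exact: rt_refl.
  have [u uK tu] : exists2 u, u \in (K `\ r)%fset & share_corner t u.
    case/orP: at2 => [sz|cnt].
      have : (size [:: r; q] <= size (enum_fset K))%N.
        move: qK; rewrite in_fsetD1 => /andP[qr qK].
        apply: uniq_leq_size; first by rewrite /= inE eq_sym qr.
        by move=> x; rewrite !inE => /orP[] /eqP ->.
      by move=> /= h; have := leq_trans h sz.
    have : has (predI (share_corner t) (predC1 r)) (enum_fset K).
      apply: contraT => /hasPn h.
      have : (size [seq x <- enum_fset K | share_corner t x] <= size [:: r])%N.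
        apply: uniq_leq_size; first by apply/filter_uniq/fset_uniq.
        move=> x; rewrite mem_filter inE => /andP[tx xK]; have := h x xK.
        by rewrite /= tx negbK.
      by rewrite size_filter => /(leq_trans cnt).
    by case/hasP=> u uK /andP[/= tu ur]; exists u => //; rewrite in_fsetD1 ur.
  by apply: connected_underU1 tu => //; [exact: share_corner_sym|exact: g2].
Qed.

Lemma mids_dirs T (t : tile) d d' : d != t.2 -> d' != t.2 -> d != d' ->
  mids T t = (mid_dir T t d + mid_dir T t d')%N.
Proof.
rewrite /mids; elim/ord3P: (t.2); elim/ord3P: d => //; elim/ord3P: d' => // _ _ _;
  rewrite !ordSE !ord_predE //; lia.
Qed.

Definition irr (T : {fset tile}) (tau rho : nat) : Prop :=
  [/\ (5 <= #|` T|%fset)%N, good T, three_runs T,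
      connected_under tile_adjacent (spine T) & (#|` T|%fset = tau /\ num_runs T = rho)].

Lemma irr_comb T tau rho : irr T tau rho -> tredoku_comb T.
Proof.
by case=> h1 [h2 h3 h4 h5] h6 _ _; split=> //; exact: three_runs_size.
Qed.

Lemma irr_irreducible (R : realType) T tau rho : irr T tau rho ->
  [/\ irreducible_tredoku R T, #|` T|%fset = tau & num_runs T = rho].
Proof.
move=> h; have c := irr_comb h; case: h => _ _ _ h4 [h5 h6]; split=> //.
by split=> //; apply/tredoku_combP.
Qed.

Lemma three_runs_lnk T : tiles_disjoint T -> three_runs T <->
  (forall t s d b, t \in T -> s \in T -> lnk d b t s ->
     has_nb T t d (~~ b) = ~~ has_nb T s d b).
Proof.
move=> disj; split=> h.
  move=> t s d b tT sT l; rewrite (h t d b tT (lnk_slot l) (lnk_has_nb sT l)).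
  by rewrite (lnk_nb disj sT l).
move=> t d b tT dt hn; have [sT l] := nbP disj tT dt hn; exact: h.
Qed.

Lemma mem_spine T t : (t \in spine T) =
  (t \in T) && ((tile_degree T t == 3) || (tile_degree T t == 4)).
Proof. by rewrite /spine !inE. Qed.

(** * Turning an end tile into the middle of a new run *)

Section Grow.
Variables (T : {fset tile}) (tau rho : nat) (L0 M A B : tile) (d d' : 'I_3) (b : bool).
Hypothesis irrT : irr T tau rho.
Hypotheses (LT : L0 \in T) (MT : M \in T) (lM : lnk d b L0 M).
Hypotheses (dL' : d' != L0.2) (dd : d != d').
Hypotheses (nd : ~~ has_nb T L0 d (~~ b)) (n0 : ~~ has_nb T L0 d' false)
  (n1 : ~~ has_nb T L0 d' true).
Hypotheses (shA : shell T A) (atA : attach T A).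
Hypotheses (shB : shell (A |` T)%fset B) (atB : attach (A |` T)%fset B).
Hypotheses (lA : lnk d' false L0 A) (lB : lnk d' true L0 B).

Local Notation T' := (B |` (A |` T))%fset.

Hypothesis cA : forall e c, e != A.2 -> has_nb T' A e c -> (e, c) = (d', true).
Hypothesis cB : forall e c, e != B.2 -> has_nb T' B e c -> (e, c) = (d', false).
Hypothesis cL : ~~ has_nb T' L0 d (~~ b).

Let goodT : good T. Proof. by case: irrT. Qed.
Let disj : tiles_disjoint T := good_disjoint goodT.
Let LrT : three_runs T. Proof. by case: irrT. Qed.

Let goodT' : good T'.
Proof. by do 2?apply: good_step. Qed.

Let disj' : tiles_disjoint T' := good_disjoint goodT'.

Let emb t : t \in T -> t \in T'.
Proof. by move=> tT; rewrite !in_fset1U tT !orbT. Qed.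

Let AT' : A \in T'. Proof. by rewrite !in_fset1U eqxx !orbT. Qed.
Let BT' : B \in T'. Proof. by rewrite !in_fset1U eqxx. Qed.
Let LT' := emb LT.
Let dL : d != L0.2 := lnk_slot lM.
Let lA' : lnk d' true A L0. Proof. by have := lA; rewrite -lnk_sym. Qed.
Let lB' : lnk d' false B L0. Proof. by have := lB; rewrite -lnk_sym. Qed.

Let AnT : A \notin T.
Proof.
by case/and3P: shA => h _ _; apply: contra h => h; exact: tile_covered.
Qed.

Let BnT : B \notin (A |` T)%fset.
Proof.
by case/and3P: shB => h _ _; apply: contra h => h; exact: tile_covered.
Qed.

Lemma grow_A t e c : t \in T' -> lnk e c A t -> [/\ e = d', c = true & t = L0].
Proof.
move=> tT l; have [? ?] := cA (lnk_slot l) (lnk_has_nb tT l); subst e c; split=> //.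
by rewrite -(lnk_nb disj' tT l) (lnk_nb disj' LT' lA').
Qed.

Lemma grow_B t e c : t \in T' -> lnk e c B t -> [/\ e = d', c = false & t = L0].
Proof.
move=> tT l; have [? ?] := cB (lnk_slot l) (lnk_has_nb tT l); subst e c; split=> //.
by rewrite -(lnk_nb disj' tT l) (lnk_nb disj' LT' lB').
Qed.

(** The new tiles are linked to [L0] only, and only in direction [d']. *)
Lemma grow_old t e c : t \in T -> e != t.2 -> (t, e) != (L0, d') ->
  has_nb T' t e c = has_nb T t e c.
Proof.
move=> tT et ne; rewrite /has_nb !coveredU1.
have kill s : s \in T' -> (forall e' c', lnk e' c' s t -> e' = d' /\ t = L0) ->
    in_tile s (out t e c) = false.
  move=> sT hs; apply/negP => /in_tileP[k hk].
  have hn : has_nb T' t e c by rewrite /has_nb hk tile_covered.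
  have [_ l] := nbP disj' (emb tT) et hn; rewrite /nb hk (covering_tri disj' _ sT) in l.
  rewrite -lnk_sym in l; have [e1 e2] := hs _ _ l.
  by rewrite e1 e2 eqxx in ne.
rewrite (kill B) // ?(kill A) // => e' c' l.
  by have [-> _ ->] := grow_A (emb tT) l.
by have [-> _ ->] := grow_B (emb tT) l.
Qed.

Let hL c : has_nb T' L0 d' c.
Proof. by case: c; [exact: lnk_has_nb lB|exact: lnk_has_nb lA]. Qed.

Let hA e c : e != A.2 -> (e, c) != (d', true) -> has_nb T' A e c = false.
Proof. by move=> eA ne; apply/negbTE/negP => h; move: ne; rewrite (cA eA h) eqxx. Qed.

Let hB e c : e != B.2 -> (e, c) != (d', false) -> has_nb T' B e c = false.
Proof. by move=> eB ne; apply/negbTE/negP => h; move: ne; rewrite (cB eB h) eqxx. Qed.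

Let dA : d' != A.2 := lnk_slot lA'.
Let dB : d' != B.2 := lnk_slot lB'.

Lemma grow_three : three_runs T'.
Proof.
apply/(three_runs_lnk disj').
have new t s e c : t \in [:: A; B] -> s \in T' -> lnk e c t s ->
    has_nb T' t e (~~ c) = ~~ has_nb T' s e c.
  move=> tAB sT; move: tAB; rewrite !inE => /orP[] /eqP -> l.
    have [-> -> ->] := grow_A sT l; rewrite hL hA //; by rewrite xpair_eqE eqxx.
  have [-> -> ->] := grow_B sT l; rewrite hL hB //; by rewrite xpair_eqE eqxx.
have inT t : t \in T' -> t \in [:: A; B] \/ t \in T.
  by rewrite !in_fset1U !inE => /or3P[/eqP->|/eqP->|->]; [left|left|right]; rewrite ?eqxx ?orbT.
move=> t s e c tT sT l; have l' := l; rewrite -lnk_sym in l'.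
case: (inT t tT) => [|tT0]; first by move/new; apply.
case: (inT s sT) => [/new /(_ tT l')|sT0].
  by rewrite negbK => ->; rewrite negbK.
have nL u v k : u \in T -> v \in T -> lnk e k u v -> (u, e) != (L0, d').
  move=> uT vT lk; apply/eqP => -[eu ee]; subst u e; have := lnk_has_nb vT lk.
  by case: k {lk} => h; [have := n1|have := n0]; rewrite h.
rewrite !grow_old ?(lnk_slot l) ?(lnk_slot l') //.
- by move/(three_runs_lnk disj): LrT; apply.
- exact: nL l'.
- exact: nL l.
Qed.

Lemma grow_old_neq t e c : t \in T -> t != L0 -> e != t.2 -> has_nb T' t e c = has_nb T t e c.
Proof.
by move=> tT tL et; apply: grow_old => //; rewrite xpair_eqE negb_and tL.
Qed.

Lemma grow_mids_old t : t \in T -> t != L0 -> mids T' t = mids T t.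
Proof.
move=> tT tL; have [h1 h2 h3] := ordS_pred t.2.
by rewrite !(mids_dirs _ h1 h2 h3) /mid_dir !grow_old_neq.
Qed.

Lemma grow_deg_old t : t \in T -> t != L0 -> tile_degree T' t = tile_degree T t.
Proof.
move=> tT tL; have [h1 h2 h3] := ordS_pred t.2.
rewrite (degree_dirs disj' (emb tT) h1 h2 h3) (degree_dirs disj tT h1 h2 h3).
by rewrite !grow_old_neq.
Qed.

Lemma grow_L : [/\ tile_degree T' L0 = 3, mids T' L0 = 1 & mids T L0 = 0].
Proof.
have hM : has_nb T' L0 d b by apply: (lnk_has_nb (emb MT) lM).
rewrite (degree_dirs disj' LT' dL dL' dd) !(mids_dirs _ dL dL' dd) /mid_dir !hL.
rewrite (negbTE n0) andFb; move: nd cL hM.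
by case: (b) => /= /negbTE -> /negbTE -> ->; rewrite ?andbF.
Qed.

Lemma grow_new t : t \in [:: A; B] -> (tile_degree T' t <= 1)%N /\ mids T' t = 0.
Proof.
rewrite !inE => /orP[] /eqP ->.
  have [e [eA ne]] := other_dir dA.
  have ne' : forall c, (e, c) != (d', true) by move=> c; rewrite xpair_eqE eq_sym (negbTE ne).
  rewrite (degree_dirs disj' AT' dA eA ne) (mids_dirs _ dA eA ne) /mid_dir !(hA eA (ne' _)).
  by rewrite (hA dA) ?xpair_eqE ?eqxx //; case: (has_nb _ _ _ _).
have [e [eB ne]] := other_dir dB.
have ne' : forall c, (e, c) != (d', false) by move=> c; rewrite xpair_eqE eq_sym (negbTE ne).
rewrite (degree_dirs disj' BT' dB eB ne) (mids_dirs _ dB eB ne) /mid_dir !(hB eB (ne' _)).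
by rewrite (hB (c := true) dB) ?xpair_eqE ?eqxx //; case: (has_nb _ _ _ _).
Qed.

(** The only new run is [A], [L0], [B]. The spine gains just [L0], which is adjacent to [M], the
    middle of the run that ends at [L0]. *)
Lemma grow_irr : irr T' tau.+2 rho.+1.
Proof.
have comb := irr_comb irrT.
case: irrT => szT _ _ spT [eT er].
have cardT' : #|` T'|%fset = tau.+2 by rewrite !cardfsU1 BnT AnT eT.
have [L3 mL' mL] := grow_L.
have [dA1 mA] := grow_new (mem_head _ _).
have [dB1 mB] : (tile_degree T' B <= 1)%N /\ mids T' B = 0.
  by apply: grow_new; rewrite !inE eqxx orbT.
split; [by rewrite cardT' -eT (leq_trans szT) // ltnW|exact: goodT'|exact: grow_three| |split=> //].
- have -> : spine T' = (L0 |` spine T)%fset.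
    apply/fsetP => t; rewrite [in RHS]in_fset1U.
    have [->|tL] := eqVneq t L0.
      by rewrite mem_spine LT' L3.
    rewrite !mem_spine in_fset1U in_fset1U.
    have [->|tB] := eqVneq t B.
      have -> : (B \in T) = false.
        by apply/negbTE; apply: contra BnT; rewrite in_fset1U => ->; rewrite orbT.
      by case: (tile_degree T' B) dB1 => [|[|]].
    have [->|tA] := eqVneq t A.
      by rewrite (negbTE AnT) /=; case: (tile_degree T' A) dA1 => [|[|]].
    by case tT : (t \in T) => //=; rewrite grow_deg_old.
  (* [L0] has no neighbour opposite to [M], so their run must continue beyond [M]. *)
  have hMd : mid_dir T M d.
    have lM' := lM; rewrite -lnk_sym in lM'; have h2 := lnk_has_nb LT lM'.
    have := LrT LT dL (lnk_has_nb MT lM); rewrite (lnk_nb disj MT lM) (negbTE nd).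
    by move/esym/negbFE; rewrite /mid_dir; move: h2; case: (b) => /= -> ->.
  have dM : d != M.2 by move: lM; rewrite -lnk_sym => /lnk_slot.
  have MS := mid_spine comb MT dM hMd.
  apply: connected_underU1 spT MS _; first exact: tile_adjacent_sym.
  rewrite tile_adjacent_sym; apply/(adjacentP disj MT LT); by exists d, b.
- rewrite (num_runsE disj' grow_three) !big_fsetU1 //= mA mB !add0n.
  rewrite (big_fsetD1 L0 LT) /= mL' -er (num_runsE disj LrT) (big_fsetD1 L0 LT) /= mL add0n add1n.
  congr S; rewrite !big_seq; apply: eq_bigr => t; rewrite in_fsetD1 => /andP[tL tT].
  exact: grow_mids_old.
Qed.

End Grow.
End Growth.

(** * Growing tails *)

Section Lists.

(** Boolean counterparts on lists, for verifying the explicit tilings by evaluation; [check_irr]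
    transfers them to finite sets. *)
Definition covs (s : seq tile) (a : tri) : bool := has (fun t => in_tile t a) s.

Definition hns (s : seq tile) (t : tile) (d : 'I_3) (b : bool) : bool := covs s (out t d b).

Definition shells (s : seq tile) (t : tile) : bool :=
  [&& ~~ covs s (tri_of t false), ~~ covs s (tri_of t true) &
   ~~ hns s t (ordS t.2) false + ~~ hns s t (ordS t.2) true
   + ~~ hns s t (ord_pred t.2) false + ~~ hns s t (ord_pred t.2) true
   <= 1 + free_node s (cnr t false false) + free_node s (cnr t false true)
      + free_node s (cnr t true false) + free_node s (cnr t true true)].

Fixpoint build (s : seq tile) : bool :=
  if s is t :: s' then (s' == [::]) || [&& build s', shells s' t & attach s' t] else false.

Definition degs (s : seq tile) (t : tile) : nat :=
  hns s t (ordS t.2) false + hns s t (ordS t.2) true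
  + hns s t (ord_pred t.2) false + hns s t (ord_pred t.2) true.

Definition midss (s : seq tile) (t : tile) : nat :=
  (hns s t (ordS t.2) false && hns s t (ordS t.2) true)
  + (hns s t (ord_pred t.2) false && hns s t (ord_pred t.2) true).

Definition threes (s : seq tile) : bool :=
  all (fun t => all (fun u => all (fun d => all (fun b =>
    lnk d b t u ==> (hns s t d (~~ b) == ~~ hns s u d b)) [:: false; true])
      [:: o0; o1; o2]) s) s.

(** A sufficient test that depends on the order of the list: every tile but the last is adjacent to
    a later one. *)
Fixpoint conn_order (s : seq tile) : bool :=
  if s is t :: s' then ((s' == [::]) || has (tile_adjacent t) s') && conn_order s' else true.

Definition spines (s : seq tile) : seq tile :=
  [seq t <- s | (degs s t == 3) || (degs s t == 4)].

Definition check (s : seq tile) (rho : nat) : bool :=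
  [&& 5 <= size s, build s, threes s, conn_order (spines s) & sumn [seq midss s t | t <- s] == rho].

Lemma mem_fset_seq (s : seq tile) x : (x \in [fset x in s]%fset) = (x \in s).
Proof. by apply/imfsetP/idP => [[y /= ys ->]|xs] //; exists x. Qed.

Lemma covered_seq s a : covered [fset x in s]%fset a = covs s a.
Proof.
apply/coveredP/hasP => [[t ts [b ->]]|[t ts /in_tileP[b ->]]].
  by exists t; [rewrite -mem_fset_seq|apply/in_tileP; exists b].
by exists t; [rewrite mem_fset_seq|exists b].
Qed.

Lemma fset_seq_cons t (s : seq tile) : [fset x in t :: s]%fset = (t |` [fset x in s])%fset.
Proof. by apply/fsetP => x; rewrite in_fset1U !mem_fset_seq in_cons. Qed.

Lemma perm_fset_seq (s : seq tile) : uniq s -> perm_eq (enum_fset [fset x in s]%fset) s.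
Proof.
by move=> us; apply: uniq_perm; [exact: fset_uniq|exact: us|exact: mem_fset_seq].
Qed.

Lemma build_good s : build s -> uniq s /\ good [fset x in s]%fset.
Proof.
elim: s => //= t s IHs /orP[/eqP ->|/and3P[/IHs[us gs] sh at_s]].
  split=> //; have -> : [fset x in [:: t]]%fset = [fset t]%fset.
    by apply/fsetP => x; rewrite in_fset1 mem_fset_seq mem_seq1.
  exact: good1.
have pe := perm_fset_seq us.
have fr n : free_node [fset x in s]%fset n = free_node s n by exact: perm_all.
split.
  rewrite us andbT; case/and3P: sh => h _ _; apply: contra h => ts.
  by apply/hasP; exists t => //; apply/in_tileP; exists false.
rewrite fset_seq_cons; apply: good_step => //.
  by rewrite /shell /has_nb !covered_seq !fr.
move: at_s; rewrite /attach (perm_has _ pe) (perm_size pe).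
by move/permP: pe => ->.
Qed.

Lemma conn_order_connected s : conn_order s -> connected_under tile_adjacent [fset x in s]%fset.
Proof.
elim: s => [_ x y|t s IHs /= /andP[h /IHs cs]]; first by rewrite mem_fset_seq.
case/orP: h => [/eqP ->|/hasP[u us tu]].
  by move=> x y; rewrite !mem_fset_seq !mem_seq1 => /eqP -> /eqP ->; exact: rt_refl.
rewrite fset_seq_cons; apply: connected_underU1 tu => //; first exact: tile_adjacent_sym.
by rewrite mem_fset_seq.
Qed.

Lemma check_irr s rho : check s rho -> irr [fset x in s]%fset (size s) rho.
Proof.
case/and5P=> s5 /build_good[us gs] /allP th co /eqP sm.
have disj := good_disjoint gs; have pe := perm_fset_seq us.
have card_s : #|` [fset x in s]%fset|%fset = size s by exact: perm_size.
have hn t d b : has_nb [fset x in s]%fset t d b = hns s t d b by exact: covered_seq.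
have L : three_runs [fset x in s]%fset.
  apply/(three_runs_lnk disj) => t u d b; rewrite !mem_fset_seq => ts uS l; rewrite !hn.
  have /allP/(_ u uS)/allP/(_ d) := th t ts.
  have -> : d \in [:: o0; o1; o2] by elim/ord3P: d {l}.
  by move=> /(_ isT)/allP/(_ b); rewrite l => /= h; apply/eqP/h; case: (b).
split=> //; first by rewrite card_s.
- have -> : spine [fset x in s]%fset = [fset x in spines s]%fset.
    apply/fsetP => t; rewrite mem_spine !mem_fset_seq /spines mem_filter andbC.
    by case ts : (t \in s); rewrite ?andbF // (tile_degreeE disj) ?mem_fset_seq // !hn.
  exact: conn_order_connected.
- split=> //; rewrite (num_runsE disj L) (perm_big _ pe) /= -sm sumnE big_map.
  by apply: eq_bigr => t _; rewrite /mids /mid_dir !hn.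
Qed.

End Lists.

(** * Staircases and the explicit starting tilings *)

Section Tail.
Local Open Scope ring_scope.

(* The end of a staircase: [tail0 p] is its last tile, preceded by [tail1 ph p] (to
   the left if [ph] is false, below if [ph] is true) and [tail2 p]; all other tiles
   lie behind the line through [p] of direction w. *)
Definition bounded (ph : bool) (p n : node) : bool :=
  (n.1 + n.2 < p.1 + p.2) || (n.1 + n.2 == p.1 + p.2) && (if ph then n.2 < p.2 else n.1 < p.1).

Definition tail0 (p : node) : tile := (p, o2).
Definition tail1 (ph : bool) (p : node) : tile :=
  (if ph then (p.1, p.2 - 1) else (p.1 - 1, p.2), o2).
Definition tail2 (p : node) : tile := ((p.1 - 1, p.2 - 1), o2).

Definition tail_tile (ph : bool) (p : node) (t : tile) : bool :=
  [|| t == tail0 p, t == tail1 ph p, t == tail2 p | all (bounded ph p) (corners t)].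

Definition tail (ph : bool) (p : node) (T : seq tile) : bool :=
  [&& all (tail_tile ph p) T, tail0 p \in T & tail1 ph p \in T].

Lemma tail_covered ph p (T : {fset tile}) a : tail ph p T -> covered T a ->
  [|| in_tile (tail0 p) a, in_tile (tail1 ph p) a, in_tile (tail2 p) a
    | all (bounded ph p) (verts a)].
Proof.
case/and3P=> /allP h _ _ /coveredP[t tT [b ->]].
have ta : in_tile t (tri_of t b) by apply/in_tileP; exists b.
case/or4P: (h t tT) => [/eqP <-|/eqP <-|/eqP <-|/allP hb]; rewrite ?ta ?orbT //.
apply/or4P; constructor 4; apply/allP => n nv; apply: hb; rewrite mem_corners.
by case: b {ta} nv => ->; rewrite ?orbT.
Qed.

Lemma tail_free ph p (T : {fset tile}) n : tail ph p T ->
  ~~ [|| n \in corners (tail0 p), n \in corners (tail1 ph p), n \in corners (tail2 p)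
       | bounded ph p n] -> free_node T n.
Proof.
case/and3P=> /allP h _ _ /norP[h0 /norP[h1 /norP[h2 h3]]].
apply/allP => t tT; case/or4P: (h t tT) => [/eqP ->|/eqP ->|/eqP ->|/allP hb] //.
by apply: contra h3 => /hb.
Qed.

Lemma count_ge2 (K : {fset tile}) (q : pred tile) s t :
  s \in K -> t \in K -> s != t -> q s -> q t -> (2 <= count q K)%N.
Proof.
move=> sK tK st qs qt; rewrite -size_filter -[2%N]/(size [:: s; t]).
apply: uniq_leq_size; first by rewrite /= inE st.
by move=> x; rewrite !inE mem_filter => /orP[] /eqP ->; rewrite ?qs ?qt.
Qed.

(** One side is covered, so at most three are free, and two free corners permit that many. *)
Lemma leaf_shell (K : {fset tile}) t d b c c' e e' : ~~ covered K (tri_of t false) ->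
  ~~ covered K (tri_of t true) -> d != t.2 -> has_nb K t d b ->
  (c, c') != (e, e') -> free_node K (cnr t c c') -> free_node K (cnr t e e') -> shell K t.
Proof.
move=> h0 h1 dt hn ne f1 f2; rewrite /shell h0 h1 /=.
have le3 : (~~ has_nb K t (ordS t.2) false + ~~ has_nb K t (ordS t.2) true
   + ~~ has_nb K t (ord_pred t.2) false + ~~ has_nb K t (ord_pred t.2) true <= 3)%N.
  have := mem_slots t d b; rewrite dt !inE !xpair_eqE => h; move: hn.
  by case/or4P: h => /andP[/eqP -> /eqP ->] ->; do 3!case: (has_nb _ _ _ _).
apply: leq_trans le3 _; move: ne f1 f2.
by case: c; case: c'; case: e; case: e' => //= _ -> ->; do 2!case: (free_node _ _).
Qed.

Ltac lattice := rewrite /shell /lnk /tile_adjacent /share_corner /tail_tile /in_tile /bounded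
  /tail0 /tail1 /tail2 ?edgesE ?cornersE /= ?inE ?xpair_eqE /= ?ord3_eqE ?eqxx ?andbF ?andbT ?orbF
  ?orbT /=; lia.

(** Of the two leaves added beside [tail0 p], the leaf [B] continues the staircase at a right turn
    in lattice coordinates, which flips [ph]; the leaf [A] falls behind the new line. *)
Lemma tail_step ph p (T : {fset tile}) tau rho : irr T tau rho -> tail ph p T ->
  exists T' : {fset tile}, exists2 p', irr T' tau.+2 rho.+1 & tail (~~ ph) p' T'.
Proof.
move=> irrT tl; have /and3P[/allP hT LT MT] := tl.
have unc a : ~~ [|| in_tile (tail0 p) a, in_tile (tail1 ph p) a, in_tile (tail2 p) a
    | all (bounded ph p) (verts a)] -> ~~ covered T a.
  by apply: contra; exact: tail_covered.
have fr n : ~~ [|| n \in corners (tail0 p), n \in corners (tail1 ph p), n \in corners (tail2 p)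
       | bounded ph p n] -> free_node T n by exact: tail_free.
have frU (K : {fset tile}) t n : n \notin corners t -> free_node K n -> free_node (t |` K)%fset n.
  move=> nt /allP fK; apply/allP => s; rewrite in_fset1U => /orP[/eqP -> //|]; exact: fK.
have att (K : {fset tile}) t : tail0 p \in K -> tail1 ph p \in K -> tile_adjacent t (tail0 p) ->
    share_corner t (tail0 p) -> share_corner t (tail1 ph p) -> attach K t.
  move=> h0 h1 ad s0 s1; apply/andP; split; first by apply/hasP; exists (tail0 p).
  apply/orP; right; apply: (count_ge2 h0 h1) => //.
  by case: (p); case: (ph) => u v; clear; lattice.
have disj : tiles_disjoint T by case: irrT => _ [].
case: p ph LT MT tl hT unc fr att => x y [] LT MT tl hT unc fr att.
(* An upright rhombus of orientation [o2] on the left would share an edge with [tail2]. The slanted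
   [A] meets [tail1] and [tail2] only at the corner [(x, y)]. *)
- pose A : tile := ((x, y), o0); pose B : tile := ((x + 1, y), o2).
  have lA : lnk o1 false (tail0 (x, y)) A by clear; lattice.
  have lB : lnk o1 true (tail0 (x, y)) B by clear; lattice.
  have lA' : lnk o1 true A (tail0 (x, y)) by clear; lattice.
  have lB' : lnk o1 false B (tail0 (x, y)) by clear; lattice.
  have LT1 : tail0 (x, y) \in (A |` T)%fset by rewrite in_fset1U LT orbT.
  have MT1 : tail1 true (x, y) \in (A |` T)%fset by rewrite in_fset1U MT orbT.
  have shA : shell T A.
    apply: (@leaf_shell T A o1 true false false false true) => //.
    + by apply: unc; clear; lattice.
    + by apply: unc; clear; lattice.
    + exact: lnk_has_nb lA'.
    + by apply: fr; clear; lattice.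
    + by apply: fr; clear; lattice.
  have shB : shell (A |` T)%fset B.
    apply: (@leaf_shell _ B o1 false false true true true) => //.
    + rewrite coveredU1; apply/norP; split; [by clear; lattice|by apply: unc; clear; lattice].
    + rewrite coveredU1; apply/norP; split; [by clear; lattice|by apply: unc; clear; lattice].
    + exact: lnk_has_nb lB'.
    + by apply: frU; [clear; lattice|apply: fr; clear; lattice].
    + by apply: frU; [clear; lattice|apply: fr; clear; lattice].
  exists (B |` (A |` T))%fset, (x + 1, y).
    apply: (@grow_irr T tau rho (tail0 (x, y)) (tail1 true (x, y)) A B o0 o1 false) => //.
    + by clear; lattice.
    + by apply: unc; clear; lattice.
    + by apply: unc; clear; lattice.
    + by apply: unc; clear; lattice.
    + by apply: att => //; clear; lattice.
    + by apply: att => //; clear; lattice.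
    + move=> e c; elim/ord3P: e => //= _; case: c => //; rewrite /has_nb !coveredU1
        => /or3P[h|h|/(tail_covered tl) h]; exfalso; move: h; clear; lattice.
    + move=> e c; elim/ord3P: e => //= _; case: c => //; rewrite /has_nb !coveredU1
        => /or3P[h|h|/(tail_covered tl) h]; exfalso; move: h; clear; lattice.
    + rewrite /has_nb !coveredU1; apply/norP; split; first by clear; lattice.
      by apply/norP; split; [clear; lattice|apply: unc; clear; lattice].
  (* The last three positions shift by one: [B], the old [tail0] and the old [tail1]. The old
     [tail2] and [A] are bounded with respect to the new end. *)
  apply/and3P; split.
  + apply/allP => t; rewrite !in_fset1U => /or3P[/eqP ->|/eqP ->|/hT].
    * by clear; lattice.
    * by clear; lattice.
    * case/or4P => [/eqP ->|/eqP ->|/eqP ->|/allP h]; [clear; lattice..|].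
      apply/or4P; constructor 4; apply/allP => n /h; case: n => u v; clear; lattice.
  + by rewrite fset1U1.
  + rewrite !in_fset1U (_ : tail1 false (x + 1, y) = tail0 (x, y)) ?LT ?orbT //.
    by apply/eqP; clear; lattice.
(* The mirror image of the previous case under exchange of the two coordinates. *)
- pose A : tile := ((x + 1, y - 1), o1); pose B : tile := ((x, y + 1), o2).
  have lA : lnk o0 false (tail0 (x, y)) A by clear; lattice.
  have lB : lnk o0 true (tail0 (x, y)) B by clear; lattice.
  have lA' : lnk o0 true A (tail0 (x, y)) by clear; lattice.
  have lB' : lnk o0 false B (tail0 (x, y)) by clear; lattice.
  have LT1 : tail0 (x, y) \in (A |` T)%fset by rewrite in_fset1U LT orbT.
  have MT1 : tail1 false (x, y) \in (A |` T)%fset by rewrite in_fset1U MT orbT.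
  have shA : shell T A.
    apply: (@leaf_shell T A o0 true false false true false) => //.
    + by apply: unc; clear; lattice.
    + by apply: unc; clear; lattice.
    + exact: lnk_has_nb lA'.
    + by apply: fr; clear; lattice.
    + by apply: fr; clear; lattice.
  have shB : shell (A |` T)%fset B.
    apply: (@leaf_shell _ B o0 false true false true true) => //.
    + rewrite coveredU1; apply/norP; split; [by clear; lattice|by apply: unc; clear; lattice].
    + rewrite coveredU1; apply/norP; split; [by clear; lattice|by apply: unc; clear; lattice].
    + exact: lnk_has_nb lB'.
    + by apply: frU; [clear; lattice|apply: fr; clear; lattice].
    + by apply: frU; [clear; lattice|apply: fr; clear; lattice].
  exists (B |` (A |` T))%fset, (x, y + 1).
    apply: (@grow_irr T tau rho (tail0 (x, y)) (tail1 false (x, y)) A B o1 o0 false) => //.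
    + by clear; lattice.
    + by apply: unc; clear; lattice.
    + by apply: unc; clear; lattice.
    + by apply: unc; clear; lattice.
    + by apply: att => //; clear; lattice.
    + by apply: att => //; clear; lattice.
    + move=> e c; elim/ord3P: e => //= _; case: c => //; rewrite /has_nb !coveredU1
        => /or3P[h|h|/(tail_covered tl) h]; exfalso; move: h; clear; lattice.
    + move=> e c; elim/ord3P: e => //= _; case: c => //; rewrite /has_nb !coveredU1
        => /or3P[h|h|/(tail_covered tl) h]; exfalso; move: h; clear; lattice.
    + rewrite /has_nb !coveredU1; apply/norP; split; first by clear; lattice.
      by apply/norP; split; [clear; lattice|apply: unc; clear; lattice].
  apply/and3P; split.
  + apply/allP => t; rewrite !in_fset1U => /or3P[/eqP ->|/eqP ->|/hT].
    * by clear; lattice.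
    * by clear; lattice.
    * case/or4P => [/eqP ->|/eqP ->|/eqP ->|/allP h]; [clear; lattice..|].
      apply/or4P; constructor 4; apply/allP => n /h; case: n => u v; clear; lattice.
  + by rewrite fset1U1.
  + rewrite !in_fset1U (_ : tail1 true (x, y + 1) = tail0 (x, y)) ?LT ?orbT //.
    by apply/eqP; clear; lattice.
Qed.

Lemma tail_grow n : forall ph p (T : {fset tile}) tau rho, irr T tau rho -> tail ph p T ->
  exists T' : {fset tile}, irr T' (tau + 2 * n)%N (rho + n)%N.
Proof.
elim: n => [|n IHn] ph p T tau rho h tl; first by exists T; rewrite muln0 !addn0.
have [T' [p' h' tl']] := tail_step h tl; have [T'' h''] := IHn _ _ _ _ _ h' tl'.
have e1 : (tau + 2 * n.+1 = tau.+2 + 2 * n)%N by clear; lia.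
have e2 : (rho + n.+1 = rho.+1 + n)%N by clear; lia.
by exists T''; rewrite e1 e2.
Qed.

(* Tilings with tau tiles and rho runs, named after (tau, rho).  The last tile of a
   list is its 4-tile, and [build] adds the others from right to left. *)
Definition small_5_2 : seq tile :=
  [:: ((2, -1), o0); ((0, 1), o2); ((0, 0), o0); ((0, -1), o2); ((0, 0), o2)].

Definition small_7_3 : seq tile :=
  [:: ((2, -1), o0); ((1, 1), o2); ((0, 1), o0); ((0, 1), o2); ((0, -1), o2);
      ((-1, 0), o2); ((0, 0), o2)].

Definition small_6_3 : seq tile :=
  [:: ((2, 0), o1); ((2, -1), o0); ((1, -1), o1); ((0, 1), o2); ((0, 0), o0); ((0,
      0), o2)].

Definition small_7_4 : seq tile :=
  [:: ((2, 0), o0); ((2, -1), o0); ((1, -1), o1); ((0, 1), o0); ((0, 1), o2);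
      ((-1, 0), o2); ((0, 0), o2)].

Definition small_8_5 : seq tile :=
  [:: ((2, -1), o1); ((1, 1), o1); ((1, 0), o2); ((0, -1), o1); ((1, -1), o1);
      ((0, 1), o1); ((0, 0), o0); ((0, 0), o2)].

Definition small_9_6 : seq tile :=
  [:: ((2, 0), o0); ((2, -1), o0); ((2, -2), o0); ((0, 1), o2); ((0, -1), o2);
      ((-1, 1), o2); ((-1, -1), o2); ((-1, 0), o2); ((0, 0), o2)].

Definition tailed_8_4 : seq tile :=
  [:: ((1, 2), o2); ((1, 1), o2); ((1, 0), o2); ((0, 1), o0); ((0, 1), o2); ((0, -1),
      o2); ((-1, 0), o2); ((0, 0), o2)].

Definition tailed_9_5 : seq tile :=
  [:: ((2, 1), o2); ((2, -1), o1); ((1, 1), o2); ((1, 1), o0); ((1, 0), o2); ((0, 1),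
      o1); ((0, 0), o0); ((0, -1), o2); ((0, 0), o2)].

Definition tailed_10_6 : seq tile :=
  [:: ((2, 0), o1); ((2, -1), o0); ((1, 2), o2); ((1, 1), o2); ((1, -1), o1); ((0,
      1), o2); ((0, 1), o0); ((0, -1), o0); ((0, 0), o0); ((0, 0), o2)].

Definition tailed_11_7 : seq tile :=
  [:: ((2, 0), o1); ((2, -1), o0); ((2, -2), o0); ((1, 2), o2); ((1, 1), o2); ((0,
      1), o2); ((0, 1), o0); ((0, 0), o0); ((0, -1), o0); ((0, -1), o2); ((0, 0),
      o2)].


End Tail.

Lemma check_tail ph p s rho n : check s rho -> tail ph p s ->
  exists T : {fset tile}, irr T (size s + 2 * n)%N (rho + n)%N.
Proof.
move=> ck tl; apply: (tail_grow n (check_irr ck) (ph := ph) (p := p)).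
have us : uniq s by have /and5P[_ /build_good[]] := ck.
case/and3P: tl => h0 h1 h2; apply/and3P; rewrite !mem_fset_seq; split=> //.
by rewrite (perm_all _ (perm_fset_seq us)).
Qed.

Theorem theorem2 (R : realType) :
  [/\ exists T : {fset tile},
        [/\ irreducible_tredoku R T, #|` T|%fset = 5 & num_runs T = 2],
      exists T : {fset tile},
        [/\ irreducible_tredoku R T, #|` T|%fset = 7 & num_runs T = 3],
      forall (T : {fset tile}) (tau rho : nat),
        irreducible_tredoku R T -> #|` T|%fset = tau -> num_runs T = rho ->
        (tau, rho) <> (5, 2) -> (tau, rho) <> (7, 3) ->
        2 * rho - 3 <= tau <= 2 * rho
    & forall k rho : nat, k <= 3 -> 3 + k <= rho ->
        exists T : {fset tile},
          [/\ irreducible_tredoku R T, #|` T|%fset = 2 * rho - k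
            & num_runs T = rho]].
Proof.
have base s rho : check s rho -> exists T : {fset tile},
    [/\ irreducible_tredoku R T, #|` T|%fset = size s & num_runs T = rho].
  by move=> /check_irr h; exists [fset x in s]%fset; exact: irr_irreducible.
split.
- by apply: (base small_5_2); vm_compute.
- by apply: (base small_7_3); vm_compute.
- exact: irreducible_bounds.
move=> k rho k3 hrho.
have [n e] : exists n, rho = 3 + k + n by exists (rho - (3 + k)); rewrite subnKC.
(* For each [k] the smallest case [rho = 3 + k] has a tiling of its own; the staircases start at
   [rho = 4 + k]. *)
case: n e => [|n] e.
  rewrite addn0 in e; subst rho; case: k k3 {hrho} => [|[|[|[|//]]]] _.
  - by apply: (base small_6_3); vm_compute.
  - by apply: (base small_7_4); vm_compute.
  - by apply: (base small_8_5); vm_compute.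
  - by apply: (base small_9_6); vm_compute.
(* Each staircase step adds two tiles and one run, so [2 rho - tau = k] is preserved. *)
have fam ph p s : check s (4 + k) -> tail ph p s -> size s = 2 * (4 + k) - k ->
    exists T : {fset tile}, [/\ irreducible_tredoku R T, #|` T|%fset = 2 * rho - k & num_runs T = rho].
  move=> ck tl sz; have [T h] := check_tail n ck tl; exists T.
  have e1 : 2 * rho - k = size s + 2 * n by rewrite sz e; move: k3; clear; lia.
  have e2 : rho = 4 + k + n by rewrite e; clear; lia.
  by rewrite e1 [X in num_runs T = X]e2; exact: irr_irreducible.
case: k k3 {hrho e} fam => [|[|[|[|//]]]] _ fam.
- by apply: (fam true (1, 2)%R tailed_8_4); vm_compute.
- by apply: (fam false (2, 1)%R tailed_9_5); vm_compute.
- by apply: (fam true (1, 2)%R tailed_10_6); vm_compute.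
- by apply: (fam true (1, 2)%R tailed_11_7); vm_compute.
Qed.
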